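(* Let $\mathcal{A}$ be a small block-stable class of graphs and let $\mathcal{B}\subset\mathcal{A}$ be the subclass of all graphs that are $2$-connected or consist of two vertices joined by a single edge. Assume that $\mathcal{B}$ is non-empty, and let $d$ denote the greatest common divisor of all integers $k$ with $[z^k]\exp(\mathcal{B}'(z))>0$. Then the graph class $\mathcal{A}$ is smooth if and only if $d=1$.
   Context: Graphs are finite and simple. A graph is $2$-connected if it is connected, has at least $3$ vertices, and deleting any single vertex does not disconnect it. A block of a graph $G$ is a subgraph that is either an isolated vertex (a vertex of $G$ with no neighbours), or two vertices joined by an edge whose deletion would increase the number of connected components, or a maximal $2$-connected subgraph. A graph class $\mathcal{A}$ is a collection of graphs closed under relabelling of vertices (isomorphism); by convention it contains the graph with empty vertex set. For a class $\mathcal{H}$ of graphs closed under relabelling, $\mathcal{H}[n]$ is the set of graphs in $\mathcal{H}$ with vertex set $[n]=\{1,\dots,n\}$, and its exponential generating series is $\mathcal{H}(z)=\sum_{n\ge0}|\mathcal{H}[n]|\,z^n/n!$; $\mathcal{H}'(z)$ is its formal derivative. $\mathcal{A}$ is small if $\mathcal{A}(z)$ has positive radius of convergence. $\mathcal{A}$ is block-stable if it contains the one-vertex graph and a graph lies in $\mathcal{A}$ if and only if all its blocks do. $\mathcal{A}$ is smooth if $\mathcal{A}(z)$ has a finite positive radius of convergence $\rho$ and satisfies the ratio test, i.e. $[z^n]\mathcal{A}(z)/[z^{n+1}]\mathcal{A}(z)\to\rho$ as $n\to\infty$. For small block-stable classes it is known that, with $\mathcal{C}\subset\mathcal{A}$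 the subclass of connected graphs (connected graphs have non-empty vertex set), $\mathcal{A}(z)=\exp(\mathcal{C}(z))$ and $z\mathcal{C}'(z)=z\exp(\mathcal{B}'(z\mathcal{C}'(z)))$. *)

(* Defs.v *)
From HB Require Import structures.
From mathcomp Require Import all_boot all_order all_algebra.

Set Implicit Arguments.
Unset Strict Implicit.
Unset Printing Implicit Defensive.

(* A [graph U] is a finite simple graph whose vertices are taken from the      *)
(* finite label type U; its vertex set [vset G] may be any subset of U, so     *)
(* that all subgraphs of G are again of type [graph U].                        *)
Section Graphs.
Variable U : finType.

Definition graph_wf (p : {set U} * {set {set U}}) : bool :=
  [forall e in p.2, (e \subset p.1) && (#|e| == 2)].

Record graph := Graph { graph_val : {set U} * {set {set U}};
                        _ : graph_wf graph_val }.

HB.instance Definition _ := [isSub for graph_val].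
HB.instance Definition _ := [Finite of graph by <:].

Definition vset (G : graph) : {set U} := (graph_val G).1.
Definition edges (G : graph) : {set {set U}} := (graph_val G).2.

Lemma edgesP (G : graph) (e : {set U}) :
  e \in edges G -> (e \subset vset G) && (#|e| == 2).
Proof. by case: G => p wf eG; exact: (forall_inP wf). Qed.

Definition adj (G : graph) : rel U := [rel x y | [set x; y] \in edges G].

Definition sub_graph (H G : graph) : bool :=
  (vset H \subset vset G) && (edges H \subset edges G).

Lemma del_vertex_wf (G : graph) (v : U) :
  graph_wf (vset G :\ v, [set e in edges G | v \notin e]).
Proof.
apply/forall_inP => e /=; rewrite inE => /andP[/edgesP /andP[sub ->] ve].
by rewrite andbT subsetD1 sub.
Qed.

Definition del_vertex (G : graph) (v : U) : graph := Graph (del_vertex_wf G v).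

Lemma del_edge_wf (G : graph) (e : {set U}) :
  graph_wf (vset G, edges G :\ e).
Proof.
by apply/forall_inP => f /=; rewrite in_setD1 => /andP[_ /edgesP].
Qed.

Definition del_edge (G : graph) (e : {set U}) : graph :=
  Graph (del_edge_wf G e).

Definition components (G : graph) : nat := n_comp (adj G) (vset G).

(* The empty graph is not connected. *)
Definition connected_graph (G : graph) : Prop :=
  vset G <> set0 /\
  forall x y : U, x \in vset G -> y \in vset G -> connect (adj G) x y.

Definition two_connected (G : graph) : Prop :=
  [/\ connected_graph G,
      3 <= #|vset G| &
      forall v : U, v \in vset G -> connected_graph (del_vertex G v)].

Definition single_edge (G : graph) : Prop :=
  #|vset G| = 2 /\ edges G = [set vset G].

Definition isolated_vertex_block (K G : graph) : Prop :=
  exists2 v : U, vset K = [set v] & forall w : U, ~~ adj G v w.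

Definition bridge_block (K G : graph) : Prop :=
  single_edge K /\ components G < components (del_edge G (vset K)).

Definition max_two_connected_block (K G : graph) : Prop :=
  two_connected K /\
  forall H : graph, two_connected H -> sub_graph H G -> sub_graph K H -> H = K.

Definition block (K G : graph) : Prop :=
  sub_graph K G /\
  [\/ isolated_vertex_block K G, bridge_block K G
    | max_two_connected_block K G].

End Graphs.

Definition isomorphic (U W : finType) (G : graph U) (H : graph W) : Prop :=
  exists2 f : {x : U | x \in vset G} -> {y : W | y \in vset H},
    bijective f &
    forall x y, adj H (val (f x)) (val (f y)) = adj G (val x) (val y).

Definition graph_family := forall U : finType, graph U -> Prop.

Definition relabelling_closed (A : graph_family) : Prop :=
  forall (U W : finType) (G : graph U) (H : graph W),
    isomorphic G H -> A U G -> A W H.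

Definition graph_class (A : graph_family) : Prop :=
  relabelling_closed A /\
  forall (U : finType) (G : graph U), vset G = set0 -> A U G.

Definition block_stable (A : graph_family) : Prop :=
  (forall (U : finType) (G : graph U), #|vset G| = 1 -> A U G) /\
  (forall (U : finType) (G : graph U),
     A U G <-> (forall K : graph U, block K G -> A U K)).

Definition block_family (A : graph_family) : graph_family :=
  fun U G => A U G /\ (two_connected G \/ single_edge G).

Definition nonempty_family (A : graph_family) : Prop :=
  exists (U : finType) (G : graph U), A U G.

Definition is_gcd (S : nat -> Prop) (d : nat) : Prop :=
  (forall k, S k -> d %| k) /\
  (forall m, (forall k, S k -> m %| k) -> m %| d).

From mathcomp Require Import all_classical all_reals all_analysis.
Import Order.TTheory GRing.Theory Num.Theory.
Import numFieldNormedType.Exports.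

Local Open Scope classical_set_scope.
Local Open Scope ring_scope.

Lemma is_gcd_exists (S : nat -> Prop) : exists d, is_gcd S d.
Proof.
have [[k0 [Sk0 k0_gt0]]|noS] := pselect (exists k, S k /\ (0 < k)%N); last first.
  exists 0%N; split=> [k Sk|m _]; last exact: dvdn0.
  have [->//|k_gt0] := posnP k.
  by case: noS; exists k.
pose P m := `[< forall k, S k -> (m %| k)%N >].
have exP : exists m, P m by exists 1%N; apply/asboolP => k _; exact: dvd1n.
have bdP m : P m -> (m <= k0)%N by move=> /asboolP /(_ _ Sk0) /dvdn_leq; apply.
have [d /asboolP Pd dmax] := ex_maxnP exP bdP.
exists d; split=> // m Pm.
have d_gt0 : (0 < d)%N by apply: (dvdn_gt0 k0_gt0); exact: Pd.
have : P (lcmn d m) by apply/asboolP => k Sk; rewrite dvdn_lcm Pd ?Pm.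
move=> /dmax le_l.
have -> : d = lcmn d m.
  apply/eqP; rewrite eqn_leq le_l andbT dvdn_leq ?dvdn_lcml//.
  rewrite lcmn_gt0 d_gt0 /=; apply: (dvdn_gt0 k0_gt0); exact: Pm.
exact: dvdn_lcmr.
Qed.

(* The labels 0, ..., n - 1 play the role of 1, ..., n. *)
Definition labelled (A : graph_family) (n : nat) : {set graph 'I_n} :=
  [set G : graph 'I_n | (vset G == [set: 'I_n]%SET) && `[< A 'I_n G >]]%SET.

(* Power series are represented by their sequences of coefficients. *)
Definition egf (R : realType) (A : graph_family) : R^nat :=
  fun n => #|labelled A n|%:R / n`!%:R.

(* The coefficients of exp(f(z)) for a formal power series f with f 0 = 0:     *)
(* z^n only occurs in f^j for j <= n, and only through f 0, ..., f n.          *)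
Definition fps_exp (R : realType) (f : R^nat) : R^nat :=
  fun n => (\sum_(j < n.+1) (j`!%:R)^-1 *: (\poly_(i < n.+1) f i) ^+ j)`_n.

Definition convergence_radius (R : realType) (f : R^nat) : \bar R :=
  ereal_sup [set `|x|%:E | x in [set x : R | cvgn (pseries f x)]].

Definition small_family (R : realType) (A : graph_family) : Prop :=
  (0 < convergence_radius (@egf R A))%E.

Definition smooth_family (R : realType) (A : graph_family) : Prop :=
  exists rho : R,
    [/\ 0 < rho,
        convergence_radius (@egf R A) = rho%:E &
        (fun n => egf R A n / egf R A n.+1) @ \oo --> rho].

(* Main.v *)
(* The coefficients of T = z C' satisfy T = z phi(T) with phi = exp(B'), because a
   connected graph hanging at a root is a set of blocks at the root with rooted
   connected graphs attached to their other vertices.  Let rho be the radius of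
   convergence of T and tau = T(rho), which is finite.  By Lagrange inversion
   t_n rho^n is tau/n times the probability that n independent steps with law
   phi_k tau^k rho / tau add up to n - 1.  These probabilities decay
   subexponentially along n = 1 mod d, so exponential concentration of the number
   of steps of a given size survives the conditioning; exchanging one step then
   shows that t_n rho^n is asymptotically unchanged by n -> n + d, and zero
   outside n = 1 mod d.  The recursion n a_n = sum_k t_k a_(n-k), i.e. A' = C' A,
   turns this into n a_n rho^n ~ h_n L_(n-1), where h_(n+1) ~ h_n and L_r is the
   sum of the a_j rho^j over j = r mod d.  Hence d = 1 gives smoothness.  Conversely,
   smoothness makes all the L_r equal, which is impossible for d > 1 because A has
   the inverse exp(-C), with absolutely summable coefficients at rho. *)
Require Import Defs.
From mathcomp Require Import all_boot.
From mathcomp Require Import boolp.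
Set Implicit Arguments.
Unset Strict Implicit.
Unset Printing Implicit Defensive.

(** * Nonseparable graphs and blocks *)

(** Nothing is known about the nature of the singularity: no moment of the step law is controlled,
    so no local limit theorem is at hand. Two facts replace it. Beyond [rho] the series diverges, so
    t_n rho^n cannot decay exponentially; since independent runs can be concatenated, one good
    length yields a subexponential lower bound at all admissible lengths. Deviations in the number
    of steps of one size are exponentially unlikely, and such a lower bound outweighs them.
    Non-emptiness of $\mathcal{B}$ gives some phi_k > 0 with k >= 2, so the equation is nonlinear,
    which keeps T bounded up to and at [rho]. As phi is an exponential, its support is closed under
    addition and contains all large multiples of d; so steps whose sizes differ by exactly d can be
    exchanged, while steps of size 0 (phi_0 = 1) change the number of steps alone. In the transfer
    to A the tail of the recursion has to be small against the main term; this rests on Lagrange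
    inversion for T^2, which bounds the convolution square of t_n rho^n by a multiple of t_n rho^n
    itself. All series are handled as polynomials modulo a power of X. *)

Section GraphOps.
Variable U : finType.
Implicit Types (G H K F : graph U) (x y v c r : U) (S D L : {set U}).

Lemma graph_ext G H : vset G = vset H -> edges G = edges H -> G = H.
Proof.
by case: G => [[V E] ?]; case: H => [[V' E'] ?]; rewrite /vset /edges /= => e1 e2;
  apply: val_inj; rewrite /= e1 e2.
Qed.

Lemma mk_graph_wf (V : {set U}) (E : {set {set U}}) :
  graph_wf (V, [set e in E | (e \subset V) && (#|e| == 2)]).
Proof. by apply/forall_inP => e /=; rewrite inE => /andP[]. Qed.

Definition mk_graph V E : graph U := Graph (mk_graph_wf V E).

Definition gunion G H := mk_graph (vset G :|: vset H) (edges G :|: edges H).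
Definition induced G D := mk_graph (vset G :&: D) (edges G).

Lemma edge_sub G e : e \in edges G -> e \subset vset G.
Proof. by move/edgesP/andP=> []. Qed.

Lemma edge_card G e : e \in edges G -> #|e| = 2.
Proof. by move/edgesP/andP=> [_ /eqP]. Qed.

Lemma edge_ends G e : e \in edges G -> exists x y, x != y /\ e = [set x; y].
Proof. by move/edge_card/eqP/cards2P. Qed.

Lemma edges_gunion G H : edges (gunion G H) = edges G :|: edges H.
Proof.
apply/setP=> e; rewrite /edges /= !inE -!/(edges _).
apply: andb_idr => /orP[] /edgesP /andP[s ->]; rewrite andbT.
  exact: subset_trans s (subsetUl _ _).
exact: subset_trans s (subsetUr _ _).
Qed.

Lemma vset_gunion G H : vset (gunion G H) = vset G :|: vset H.
Proof. by []. Qed.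

Lemma vset_induced G D : vset (induced G D) = vset G :&: D.
Proof. by []. Qed.

Lemma in_edges_induced G D e :
  (e \in edges (induced G D)) = (e \in edges G) && (e \subset D).
Proof.
rewrite /edges /= !inE -!/(edges _) subsetI.
case: (boolP (e \in edges G)) => //= /edgesP /andP[-> ->].
by rewrite /= andbT.
Qed.

Lemma vset_del G v : vset (del_vertex G v) = vset G :\ v.
Proof. by []. Qed.

Lemma in_edges_del G v e :
  (e \in edges (del_vertex G v)) = (e \in edges G) && (v \notin e).
Proof. by rewrite /edges /= !inE. Qed.

Lemma edges_del_edge G e : edges (del_edge G e) = edges G :\ e.
Proof. by []. Qed.

Lemma gunionC G H : gunion G H = gunion H G.
Proof.
by apply: graph_ext; rewrite ?edges_gunion ?vset_gunion setUC.
Qed.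

Lemma adj_sym G : symmetric (adj G).
Proof. by move=> x y; rewrite /adj /= setUC. Qed.

Lemma adjP G x y : adj G x y -> [/\ x \in vset G, y \in vset G & x != y].
Proof.
rewrite /adj /= => e; have := edge_sub e; rewrite subUset !sub1set => /andP[-> ->].
split=> //; apply/eqP => xy; move: (edge_card e).
by rewrite xy setUid cards1.
Qed.

Lemma csym G : connect_sym (adj G).
Proof. exact/sym_connect_sym/adj_sym. Qed.

Lemma adj_gunion G H x y : adj (gunion G H) x y = adj G x y || adj H x y.
Proof. by rewrite /adj /= edges_gunion inE. Qed.

Lemma adj_induced G D x y :
  adj (induced G D) x y = [&& adj G x y, x \in D & y \in D].
Proof. by rewrite /adj /= in_edges_induced subUset !sub1set. Qed.

Lemma adj_del G v x y :
  adj (del_vertex G v) x y = [&& adj G x y, x != v & y != v].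
Proof.
by rewrite /adj /= in_edges_del !inE negb_or ![v == _]eq_sym.
Qed.

Lemma sub_graph_refl G : sub_graph G G.
Proof. by rewrite /sub_graph !subxx. Qed.

Lemma sub_graph_trans H G K : sub_graph G H -> sub_graph H K -> sub_graph G K.
Proof.
move=> /andP[a b] /andP[c d]; rewrite /sub_graph.
by rewrite (subset_trans a c) (subset_trans b d).
Qed.

Lemma sub_graph_anti G H : sub_graph G H -> sub_graph H G -> G = H.
Proof.
move=> /andP[a b] /andP[c d]; apply: graph_ext; apply/eqP; rewrite eqEsubset.
  by rewrite a c.
by rewrite b d.
Qed.

Lemma sub_gunionl G H : sub_graph G (gunion G H).
Proof. by rewrite /sub_graph edges_gunion vset_gunion !subsetUl. Qed.

Lemma sub_gunionr G H : sub_graph H (gunion G H).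
Proof. by rewrite gunionC; exact: sub_gunionl. Qed.

Lemma sub_induced G D : sub_graph (induced G D) G.
Proof.
rewrite /sub_graph subsetIl; apply/subsetP => e.
by rewrite in_edges_induced => /andP[].
Qed.

Lemma sub_to_induced H G D : sub_graph H G -> vset H \subset D ->
  sub_graph H (induced G D).
Proof.
move=> /andP[a /subsetP b] c; rewrite /sub_graph subsetI a c /=.
apply/subsetP => e eH; rewrite in_edges_induced b //=.
exact: subset_trans (edge_sub eH) c.
Qed.

Lemma sub_adj H G : sub_graph H G -> subrel (adj H) (adj G).
Proof. by move=> /andP[_ /subsetP h] x y; apply: h. Qed.

Lemma sub_connect H G : sub_graph H G -> subrel (connect (adj H)) (connect (adj G)).
Proof.
move=> h; apply: connect_sub => x y xy; apply: connect1.
exact: sub_adj h _ _ xy.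
Qed.

Lemma sub_del H G v : sub_graph H G -> sub_graph (del_vertex H v) (del_vertex G v).
Proof.
move=> /andP[a /subsetP b]; rewrite /sub_graph !vset_del setSD //=.
apply/subsetP => e; rewrite !in_edges_del => /andP[/b -> ->] //.
Qed.

Lemma sub_del_self G v : sub_graph (del_vertex G v) G.
Proof.
rewrite /sub_graph vset_del subsetDl; apply/subsetP => e.
by rewrite in_edges_del => /andP[].
Qed.

Lemma connect_closed_set G S x y :
  (forall a b, adj G a b -> a \in S -> b \in S) ->
  connect (adj G) x y -> x \in S -> y \in S.
Proof.
move=> cl cxy xS; rewrite -(closed_connect (a := mem S) (e := adj G) _ cxy) //.
apply: (intro_closed (csym G)) => a b; exact: cl.
Qed.

Lemma connect_vset G x y : connect (adj G) x y -> x \in vset G -> y \in vset G.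
Proof. by apply: connect_closed_set => a b /adjP[]. Qed.

Lemma connected_from G x : x \in vset G ->
  (forall y, y \in vset G -> connect (adj G) x y) -> connected_graph G.
Proof.
move=> xG h; split; first by apply/eqP/set0Pn; exists x.
by move=> y z yG zG; apply: connect_trans (h z zG); rewrite csym; apply: h.
Qed.

Lemma connected_sub H G : sub_graph H G -> vset H = vset G ->
  connected_graph H -> connected_graph G.
Proof.
move=> s e [n c]; split; first by rewrite -e.
by move=> x y; rewrite -e => xH yH; apply: (sub_connect s); apply: c.
Qed.

(** One notion for 2-connected graphs and single edges, so that both kinds of blocks are glued and
    split alike. Deletion ranges over all labels, which is harmless because deleting a foreign label
    changes nothing. *)
Definition nonseparable G : Prop :=
  [/\ connected_graph G, 1 < #|vset G| &
      forall v, connected_graph (del_vertex G v)].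

Lemma del_vertex_out G v : v \notin vset G -> del_vertex G v = G.
Proof.
move=> vG; apply: graph_ext.
  rewrite vset_del; apply/setP => x; rewrite !inE.
  by case: eqP => //= ->; rewrite (negbTE vG).
apply/setP => e; rewrite in_edges_del andb_idr // => /edge_sub eG.
by apply: contra vG => /(subsetP eG).
Qed.

Lemma nonseparableP G : nonseparable G <-> two_connected G \/ single_edge G.
Proof.
split.
  case=> c n dc; have [lt2|le2] := ltnP 2 #|vset G|.
    by left; split => // v _.
  have e2 : #|vset G| = 2 by apply/eqP; rewrite eqn_leq le2.
  right; split => //; move/eqP/cards2P: (e2) => [x [y [xy Vxy]]].
  apply/eqP; rewrite eqEsubset; apply/andP; split.
    apply/subsetP => e eG; rewrite inE eqEcard (edge_sub eG) e2.
    by rewrite (edge_card eG).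
  rewrite sub1set.
  have xV : x \in vset G by rewrite Vxy !inE eqxx.
  have yV : y \in vset G by rewrite Vxy !inE eqxx orbT.
  case: c => _ /(_ x y xV yV) /connectP [[|z p] /=].
    by move=> _ exy; move: xy; rewrite exy eqxx.
  case/andP => xz _ _; have [_ zV zx] := adjP xz.
  move: zV xz; rewrite Vxy !inE eq_sym (negbTE zx) /= => /eqP ->.
  by [].
case.
  case=> c n dc; split=> //; first exact: ltn_trans n.
  move=> v; case: (boolP (v \in vset G)) => [|vG]; first exact: dc.
  by rewrite del_vertex_out.
case=> n e; have c : connected_graph G.
  move/eqP/cards2P: (n) => [x [y [xy Vxy]]].
  apply: (@connected_from _ x); first by rewrite Vxy !inE eqxx.
  move=> z; rewrite Vxy !inE => /orP[/eqP -> //|/eqP ->].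
  by apply: connect1; rewrite /adj /= e Vxy inE.
split=> //; first by rewrite n.
move=> v; case: (boolP (v \in vset G)) => vG; last by rewrite del_vertex_out.
have /eqP/cards1P [w Vw] : #|vset G :\ v| = 1.
  by apply/eqP; rewrite -eqSS -add1n -n (cardsD1 v (vset G)) vG.
apply: (@connected_from _ w); first by rewrite vset_del Vw inE.
by move=> y; rewrite vset_del Vw inE => /eqP ->.
Qed.

Lemma nonseparable_edge G x y : adj G x y ->
  nonseparable (mk_graph [set x; y] [set [set x; y]]).
Proof.
move=> xy; have [_ _ nxy] := adjP xy.
apply/nonseparableP; right; rewrite /single_edge.
split; first by rewrite /vset /= cards2 nxy.
apply/setP => e; rewrite /edges /vset /= !inE.
by case: eqP => // ->; rewrite subxx cards2 nxy.
Qed.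

Lemma nonseparable_gt G v : nonseparable G -> exists2 x, x \in vset G & x != v.
Proof.
by case=> _ _ /(_ v) [/eqP/set0Pn [x]]; rewrite !inE => /andP[a b] _; exists x.
Qed.

Lemma nonseparable_del G v x y : nonseparable G -> x \in vset G -> y \in vset G ->
  x != v -> y != v -> connect (adj (del_vertex G v)) x y.
Proof.
case=> _ _ /(_ v) [_ c] xG yG xv yv; apply: c; rewrite vset_del !inE.
  by rewrite xv.
by rewrite yv.
Qed.

Lemma nonseparable_sub H G : sub_graph H G -> vset H = vset G ->
  nonseparable H -> nonseparable G.
Proof.
move=> s e [c n d]; split; first exact: connected_sub c.
  by rewrite -e.
by move=> v; apply: connected_sub (d v); [exact: sub_del | rewrite !vset_del e].
Qed.

Definition maxns K G : Prop :=
  [/\ nonseparable K, sub_graph K G &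
      forall H, nonseparable H -> sub_graph H G -> sub_graph K H -> H = K].

(** Among the nonseparable subgraphs of [G] containing [H], one with the most vertices plus edges is
    maximal for inclusion. *)
Lemma maxns_exists H G : nonseparable H -> sub_graph H G ->
  exists2 K, maxns K G & sub_graph H K.
Proof.
move=> nH sH.
pose P K := `[< nonseparable K >] && sub_graph K G && sub_graph H K.
have PH : P H by rewrite /P sH sub_graph_refl !andbT; apply/asboolP.
pose m K := #|vset K| + #|edges K|.
case: (arg_maxnP m PH) => K /andP[/andP[/asboolP nK sK] sHK] maxK.
exists K => //; split => // K' nK' sK' sKK'.
have /maxK : P K'.
  by rewrite /P sK' (sub_graph_trans sHK sKK') !andbT; apply/asboolP.
rewrite /m /= => le; move/andP: (sKK') => [a b].
have := subset_leq_card a; have := subset_leq_card b => lb la.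
have ea : #|vset K'| <= #|vset K|.
  by rewrite -(leq_add2r #|edges K|) (leq_trans _ le) // leq_add2l.
have eb : #|edges K'| <= #|edges K|.
  by rewrite -(leq_add2l #|vset K|) (leq_trans _ le) // leq_add2r.
apply/esym/graph_ext; apply/eqP; rewrite eqEcard.
  by rewrite a.
by rewrite b.
Qed.

(** Removing [c] leaves [H] connected, and a walk avoiding [c] cannot pass from one side to the
    other. So the side of any vertex of [H] other than [c] contains all of [H]. *)
Lemma nonseparable_sum G1 G2 H c :
  vset G1 :&: vset G2 \subset [set c] -> nonseparable H ->
  sub_graph H (gunion G1 G2) -> sub_graph H G1 \/ sub_graph H G2.
Proof.
move=> sc nH sH.
have [x xH xc] := nonseparable_gt c nH.
have main (X Y : graph U) : vset X :&: vset Y \subset [set c] ->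
    sub_graph H (gunion X Y) -> x \in vset X -> sub_graph H X.
  move=> {}sc {}sH xX.
  have inc z : z \in vset X -> z \in vset Y -> z = c.
    by move=> a b; apply/set1P; apply: (subsetP sc); rewrite inE a.
  have stp a b : adj H a b -> a \in vset X -> a != c -> b \in vset X.
    move=> ab aX ac; have := sub_adj sH ab; rewrite adj_gunion => /orP[/adjP[]//|].
    by case/adjP=> aY _ _; rewrite (inc a) ?eqxx in ac.
  have sub1 y : y \in vset H -> y != c -> y \in vset X.
    move=> yH yc; have := nonseparable_del nH xH yH xc yc.
    move/(connect_closed_set (S := vset X)); apply=> // a b.
    by rewrite adj_del => /and3P[ab ac _] aX; apply: stp ab aX ac.
  have sub2 y : y \in vset H -> y \in vset X.
    move=> yH; case: nH => -[_ /(_ x y xH yH) cxy] _ _.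
    apply: (connect_closed_set _ cxy) => // a b ab aX.
    have [ac|] := eqVneq a c; last exact: stp ab aX.
    have [_ bH nab] := adjP ab.
    by apply: sub1 => //; rewrite -ac eq_sym.
  apply/andP; split; first by apply/subsetP.
  apply/subsetP => e eH; move/andP: (sH) => [_ /subsetP /(_ e eH)].
  rewrite edges_gunion inE => /orP[//|eY].
  have : e \subset [set c].
    apply/subsetP => z ze; rewrite inE; apply/eqP; apply: inc.
      by apply: sub2; apply: (subsetP (edge_sub eH)).
    exact: (subsetP (edge_sub eY)).
  by move/subset_leq_card; rewrite cards1 (edge_card eH).
have : x \in vset (gunion G1 G2) by move/andP: sH => [/subsetP + _]; apply.
rewrite vset_gunion inE => /orP[x1|x2]; first by left; apply: (main _ G2).
by right; apply: (main _ G1) => //; rewrite ?(setIC (vset G2)) // gunionC.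
Qed.

(* Attaching to K a path with both ends in K creates no separating vertex: each
   inner vertex of the path reaches K along one of its two arcs. *)
Lemma nonseparable_ear K G F x y :
  nonseparable K -> sub_graph K G -> sub_graph F G ->
  (forall e, e \in edges F -> ~~ (e \subset vset K)) ->
  x \in vset K -> y \in vset K -> x != y -> connect (adj F) x y ->
  exists H, [/\ nonseparable H, sub_graph H G, sub_graph K H &
                vset K \proper vset H].
Proof.
move=> nK sK sF FK xK yK xy /connectP [p0 pp0 ly].
case/shortenP: pp0 ly => p pp up _ ly.
have hasy : has (mem (vset K)) p.
  apply/hasP; exists y; rewrite //= ly.
  by case: (p) ly => [/= e|z q _] /=; [move: xy; rewrite e eqxx | exact: mem_last].
(* The simple path is cut at its first return to [K]: the vertices of [p1] lie outside [K], and [l]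
   is the far end of the ear. *)
move: pp up; case/split_find: hasy => l p1 p2 lK' nh.
have {lK'} lK : l \in vset K := lK'.
rewrite cat_path rcons_path => /andP[/andP[pp1 lastl] _].
rewrite -cat_cons -rcons_cons cat_uniq => /andP[u1 _] {ly p p2}.
(* A single edge from [x] to [l] would lie inside [K], against the assumption on [F]. *)
have np1 : p1 != [::].
  apply/eqP => e; move: lastl; rewrite e /= => /[dup] xl.
  by move/FK; rewrite subUset !sub1set xK lK.
have p1K z : z \in p1 -> z \notin vset K.
  by move=> zp; apply: contra nh => zK; apply/hasP; exists z.
have p1G z : z \in p1 -> z \in vset G.
  move=> zp; have cz : connect (adj F) x z.
    by apply: (path_connect pp1); rewrite inE zp orbT.
  apply: connect_vset (sub_connect sF cz) _.
  by move/andP: sK => [/subsetP h _]; apply: h.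
pose W := vset K :|: [set z in p1].
pose H := induced G W.
have VH : vset H = W.
  rewrite vset_induced; apply/setIidPr/subsetP => z; rewrite !inE => /orP[zK|].
    by move/andP: sK => [/subsetP h _]; apply: h.
  exact: p1G.
have sKH : sub_graph K H by apply: sub_to_induced => //; exact: subsetUl.
have walk v z q : path (adj F) z q -> {subset z :: q <= x :: rcons p1 l} ->
    v \notin z :: q -> connect (adj (del_vertex H v)) z (last z q).
  elim: q z => [|w q IH] z //= /andP[zw pq] sub vn.
  apply: (connect_trans (y := w)); last first.
    apply: IH => //; first by move=> t tq; apply: sub; rewrite inE tq orbT.
    by move: vn; rewrite inE negb_or => /andP[].
  apply: connect1; rewrite adj_del adj_induced (sub_adj sF zw) /=.
  have inW t : t \in x :: rcons p1 l -> t \in W.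
    rewrite !inE mem_rcons inE => /or3P[/eqP->|/eqP->|->]; rewrite ?orbT ?xK ?lK //.
  rewrite !inW ?sub ?inE ?eqxx ?orbT //=.
  by move: vn; rewrite !inE !negb_or ![v == _]eq_sym => /and3P[-> ->].
have attach v z : z \in p1 -> z != v ->
    exists2 k, k \in vset K /\ k != v & connect (adj (del_vertex H v)) z k.
  move=> zp zv; move: (pp1) (u1) lastl.
  move: walk; case/splitPr: zp => a b walk.
  move=> + u lastl; rewrite cat_path /= => /and3P[pa az pb].
  have usplit : ~~ ((v \in x :: a) && (v \in rcons b l)).
    apply/negP => /andP[va vb].
    move: u; rewrite rcons_cons rcons_cat -cat_cons cat_uniq => /and3P[_ /hasPn nb _].
    by move: (nb v); rewrite /= inE vb orbT => /(_ isT) /=; rewrite va.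
  case/nandP: usplit => nv.
    exists x; first by split=> //; move: nv; rewrite inE negb_or eq_sym => /andP[].
    rewrite csym.
    have := walk v x (rcons a z); rewrite last_rcons; apply.
    - by rewrite rcons_path pa az.
    - by move=> t; rewrite !(inE, mem_rcons, mem_cat); case/or3P=> ->; rewrite ?orbT.
    - by rewrite -rcons_cons mem_rcons inE negb_or eq_sym zv nv.
  exists l; first by split=> //; move: nv; rewrite mem_rcons inE negb_or eq_sym => /andP[].
  have := walk v z (rcons b l); rewrite last_rcons; apply.
  - by rewrite rcons_path pb; move: lastl; rewrite last_cat.
  - by move=> t; rewrite !(inE, mem_rcons, mem_cat); case/or3P=> ->; rewrite ?orbT.
  - by rewrite inE negb_or eq_sym zv nv.
have sHG : sub_graph H G by exact: sub_induced.
clearbody H; exists H; split=> //; last first.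
- rewrite VH properE subsetUl /=; case: (p1) np1 p1K @W {H VH sKH sHG walk attach pp1 nh u1 lastl p1G} => // z q _ zK W.
  apply/subsetPn; exists z; last by rewrite zK // mem_head.
  by rewrite !inE eqxx orbT.
have delc v : connected_graph (del_vertex H v).
  have [k kK kv] := nonseparable_gt v nK.
  apply: (@connected_from _ k); first by rewrite vset_del in_setD1 kv VH !inE kK.
  move=> z; rewrite vset_del VH in_setD1 !inE => /andP[zv /orP[zK|zp]].
    exact: sub_connect (sub_del v sKH) _ _ (nonseparable_del nK kK zK kv zv).
  have [k' [k'K k'v] zk'] := attach v z zp zv.
  rewrite (csym _ k z); apply: connect_trans zk' _.
  exact: sub_connect (sub_del v sKH) _ _ (nonseparable_del nK k'K kK k'v kv).
split=> //; last first.
  case: nK => _ n _; apply: leq_trans n _; apply: subset_leq_card.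
  by move/andP: sKH => [].
apply: (@connected_from _ x); first by rewrite VH !inE xK.
move=> z; rewrite VH !inE => /orP[zK|zp].
  by apply: (sub_connect sKH); case: nK => -[_ c] _ _; apply: c.
have [v vK vz] : exists2 v, v \in vset K & v != z.
  by exists x => //; apply: contraTneq xK => ->; rewrite p1K.
have [k [kK _] zk] := attach v z zp (negbT (introF eqP (fun e => negP vz (introT eqP (esym e))))).
rewrite csym; apply: connect_trans (sub_connect (sub_del_self H v) zk) _.
by apply: (sub_connect sKH); case: nK => -[_ c] _ _; apply: c.
Qed.

End GraphOps.


(** * Blocks as maximal nonseparable subgraphs, and components *)

Section Blocks.
Variable U : finType.
Implicit Types (G H K F : graph U) (x y v c r : U) (S D L : {set U}).

Lemma sub_del_edge G e : sub_graph (del_edge G e) G.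
Proof. by rewrite /sub_graph edges_del_edge subD1set subxx. Qed.

(** Taking roots in [G] maps the component representatives of [G] minus the edge onto those of [G].
    If [u] and [v] are separated, their two representatives collide, so the number of components
    strictly changes. *)
Lemma bridgeP G u v : adj G u v ->
  (components G < components (del_edge G [set u; v])) =
  ~~ connect (adj (del_edge G [set u; v])) u v.
Proof.
move=> uv; set F := del_edge G _.
have sF : sub_graph F G := sub_del_edge _ _.
have [_ _ nuv] := adjP uv.
case: (boolP (connect _ u v)) => /= cuv.
  suff -> : components F = components G by rewrite ltnn.
  apply: eq_n_comp => x y; apply/idP/idP; first exact: sub_connect.
  apply: connect_sub => {}x {}y xy; have [e|ne] := eqVneq [set x; y] [set u; v].
    have : x \in [set u; v] by rewrite -e !inE eqxx.
    have : y \in [set u; v] by rewrite -e !inE eqxx orbT.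
    have [_ _ nxy] := adjP xy.
    rewrite !inE => /orP[]/eqP ? /orP[]/eqP ?; subst => //; rewrite ?eqxx // in nxy.
    by rewrite csym.
  by apply: connect1; rewrite /adj /= in_setD1 ne.
have uG : u \in vset G by case: (adjP uv).
have vG : v \in vset G by case: (adjP uv).
pose A := [predI roots (adj F) & vset F]; pose B := [predI roots (adj G) & vset G].
change (#|B| < #|A|).
pose f := root (adj G).
have rA x : x \in vset G -> root (adj F) x \in A.
  move=> xG; rewrite !inE (roots_root (csym F)) /=.
  by apply: (connect_vset (G := F) (connect_root _ x)).
have rfF x : f (root (adj F) x) = f x.
  apply/esym/(rootP (csym G)); apply: (sub_connect sF); exact: connect_root.
have BA : #|B| <= #|f @: A|.
  apply: subset_leq_card; apply/subsetP => y /andP[/eqP ry yG].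
  apply/imsetP; exists (root (adj F) y); first exact: rA.
  by rewrite rfF.
apply: leq_ltn_trans BA _; rewrite ltn_neqAle leq_imset_card andbT.
apply/imset_injP => inj; move/negP: cuv; apply.
apply/(rootP (csym F)); apply: inj; rewrite ?rA // !rfF.
by apply/(rootP (csym G)); apply: connect1.
Qed.

Lemma two_connected_nonseparable H : two_connected H -> nonseparable H.
Proof. by move=> h; apply/nonseparableP; left. Qed.

Lemma single_edge_ends K : single_edge K ->
  exists u v, [/\ u != v, vset K = [set u; v] & adj K u v].
Proof.
case=> /eqP/cards2P [u [v [uv VK]]] EK.
by exists u, v; split=> //; rewrite /adj /= EK VK inE.
Qed.

(** The bridge condition is maximality in disguise. A larger nonseparable graph around the edge uv
    has a third vertex [w], and joining [u] to [w] without [v], then [w] to [v] without [u],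
    bypasses the edge. Conversely, a bypass of the edge is an ear that enlarges [K]. *)
Lemma blockP K G : block K G <->
  maxns K G \/ (sub_graph K G /\ isolated_vertex_block K G).
Proof.
split.
  case=> sK [iso|[sg lt]|[tc mx]]; first by right.
    left; split=> //; first by apply/nonseparableP; right.
    have [u [v [uv VK aK]]] := single_edge_ends sg.
    move=> H nH sH sKH; apply/esym/(sub_graph_anti sKH).
    have aG := sub_adj sK aK.
    move: lt; rewrite VK bridgeP // => /negP nc.
    have [VHK|/subsetPn [w wH]] := boolP (vset H \subset vset K).
      rewrite /sub_graph VHK; apply/subsetP => e eH.
      case: sg => cK ->; rewrite inE eqEcard cK (edge_card eH) leqnn andbT.
      exact: subset_trans (edge_sub eH) VHK.
    rewrite VK !inE negb_or => /andP[wu wv]; case: nc.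
    have [uH vH _] := adjP (sub_adj sKH aK).
    have vu : v != u by rewrite eq_sym.
    have c1 := nonseparable_del nH vH wH vu wu.
    have c2 := nonseparable_del nH uH wH uv wv.
    have inF z : z \in [set u; v] ->
        sub_graph (del_vertex H z) (del_edge G [set u; v]).
      move=> zuv; case/andP: sH => [/subsetP sV /subsetP sE].
      rewrite /sub_graph vset_del; apply/andP; split.
        by apply/subsetP => t; rewrite in_setD1 => /andP[_ /sV].
      apply/subsetP => e; rewrite in_edges_del edges_del_edge in_setD1.
      move=> /andP[/sE -> ze]; rewrite andbT.
      by apply: contraNneq ze => ->.
    apply: (connect_trans (y := w)).
      by apply: (sub_connect (inF v _) c2); rewrite !inE eqxx orbT.
    by rewrite csym; apply: (sub_connect (inF u _) c1); rewrite !inE eqxx.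
  left; split=> //; first exact: two_connected_nonseparable.
  move=> H nH sH sKH; apply: mx => //.
  have [//|[n2 _]] : two_connected H \/ single_edge H by apply/nonseparableP.
  case: tc => _ n3 _; move/andP: sKH => [/subset_leq_card + _].
  by rewrite n2 => /(leq_trans n3).
case=> [[nK sK mx]|[sK iso]]; last by split=> //; apply: Or31.
split=> //; have [tc|sg] : two_connected K \/ single_edge K by apply/nonseparableP.
  apply: Or33; split=> // H tH; apply: mx; exact: two_connected_nonseparable.
apply: Or32; split=> //; have [u [v [uv VK aK]]] := single_edge_ends sg.
rewrite VK bridgeP; last exact: sub_adj sK _ _ aK.
apply/negP => cuv.
have [|||H [nH sH sKH prop]] := nonseparable_ear nK sK (sub_del_edge G [set u; v]) _ _ _ uv cuv.
- move=> e; rewrite edges_del_edge in_setD1 => /andP[ne eG]; rewrite VK.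
  apply: contra ne => sub; rewrite eqEcard sub (edge_card eG) -VK.
  by case: sg => ->.
- by rewrite VK !inE eqxx.
- by rewrite VK !inE eqxx orbT.
by move: prop; rewrite (mx H nH sH sKH) properxx.
Qed.

Definition component G v : {set U} := [set x | connect (adj G) v x].

Lemma comp_self G v : v \in component G v. Proof. by rewrite inE. Qed.

Lemma comp_sub G v : v \in vset G -> component G v \subset vset G.
Proof. by move=> vG; apply/subsetP => x; rewrite inE => /connect_vset; apply. Qed.

Lemma comp_adj G v x y : adj G x y -> x \in component G v -> y \in component G v.
Proof. by move=> xy; rewrite !inE => /connect_trans; apply; exact: connect1. Qed.

Lemma comp_connected G : connected_graph G ->
  forall x, x \in vset G -> component G x = vset G.
Proof.
move=> [_ c] x xG; apply/eqP; rewrite eqEsubset comp_sub //.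
by apply/subsetP => y yG; rewrite inE; apply: c.
Qed.

Lemma comp_of_sub H G x : sub_graph H G ->
  (forall a b, adj G a b -> a \in vset H -> adj H a b) ->
  x \in vset H -> component G x = component H x.
Proof.
move=> sH cl xH; apply/setP => y; rewrite !inE; apply/idP/idP; last exact: sub_connect.
move=> cxy; suff : y \in component H x :&: vset H by rewrite !inE => /andP[].
apply: connect_closed_set cxy _; last by rewrite inE comp_self.
move=> a b ab; rewrite inE => /andP[ca aH]; have ab' := cl _ _ ab aH.
by rewrite inE (comp_adj ab' ca); case: (adjP ab').
Qed.

Lemma comp_gunion G1 G2 x : [disjoint vset G1 & vset G2] -> x \in vset G1 ->
  component (gunion G1 G2) x = component G1 x.
Proof.
move=> dis; apply: comp_of_sub; first exact: sub_gunionl.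
move=> a b; rewrite adj_gunion => /orP[//|/adjP[a2 _ _] a1].
by move: (disjointFr dis a1); rewrite a2.
Qed.

Lemma comp_induced_connected G v : v \in vset G ->
  connected_graph (induced G (component G v)).
Proof.
move=> vG; apply: (@connected_from _ _ v).
  by rewrite vset_induced inE vG comp_self.
move=> y; rewrite vset_induced inE => /andP[_]; rewrite inE => cvy.
suff : y \in component (induced G (component G v)) v :&: component G v by rewrite !inE => /andP[].
apply: connect_closed_set cvy _; last by rewrite inE !comp_self.
move=> a b ab; rewrite inE => /andP[ia aC]; have bC := comp_adj ab aC.
rewrite inE bC andbT; apply: comp_adj ia; by rewrite adj_induced ab aC.
Qed.

End Blocks.

(** * Block-stable classes under gluing *)

Section Stable.
Variable A : graph_family.
Hypothesis A_bs : block_stable A.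
Variable U : finType.
Implicit Types (G H K F : graph U).

(** Isolated-vertex blocks impose no condition, since one-vertex graphs belong to [A]. *)
Lemma stable_maxns G : A G <-> (forall K, maxns K G -> A K).
Proof.
case: A_bs => A1 Ab; split.
  by move=> /Ab h K mK; apply: h; apply/blockP; left.
move=> h; apply/Ab => K /blockP [|[sK [v VK _]]]; first exact: h.
by apply: A1; rewrite VK cards1.
Qed.

(** A nonseparable graph containing a given one lies on the same side, as none lies on both. Hence
    maximality transfers, and the maximal nonseparable subgraphs of [G] are those of [G1] together
    with those of [G2]. *)
Lemma stable_cover G G1 G2 : sub_graph G1 G -> sub_graph G2 G ->
  (forall H, nonseparable H -> sub_graph H G -> sub_graph H G1 \/ sub_graph H G2) ->
  (forall H, nonseparable H -> sub_graph H G1 -> sub_graph H G2 -> False) ->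
  A G <-> A G1 /\ A G2.
Proof.
have aux X Y G0 K : sub_graph X G0 ->
    (forall H, nonseparable H -> sub_graph H G0 -> sub_graph H X \/ sub_graph H Y) ->
    (forall H, nonseparable H -> sub_graph H X -> sub_graph H Y -> False) ->
    maxns K X -> maxns K G0.
  move=> sX cov ex [nK sK mx]; split=> //; first exact: sub_graph_trans sX.
  move=> H nH sH sKH; have [sHX|sHY] := cov H nH sH; first exact: mx.
  by case: (ex K nK sK); exact: sub_graph_trans sHY.
move=> s1 s2 cov ex; rewrite !stable_maxns; split.
  move=> h; split=> K mK; apply: h; first exact: (aux G1 G2).
  apply: (aux G2 G1) => //.
    by move=> H nH sH; case: (cov H nH sH) => sHX; [right | left].
  by move=> H nH a b; apply: (ex H).
case=> h1 h2 K [nK sK mx]; have [sK1|sK2] := cov K nK sK.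
  apply: h1; split=> // H nH sH; apply: mx => //; exact: sub_graph_trans s1.
apply: h2; split=> // H nH sH; apply: mx => //; exact: sub_graph_trans s2.
Qed.

Lemma stable_sum G1 G2 c : vset G1 :&: vset G2 \subset [set c] ->
  A (gunion G1 G2) <-> A G1 /\ A G2.
Proof.
move=> sc; apply: stable_cover; [exact: sub_gunionl|exact: sub_gunionr| |].
  by move=> H nH sH; apply: nonseparable_sum sc nH sH.
move=> H [_ n _] /andP[a _] /andP[b _].
have : vset H \subset [set c] by apply: subset_trans sc; rewrite subsetI a b.
by move/subset_leq_card; rewrite cards1 => /(leq_trans n).
Qed.

Lemma stable_disjoint G1 G2 : [disjoint vset G1 & vset G2] ->
  A (gunion G1 G2) <-> A G1 /\ A G2.
Proof.
move=> dis; apply: stable_cover; [exact: sub_gunionl|exact: sub_gunionr| |].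
  move=> H nH sH; case: (nH) => -[/eqP/set0Pn [c _] _] _ _.
  by apply: (nonseparable_sum (c := c)) nH sH; rewrite (disjoint_setI0 dis) sub0set.
move=> H [_ n _] /andP[a _] /andP[b _].
have : vset H \subset set0 by rewrite -(disjoint_setI0 dis) subsetI a b.
by move/subset_leq_card; rewrite cards0 => /(leq_trans n).
Qed.

End Stable.


(** * Decompositions of graphs *)

Section Decompositions.
Variable A : graph_family.
Hypothesis A_bs : block_stable A.
Variable U : finType.
Implicit Types (G H K F : graph U) (x y v c r : U) (S D L : {set U}).

Definition conn_on S : {set graph U} :=
  [set G | (vset G == S) && `[< connected_graph G /\ A G >]].

(** [P] constrains the vertex sets of components: [predT] gives all graphs of [A], and [one_in L]
    the graphs that can hang at the non-root vertices [L] of a block. *)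
Definition comp_on (P : pred {set U}) S : {set graph U} :=
  [set G | [&& vset G == S, `[< A G >] & [forall x in S, P (component G x)]]].

Definition att_on r D : {set graph U} :=
  [set G | (vset G == r |: D) &&
    `[< [/\ connected_graph G, connected_graph (del_vertex G r) & A G] >]].

Definition block_on S : {set graph U} :=
  [set G | (vset G == S) && `[< nonseparable G /\ A G >]].

Lemma induced_gunion G1 G2 : #|vset G1 :&: vset G2| <= 1 ->
  induced (gunion G1 G2) (vset G1) = G1.
Proof.
move=> le1; apply: graph_ext; first by rewrite vset_induced vset_gunion setUK.
apply/setP => e; rewrite in_edges_induced edges_gunion inE.
apply/idP/idP => [/andP[/orP[//|e2] e1]|e1]; last by rewrite e1 edge_sub.
have : e \subset vset G1 :&: vset G2 by rewrite subsetI e1 edge_sub.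
by move/subset_leq_card; rewrite (edge_card e2) => /leq_trans /(_ le1).
Qed.

(** With at most one shared vertex no edge fits into the intersection, so both parts are recovered
    by restriction and gluing is injective. *)
Lemma card_gunion (X Y Z : {set graph U}) S1 S2 : #|S1 :&: S2| <= 1 ->
  {in Y, forall G, vset G = S1} -> {in Z, forall G, vset G = S2} ->
  {in Y & Z, forall G H, gunion G H \in X} ->
  {in X, forall G, [/\ G = gunion (induced G S1) (induced G S2),
                       induced G S1 \in Y & induced G S2 \in Z]} ->
  #|X| = #|Y| * #|Z|.
Proof.
move=> le1 hY hZ hin hout; rewrite -cardsX.
rewrite -(card_in_imset (f := fun p => gunion p.1 p.2)) /=.
  apply: eq_card => G; apply/idP/imsetP.
    move=> GX; have [e a b] := hout G GX.
    by exists (induced G S1, induced G S2); rewrite // inE a b.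
  by case=> -[G1 G2] /=; rewrite inE /= => /andP[a b] ->; apply: hin.
move=> [G1 G2] [H1 H2]; rewrite !inE /= => /andP[g1 g2] /andP[h1 h2] e.
have r1 G H : G \in Y -> H \in Z -> induced (gunion G H) S1 = G.
  by move=> GY HZ; rewrite -{1}(hY _ GY) induced_gunion // hY ?hZ.
have r2 G H : G \in Y -> H \in Z -> induced (gunion G H) S2 = H.
  by move=> GY HZ; rewrite gunionC -{1}(hZ _ HZ) induced_gunion // setIC hY ?hZ.
by rewrite -(r1 _ _ g1 g2) -{2}(r2 _ _ g1 g2) e r1 ?r2.
Qed.

Lemma gunion_induced G S1 S2 : vset G = S1 :|: S2 ->
  (forall x y, adj G x y -> ([set x; y] \subset S1) || ([set x; y] \subset S2)) ->
  G = gunion (induced G S1) (induced G S2).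
Proof.
move=> VG h; apply: graph_ext.
  by rewrite vset_gunion !vset_induced -setIUr -VG setIid.
apply/setP => e; rewrite edges_gunion inE !in_edges_induced -andb_orr.
apply/idP/idP => [eG|/andP[]//]; rewrite eG /=.
by have [x [y [_ exy]]] := edge_ends eG; rewrite exy; apply: h; rewrite /adj /= -exy.
Qed.

(** Graphs are sorted by the component [D] of [v]; by block-stability the graph on [D] and the rest
    are chosen independently. *)
Lemma comp_on_rec (P : pred {set U}) S v : v \in S ->
  #|comp_on P S| = \sum_(D : {set U} | [&& v \in D, D \subset S & P D])
                     #|conn_on D| * #|comp_on P (S :\: D)|.
Proof.
move=> vS; rewrite -sum1_card.
rewrite (partition_big (fun G => component G v)
          (fun D : {set U} => [&& v \in D, D \subset S & P D])) /=; last first.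
  move=> G; rewrite inE => /and3P[/eqP VG _ /forall_inP h].
  by rewrite comp_self -VG comp_sub ?VG ?h.
apply: eq_bigr => D /and3P[vD DS PD].
rewrite sum1dep_card.
have dis : [disjoint D & S :\: D] by rewrite disjoints_subset; apply/subsetP => x xD; rewrite !inE xD.
have DuS : D :|: (S :\: D) = S by rewrite -[RHS](setID S D) (setIidPr DS).
apply: (@card_gunion _ _ _ D (S :\: D)).
- by rewrite (disjoint_setI0 dis) cards0.
- by move=> G; rewrite inE => /andP[/eqP].
- by move=> G; rewrite inE => /and3P[/eqP].
- move=> G H; rewrite !inE => /andP[/eqP VG /asboolP [cG AG]].
  move=> /and3P[/eqP VH /asboolP AH /forall_inP PH].
  have dGH : [disjoint vset G & vset H] by rewrite VG VH.
  have cD x : x \in D -> component (gunion G H) x = D.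
    by move=> xD; rewrite comp_gunion // ?comp_connected // VG.
  rewrite vset_gunion VG VH DuS eqxx cD // eqxx andbT /=.
  apply/andP; split; first by apply/asboolP/(stable_disjoint A_bs).
  apply/forall_inP => x xS; case: (boolP (x \in D)) => xD; first by rewrite cD.
  have xH : x \in S :\: D by rewrite inE xD.
  rewrite gunionC comp_gunion ?PH ?VH //.
  by rewrite disjoint_sym VG.
- move=> G; rewrite !inE => /andP[/and3P[/eqP VG /asboolP AG /forall_inP PG] /eqP cD].
  have eqG : G = gunion (induced G D) (induced G (S :\: D)).
    apply: gunion_induced; first by rewrite DuS.
    move=> x y xy; have [xG yG _] := adjP xy.
    rewrite !subUset !sub1set !in_setD -VG xG yG !andbT.
    case: (boolP (x \in D)) => xD.
      by move: xD; rewrite -cD => xD; rewrite (comp_adj xy xD).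
    case: (boolP (y \in D)) => // yD; move: yD xD; rewrite -cD => yD.
    by rewrite (comp_adj _ yD) // adj_sym.
  have VD : vset (induced G D) = D by rewrite vset_induced VG; apply/setIidPr.
  have VSD : vset (induced G (S :\: D)) = S :\: D.
    by rewrite vset_induced VG; apply/setIidPr; exact: subsetDl.
  have dGH : [disjoint vset (induced G D) & vset (induced G (S :\: D))].
    by rewrite VD VSD.
  have [A1 A2] : A (induced G D) /\ A (induced G (S :\: D)).
    by apply/(stable_disjoint A_bs dGH); rewrite -eqG.
  split=> //; rewrite ?VD ?VSD eqxx /=.
    by apply/asboolP; split=> //; rewrite -cD; apply: comp_induced_connected; rewrite VG.
  apply/andP; split; first exact/asboolP.
  apply/forall_inP => x xSD; rewrite -(@comp_gunion _ _ (induced G D)).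
  + by rewrite gunionC -eqG PG //; move: xSD; rewrite inE => /andP[].
  + by rewrite disjoint_sym.
  + by rewrite VSD.
Qed.

(** Graphs are sorted by the component [D] of [v] after removal of the root [r]. The part on
    [r |: D] is not separated by [r], the part on [S :\: D] is any connected graph containing [r],
    and they meet only in [r]. *)
Lemma conn_on_rec S r v : r \in S -> v \in S -> v != r ->
  #|conn_on S| = \sum_(D : {set U} | (v \in D) && (D \subset S :\ r))
                   #|att_on r D| * #|conn_on (S :\: D)|.
Proof.
move=> rS vS vr; rewrite -sum1_card.
rewrite (partition_big (fun G => component (del_vertex G r) v)
          (fun D : {set U} => (v \in D) && (D \subset S :\ r))) /=; last first.
  move=> G; rewrite inE => /andP[/eqP VG _].
  rewrite comp_self /=; have <- : vset (del_vertex G r) = S :\ r by rewrite vset_del VG.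
  by apply: comp_sub; rewrite vset_del VG in_setD1 vr.
apply: eq_bigr => D /andP[vD DS].
rewrite sum1dep_card.
have DS' : D \subset S by apply: subset_trans DS (subsetDl _ _).
have rD : r \notin D by apply/negP => /(subsetP DS); rewrite !inE eqxx.
have rSD : r \in S :\: D by rewrite inE rD.
have int : (r |: D) :&: (S :\: D) = [set r].
  apply/setP => z; rewrite !inE; have [->|zr] := eqVneq z r; first by rewrite rD rS.
  by rewrite andbA /=; case: (z \in D).
have DuS : (r |: D) :|: (S :\: D) = S.
  rewrite -setUA -{1}(setIidPr DS') setID; apply/setUidPr; by rewrite sub1set.
apply: (@card_gunion _ _ _ (r |: D) (S :\: D)).
- by rewrite int cards1.
- by move=> G; rewrite inE => /andP[/eqP].
- by move=> G; rewrite inE => /andP[/eqP].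
- move=> G H; rewrite !inE => /andP[/eqP VG /asboolP [cG dG AG]].
  move=> /andP[/eqP VH /asboolP [cH AH]].
  rewrite vset_gunion VG VH DuS eqxx /=; apply/andP; split.
    apply/asboolP; split.
      apply: (@connected_from _ _ r); first by rewrite vset_gunion VG !inE eqxx.
      move=> y; rewrite vset_gunion in_setU => /orP[yG|yH].
        apply: (sub_connect (sub_gunionl _ _)); case: cG => _; apply=> //.
        by rewrite VG !inE eqxx.
      apply: (sub_connect (sub_gunionr _ _)); case: cH => _; apply=> //.
      by rewrite VH.
    by apply/(stable_sum A_bs (c := r)) => //; rewrite VG VH int.
  have dvG : vset (del_vertex G r) = D by rewrite vset_del VG setU1K.
  have vdG : v \in vset (del_vertex G r) by rewrite dvG.
  rewrite -[X in _ == X]dvG -(comp_connected dG vdG); apply/eqP.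
  apply: comp_of_sub => //; first exact/sub_del/sub_gunionl.
  move=> a b; rewrite dvG !adj_del adj_gunion => /and3P[ab -> ->] aD.
  case/orP: ab => [->//|abH].
  by case: (adjP abH); rewrite VH inE aD.
- move=> G; rewrite !inE => /andP[/andP[/eqP VG /asboolP [cG AG]] /eqP cD].
  have stay x y : adj G x y -> x \in D -> y != r -> y \in D.
    move=> xy; rewrite -cD => xD yr; apply: (comp_adj _ xD); rewrite adj_del xy yr /=.
    by rewrite andbT; apply: contraTneq xD => ->; rewrite cD rD.
  have eqG : G = gunion (induced G (r |: D)) (induced G (S :\: D)).
    apply: gunion_induced; first by rewrite DuS.
    move=> x y xy; have [xG yG _] := adjP xy; have yx : adj G y x by rewrite adj_sym.
    have := stay _ _ xy; have := stay _ _ yx.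
    rewrite !subUset !sub1set !in_setD !in_setU1 -VG xG yG !andbT.
    have [->|xr] := eqVneq x r; have [->|yr] := eqVneq y r; rewrite ?(negbTE rD) //=.
    + by case: (y \in D).
    + by case: (x \in D).
    by case: (x \in D); case: (y \in D) => // h h'; rewrite ?h ?h'.
  have VD : vset (induced G (r |: D)) = r |: D.
    by rewrite vset_induced VG; apply/setIidPr; rewrite subUset sub1set rS.
  have VSD : vset (induced G (S :\: D)) = S :\: D.
    by rewrite vset_induced VG; apply/setIidPr; exact: subsetDl.
  have [A1 A2] : A (induced G (r |: D)) /\ A (induced G (S :\: D)).
    by apply/(stable_sum A_bs (c := r)); rewrite ?VD ?VSD ?int // -eqG.
  split=> //; rewrite ?VD ?VSD eqxx /=; apply/asboolP; last first.
    split=> //; apply: (@connected_from _ _ r); rewrite VSD // => y yS.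
    have ry : connect (adj G) r y.
      by case: cG => _; apply; rewrite VG //; move: yS; rewrite inE => /andP[].
    (* The larger set is closed under adjacency: a walk from [r] may enter [D], but it comes back
       only through [r]. *)
    suff : y \in D :|: component (induced G (S :\: D)) r.
      by move: yS; rewrite !inE => /andP[/negbTE -> _].
    apply: connect_closed_set ry _; last by rewrite inE comp_self orbT.
    move=> a b ab; have [aG bG _] := adjP ab; rewrite !in_setU.
    case: (boolP (a \in D)) => [aD _|aD /= aC].
      have [->|br] := eqVneq b r; first by rewrite comp_self orbT.
      by rewrite (stay _ _ ab).
    case: (boolP (b \in D)) => //= bD; apply: comp_adj aC.
    by rewrite adj_induced ab !inE aD bD -VG aG bG.
  have cdel : connected_graph (del_vertex (induced G (r |: D)) r).
    have := @comp_induced_connected _ (del_vertex G r) v.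
    rewrite vset_del VG in_setD1 vr vS cD => /(_ isT).
    have V1 : vset (induced (del_vertex G r) D) = D.
      rewrite vset_induced vset_del VG; exact/setIidPr.
    apply: connected_sub; last by rewrite V1 vset_del VD setU1K.
    rewrite /sub_graph V1 vset_del VD setU1K // subxx /=; apply/subsetP => e.
    rewrite in_edges_induced !in_edges_del in_edges_induced => /andP[/andP[-> ->] eD].
    by rewrite andbT /=; apply: subset_trans eD (subsetUr _ _).
  split=> //.
  (* [v] is joined to [r], and [D] can be left only through [r]. *)
  have [d dD rd] : exists2 d, d \in D & adj G r d.
    have [//|no] := pselect (exists2 d, d \in D & adj G r d).
    have vrc : connect (adj G) v r by case: cG => _; apply; rewrite VG.
    suff : r \in D by rewrite (negbTE rD).
    apply: connect_closed_set vrc vD => a b ab aD.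
    have [br|br] := eqVneq b r; last exact: stay ab aD br.
    by case: no; exists a; rewrite // adj_sym -br.
  apply: (@connected_from _ _ r); rewrite VD ?setU11 // => y.
  rewrite in_setU1 => /orP[/eqP -> //|yD].
  apply: (connect_trans (y := d)).
    by apply: connect1; rewrite adj_induced rd !inE eqxx dD orbT.
  case: cdel => _ h; apply: (sub_connect (sub_del_self _ r)); apply: h.
    by rewrite vset_del VD setU1K.
  by rewrite vset_del VD setU1K.
Qed.

End Decompositions.


(** * The block containing a non-separating root *)

Section BlockAtRoot.
Variable U : finType.
Implicit Types (G H K F : graph U) (x y v c r : U) (S D L : {set U}).

Definition one_in L C : bool := #|C :&: L| == 1.

Section Glue.
Variables (r : U) (D : {set U}) (K F : graph U).
Hypotheses (rD : r \notin D) (nK : nonseparable K) (rK : r \in vset K)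
  (KD : vset K \subset r |: D) (VF : vset F = D)
  (F1 : forall x, x \in D -> one_in (vset K :\ r) (component F x)).

Lemma glue_root x : x \in D ->
  exists2 l, l \in vset K /\ l != r & connect (adj F) x l.
Proof.
move=> /F1 /cards1P [l e]; have : l \in [set l] by rewrite inE.
by rewrite -e !inE => /and3P[cl lr lK]; exists l.
Qed.

Lemma glue_uniq x y : x \in vset K -> y \in vset K -> x != r -> y != r ->
  connect (adj F) x y -> x = y.
Proof.
move=> xK yK xr yr cxy.
have xD : x \in D by move: (subsetP KD x xK); rewrite in_setU1 (negbTE xr).
have /cards1P [l e] := F1 xD.
have : x \in component F x :&: (vset K :\ r) by rewrite in_setI comp_self in_setD1 xr.
have : y \in component F x :&: (vset K :\ r) by rewrite in_setI inE cxy in_setD1 yr.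
by rewrite e !inE => /eqP -> /eqP ->.
Qed.

Lemma glue_edges e : e \in edges K -> e \in edges F -> False.
Proof.
move=> eK eF; have [x [y [xy exy]]] := edge_ends eF.
have axy : adj F x y by rewrite /adj /= -exy.
have [xF yF _] := adjP axy.
have := edge_sub eK; rewrite exy subUset !sub1set => /andP[xK yK].
case/eqP: xy; apply: glue_uniq => //; last exact: connect1.
  by apply: contraNneq rD => <-; rewrite -VF.
by apply: contraNneq rD => <-; rewrite -VF.
Qed.

(** The component of [F] at an attachment vertex [l] meets the remainder [R l] only in [l], so [H]
    lies in one of the two. If [H] lies in no such component, it lies in every [R l]; each vertex or
    edge outside [K] belongs to some component and is missing from the corresponding [R l]. *)
Lemma glue_nonseparable H : nonseparable H -> sub_graph H (gunion K F) ->
  sub_graph H K \/ sub_graph H F.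
Proof.
move=> nH sH.
have [[l [lK lr] sHl]|no] := pselect (exists2 l, l \in vset K /\ l != r &
    sub_graph H (induced F (component F l))).
  by right; apply: sub_graph_trans sHl (sub_induced _ _).
left; pose R l := gunion K (induced F (D :\: component F l)).
have sR l : l \in vset K -> l != r -> sub_graph H (R l).
  move=> lK lr.
  have [] := nonseparable_sum (G1 := induced F (component F l)) (G2 := R l) (c := l) _ nH.
  - apply/subsetP => z; rewrite /R in_setI vset_gunion !vset_induced in_setU VF !in_setI in_setD.
    case/andP=> /andP[zD zC]; rewrite zC andbF orbF => zK; rewrite inE; apply/eqP.
    apply: glue_uniq => //; first by apply: contraNneq rD => <-.
    by rewrite csym; move: zC; rewrite inE.
  - apply: sub_graph_trans sH _; rewrite /sub_graph; apply/andP; split.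
      apply/subsetP => z; rewrite /R !vset_gunion !vset_induced VF !inE.
      by case: (z \in vset K) => //=; case: (z \in D) => //=; case: (connect _ _ _).
    apply/subsetP => e; rewrite /R !edges_gunion !in_setU => /orP[->|eF]; rewrite ?orbT //.
    rewrite !in_edges_induced eF /=.
    have [x [y [xy exy]]] := edge_ends eF.
    have axy : adj F x y by rewrite /adj /= -exy.
    have [xF yF _] := adjP axy.
    rewrite exy !subUset !sub1set !in_setD -VF xF yF !andbT.
    case: (boolP (x \in component F l)) => xC.
      by rewrite (comp_adj axy xC).
    case: (boolP (y \in component F l)) => [yC|]; last by rewrite orbT.
    by move: xC; rewrite (comp_adj _ yC) // adj_sym.
  - by move=> s; case: no; exists l.
  - by [].
apply/andP; split; apply/subsetP.
  move=> x xH; case: (boolP (x \in vset K)) => // xK.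
  have := subsetP (proj1 (andP sH)) x xH.
  rewrite vset_gunion VF in_setU (negbTE xK) /= => xD.
  have [l [lK lr] cxl] := glue_root xD.
  have := subsetP (proj1 (andP (sR l lK lr))) x xH.
  rewrite vset_gunion vset_induced !inE (negbTE xK) /=.
  by rewrite csym cxl andbF.
move=> e eH; have := subsetP (proj2 (andP sH)) e eH.
rewrite edges_gunion in_setU => /orP[//|eF].
have [x [y [xy exy]]] := edge_ends eF.
have axy : adj F x y by rewrite /adj /= -exy.
have [xF yF _] := adjP axy; have xD : x \in D by rewrite -VF.
have [l [lK lr] cxl] := glue_root xD.
have := subsetP (proj2 (andP (sR l lK lr))) e eH.
rewrite edges_gunion in_setU => /orP[//|].
rewrite in_edges_induced exy subUset !sub1set !inE => /and3P[_ /andP[+ _] _].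
by rewrite csym cxl.
Qed.

Lemma glue_connected :
  connected_graph (gunion K F) /\ connected_graph (del_vertex (gunion K F) r).
Proof.
have sKG := sub_gunionl K F; have sFG := sub_gunionr K F.
have [l lK lr] := nonseparable_gt r nK.
have sFd : sub_graph F (del_vertex (gunion K F) r).
  rewrite /sub_graph vset_del vset_gunion VF subsetD1 subsetUr rD /=.
  apply/subsetP => e eF; rewrite in_edges_del edges_gunion inE eF orbT /=.
  by apply: contra rD => re; rewrite -VF; apply: (subsetP (edge_sub eF)).
split.
  apply: (@connected_from _ _ r); first by rewrite vset_gunion inE rK.
  have inK y : y \in vset K -> connect (adj (gunion K F)) r y.
    by move=> yK; apply: (sub_connect sKG); case: nK => -[_ c] _ _; apply: c.
  move=> y; rewrite vset_gunion inE VF => /orP[|yD]; first exact: inK.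
  have [l' [l'K _] cy] := glue_root yD; apply: connect_trans (inK l' l'K) _.
  by rewrite csym; apply: sub_connect sFG _ _ cy.
apply: (@connected_from _ _ l); first by rewrite vset_del vset_gunion !inE lr lK.
have inK y : y \in vset K -> y != r -> connect (adj (del_vertex (gunion K F) r)) l y.
  move=> yK yr; apply: (sub_connect (sub_del r sKG)).
  exact: nonseparable_del.
move=> y; rewrite vset_del vset_gunion in_setD1 inE VF => /andP[yr /orP[yK|yD]].
  exact: inK.
have [l' [l'K l'r] cy] := glue_root yD; apply: connect_trans (inK l' l'K l'r) _.
by rewrite csym; apply: sub_connect sFd _ _ cy.
Qed.

(** The cover is complete by [glue_nonseparable], and exclusive because a nonseparable graph has an
    edge while [K] and [F] share none. *)
Lemma glue_stable (A : graph_family) : block_stable A ->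
  A U (gunion K F) <-> A U K /\ A U F.
Proof.
move=> A_bs; apply: stable_cover => //; [exact: sub_gunionl|exact: sub_gunionr| |].
  exact: glue_nonseparable.
move=> H nH /andP[_ sK] /andP[_ sF].
case: (nH) => -[_ c] n _.
have [x xH] := nonseparable_gt r nH; have [y yH yx] := nonseparable_gt x nH => _.
have /connectP [[|z p] /= pp e] := c x y xH yH; first by rewrite e eqxx in yx.
case/andP: pp => xz _; apply: (@glue_edges [set x; z]).
  exact: (subsetP sK).
exact: (subsetP sF).
Qed.

End Glue.

(** [K] is a maximal nonseparable subgraph through some edge at [r]. Outside the edges of [K], no
    two vertices of [K] are connected, since a path between them would be an ear. As [r] does not
    separate [G], every other vertex reaches [K] without passing [r]. *)
Lemma unglue G r D : r \notin D -> vset G = r |: D -> connected_graph G ->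
  connected_graph (del_vertex G r) ->
  exists K F, [/\ G = gunion K F, nonseparable K, r \in vset K,
    vset K \subset r |: D & vset F = D /\
    forall x, x \in D -> one_in (vset K :\ r) (component F x)].
Proof.
move=> rD VG cG cd.
have dvG : vset (del_vertex G r) = D by rewrite vset_del VG setU1K.
have rG : r \in vset G by rewrite VG setU11.
have [u ru] : exists u, adj G r u.
  case: cd => /eqP/set0Pn [d]; rewrite dvG => dD _.
  have dG : d \in vset G by rewrite VG inE dD orbT.
  case: cG => _ /(_ r d rG dG) /connectP [[|u p] /=].
    by move=> _ e; move: rD; rewrite -e dD.
  by case/andP => ru _ _; exists u.
have sE : sub_graph (mk_graph [set r; u] [set [set r; u]]) G.
  apply/andP; split.
    by have [_ uG _] := adjP ru; rewrite subUset !sub1set rG uG.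
  apply/subsetP => e; rewrite /edges /= !inE => /andP[/eqP -> _].
  exact: ru.
have [K [nK sK mx] sKe] := maxns_exists (nonseparable_edge ru) sE.
have rK : r \in vset K.
  by case/andP: sKe => [/subsetP h _]; apply: h; rewrite !inE eqxx.
have KG x : x \in vset K -> x \in vset G.
  by case/andP: sK => [/subsetP h _]; apply: h.
(* Maximality makes [K] an induced subgraph, so the graph [F'] below drops exactly the edges of
   [K]. *)
have eK e : e \in edges G -> e \subset vset K -> e \in edges K.
  move=> eG eVK.
  have VI : vset (induced G (vset K)) = vset K.
    by rewrite vset_induced; apply/setIidPr/subsetP.
  have -> : K = induced G (vset K).
    symmetry; apply: mx; [|exact: sub_induced|exact: sub_to_induced].
    apply: nonseparable_sub nK; last by rewrite VI.
    exact: sub_to_induced.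
  by rewrite in_edges_induced eG.
pose F' := mk_graph (vset G) [set e in edges G | ~~ (e \subset vset K)].
have inF' (e : {set U}) : (e \in edges F') = (e \in edges G) && ~~ (e \subset vset K).
  rewrite /F' /edges /= !inE; case: (boolP (e \in _)) => //= eG.
  by rewrite (edge_sub eG) (edge_card eG) andbT.
have sF' : sub_graph F' G.
  apply/andP; split; first exact: subxx.
  by apply/subsetP => e; rewrite inF' => /andP[].
have uniqK x y : x \in vset K -> y \in vset K -> connect (adj F') x y -> x = y.
  move=> xK yK cxy; apply/eqP/negPn/negP => nxy.
  have [|H [nH sH sKH]] := nonseparable_ear nK sK sF' _ xK yK nxy cxy.
    by move=> e; rewrite inF' => /andP[].
  by rewrite (mx H nH sH sKH) properxx.
pose F := del_vertex F' r.
have VF : vset F = D by rewrite -dvG !vset_del.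
have reach x : x \in D -> exists2 l, l \in vset K :\ r & connect (adj F) l x.
  move=> xD; have [l0 l0K l0r] := nonseparable_gt r nK.
  pose Y := [set z | [exists l in vset K :\ r, connect (adj F) l z]].
  suff : x \in Y by rewrite inE => /exists_inP [l a b]; exists l.
  have l0x : connect (adj (del_vertex G r)) l0 x.
    case: cd => _ c; apply: c; last by rewrite dvG.
    by rewrite vset_del in_setD1 l0r KG.
  apply: connect_closed_set l0x _; last first.
    by rewrite inE; apply/exists_inP; exists l0; rewrite // in_setD1 l0r.
  move=> a b; rewrite adj_del => /and3P[ab ar br]; rewrite !inE.
  case/exists_inP => l lK la; apply/exists_inP.
  case: (boolP (b \in vset K)) => bK; first by exists b; rewrite // in_setD1 br.
  exists l => //; apply: connect_trans la (connect1 _).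
  rewrite adj_del ar br /adj /= inF' (ab : [set a; b] \in edges G) /= andbT.
  by rewrite subUset !sub1set (negbTE bK) andbF.
(* Such a neighbour of [r] would reach another vertex of [K], which connects two vertices of [K]
   inside [F']. *)
have rF' y : ~~ adj F' r y.
  apply/negP => ry; have [_ yG nry] := adjP ry.
  have yD : y \in D by move: (yG : y \in vset G); rewrite VG in_setU1 eq_sym (negbTE nry).
  have [l] := reach y yD; rewrite in_setD1 => /andP[lr lK] cly.
  case/eqP: lr; apply: uniqK => //.
  apply: connect_trans (sub_connect (sub_del_self F' r) cly) _.
  by apply: connect1; rewrite adj_sym.
have KS : vset K \subset r |: D by rewrite -VG; apply/subsetP.
exists K, F; split=> //.
  apply: graph_ext.
    rewrite vset_gunion VF VG; apply/setP => z; rewrite !inE.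
    have [->|zr] := eqVneq z r; first by rewrite rK.
    case: (boolP (z \in D)); rewrite ?orbT //= => zD.
    case: (boolP (z \in vset K)) => //= zK.
    by move: (subsetP KS z zK); rewrite !inE (negbTE zr) (negbTE zD).
  apply/setP => e; rewrite edges_gunion inE in_edges_del inF'.
  apply/idP/idP; last by case/orP=> [|/andP[/andP[]//]]; case/andP: sK => _ /subsetP; apply.
  move=> eG; case: (boolP (e \subset vset K)) => eVK; first by rewrite eK.
  rewrite eG /=; apply/orP; right; apply/negP => re.
  have [x [y [xy exy]]] := edge_ends eG.
  move: re; rewrite exy !inE => /orP[]/eqP e1; subst.
    by have := rF' y; rewrite /adj /= inF' eG eVK.
  by have := rF' x; rewrite adj_sym /adj /= inF' eG eVK.
split=> // x xD; have [l lK clx] := reach x xD.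
apply/cards1P; exists l; apply/setP => z; rewrite !inE.
apply/idP/eqP => [/and3P[cxz zr zK]|->]; last first.
  by rewrite csym clx; move: lK; rewrite !inE.
apply: uniqK => //; first by move: lK; rewrite !inE => /andP[].
rewrite csym; apply: (sub_connect (sub_del_self F' r)).
exact: connect_trans clx cxz.
Qed.

(** [L] is the set of non-root vertices of the block at [r]; there is only one such block because
    [r] does not separate the graph. *)
Lemma att_on_rec (A : graph_family) (A_bs : block_stable A) r D : r \notin D ->
  #|att_on A r D| = \sum_(L : {set U} | L \subset D)
     #|block_on A (r |: L)| * #|comp_on A (one_in L) D|.
Proof.
move=> rD.
pose Y := [set p : graph U * graph U |
  [&& r \in vset p.1, vset p.1 \subset r |: D, p.1 \in block_on A (vset p.1) &
      p.2 \in comp_on A (one_in (vset p.1 :\ r)) D]].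
have glueY p : p \in Y -> [/\ nonseparable p.1 /\ A U p.1, r \in vset p.1,
    vset p.1 \subset r |: D, vset p.2 = D /\ A U p.2 &
    forall x, x \in D -> one_in (vset p.1 :\ r) (component p.2 x)].
  rewrite !inE => /and4P[rK sK /andP[_ /asboolP [nK AK]]].
  by move=> /and3P[/eqP VF /asboolP AF /forall_inP h].
have -> : #|att_on A r D| = #|Y|.
  rewrite -(card_in_imset (f := fun p => gunion p.1 p.2) (D := Y)); last first.
    move=> [K F] [K' F'] /glueY /= [[nK AK] rK sK [VF AF] hF].
    move=> /glueY /= [[nK' AK'] rK' sK' [VF' AF'] hF'] e.
    (* [r] lies outside [F], so the block of the other decomposition has to lie in [K]; by symmetry
       the blocks coincide. *)
    have sub1 : sub_graph K' K.
      have [|//|/andP[/subsetP /(_ r rK')]] := @glue_nonseparable r D K F rD sK VF hF K' nK'.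
        by rewrite e; exact: sub_gunionl.
      by rewrite VF (negbTE rD).
    have sub2 : sub_graph K K'.
      have [|//|/andP[/subsetP /(_ r rK)]] := @glue_nonseparable r D K' F' rD sK' VF' hF' K nK.
        by rewrite -e; exact: sub_gunionl.
      by rewrite VF' (negbTE rD).
    have eK : K = K' by apply: sub_graph_anti.
    subst K'; congr (_, _); apply: graph_ext; first by rewrite VF VF'.
    apply/setP => ed; have := congr1 (fun G => ed \in edges G) e.
    rewrite /= !edges_gunion !inE.
    have := @glue_edges r D K F rD sK VF hF ed.
    have := @glue_edges r D K F' rD sK VF' hF' ed.
    case: (ed \in edges K) => //= h1 h2 _.
    by apply/idP/idP => h; [case: h2 | case: h1].
  apply: eq_card => G; apply/idP/imsetP.
    rewrite inE => /andP[/eqP VG /asboolP [cG dG AG]].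
    have [K [F [eG nK rK sK [VF hF]]]] := unglue rD VG cG dG.
    exists (K, F) => //; move: AG; rewrite eG.
    move=> /(glue_stable rD sK VF hF A_bs) [AK AF].
    rewrite !inE rK sK eqxx VF eqxx /=; apply/and3P; split.
    - by apply/asboolP.
    - by apply/asboolP.
    - exact/forall_inP.
  case=> [[K F]] /glueY /= [[nK AK] rK sK [VF AF] hF] ->.
  rewrite inE vset_gunion VF; apply/andP; split.
    rewrite eqEsubset subUset sK subsetUr /= subUset subsetUr andbT sub1set.
    by rewrite inE rK.
  have [c1 c2] := glue_connected rD nK rK VF hF.
  by apply/asboolP; split=> //; apply/(glue_stable rD sK VF hF A_bs).
rewrite -sum1_card (partition_big (fun p => vset p.1 :\ r)
   (fun L : {set U} => L \subset D)) /=; last first.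
  by move=> p /glueY [_ _ sK _ _]; rewrite subDset.
apply: eq_bigr => L LD; rewrite sum1dep_card -cardsX; apply: eq_card => -[K F].
have rL : r \notin L by apply: contra rD => /(subsetP LD).
rewrite !inE /=; apply/idP/idP.
  move=> /andP[/and4P[rK _ /andP[_ nA] h] /eqP eL]; rewrite -eL in h *.
  by rewrite setD1K // eqxx nA.
move=> /andP[/andP[/eqP VK nA] h]; rewrite VK setU1K // eqxx setU11 nA h !andbT /=.
by rewrite eqxx andbT setUS.
Qed.

End BlockAtRoot.


(** * Counting recursions *)

Section MapGraph.
Variables (T U : finType) (f : T -> U).
Hypothesis f_inj : injective f.
Implicit Types (G : graph T).

Definition map_graph G : graph U :=
  mk_graph (f @: vset G) [set f @: (e : {set T}) | e in edges G].

Lemma edges_map G : edges (map_graph G) = [set f @: (e : {set T}) | e in edges G].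
Proof.
apply/setP => e; rewrite /map_graph {1}/edges /= in_set andb_idr //.
case/imsetP => e' eG ->; rewrite imsetS ?edge_sub //.
by rewrite card_imset // (edge_card eG).
Qed.

Lemma vset_map G : vset (map_graph G) = f @: vset G.
Proof. by []. Qed.

Lemma mem_edges_map G (e : {set T}) : (f @: e \in edges (map_graph G)) = (e \in edges G).
Proof. by rewrite edges_map (mem_imset _ _ (imset_inj f_inj)). Qed.

Lemma map_graph_inj : injective map_graph.
Proof.
move=> G H e; apply: graph_ext.
  by apply: (imset_inj f_inj); rewrite -!vset_map e.
by apply/setP => x; rewrite -!mem_edges_map e.
Qed.

Lemma adj_map G x y : adj (map_graph G) (f x) (f y) = adj G x y.
Proof.
rewrite /adj /= -(mem_edges_map G [set x; y]).
by rewrite imsetU !imset_set1.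
Qed.

Lemma connect_map G x y :
  connect (adj (map_graph G)) (f x) (f y) = connect (adj G) x y.
Proof.
apply/idP/idP => [c|/connectP [p pp ->]].
  have : f y \in f @: component G x.
    apply: connect_closed_set c _; last by rewrite mem_imset // comp_self.
    move=> a b ab /imsetP [z zx az]; subst a.
    have [_ /imsetP [w wG bw] _] := adjP ab; subst b.
    by rewrite mem_imset //; apply: comp_adj zx; rewrite -adj_map.
  by rewrite mem_imset // inE.
elim: p x pp => [|z p IH] x /=; first by rewrite connect0.
case/andP => xz pp; apply: connect_trans (IH z pp).
by apply: connect1; rewrite adj_map.
Qed.

Lemma connected_map G : connected_graph (map_graph G) <-> connected_graph G.
Proof.
split=> -[n c]; split.
- by move=> e; apply: n; rewrite vset_map e imset0.
- by move=> x y xG yG; rewrite -connect_map; apply: c; rewrite vset_map mem_imset.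
- by move/eqP; rewrite vset_map imset_eq0 => /eqP.
- move=> x y /imsetP [x' xG ->] /imsetP [y' yG ->].
  by rewrite connect_map; apply: c.
Qed.

Lemma del_map G v : del_vertex (map_graph G) (f v) = map_graph (del_vertex G v).
Proof.
apply: graph_ext.
  apply/setP => y; rewrite vset_del in_setD1 !vset_map.
  apply/andP/imsetP => [[yv /imsetP [x xG yx]]|[x + ->]].
    exists x => //; rewrite vset_del in_setD1 xG andbT.
    by apply: contraNneq yv => <-; rewrite yx.
  by rewrite vset_del in_setD1 (inj_eq f_inj) mem_imset // => /andP[].
apply/setP => e; rewrite in_edges_del !edges_map.
apply/andP/imsetP => [[/imsetP [x xG ->]]|[x + ->]].
  rewrite mem_imset // => vx.
  by exists x; rewrite // in_edges_del xG vx.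
rewrite in_edges_del => /andP[xG vx].
by rewrite (mem_imset _ _ (imset_inj f_inj)) mem_imset.
Qed.

Lemma nonseparable_map G : nonseparable (map_graph G) <-> nonseparable G.
Proof.
split=> -[c n d]; split.
- exact/connected_map.
- by rewrite vset_map card_imset in n.
- by move=> v; apply/connected_map; rewrite -del_map.
- exact/connected_map.
- by rewrite vset_map card_imset.
- move=> v; case: (boolP (v \in vset (map_graph G))).
    by case/imsetP => x _ ->; rewrite del_map; apply/connected_map.
  by move/del_vertex_out => ->; apply/connected_map.
Qed.

Lemma isomorphic_map G : isomorphic G (map_graph G).
Proof.
pose g (x : {x | x \in vset G}) : {y | y \in vset (map_graph G)} :=
  exist _ (f (val x)) (imset_f f (valP x)).
exists g; last by move=> x y; rewrite adj_map.
apply: inj_card_bij => [x y /(congr1 val) /= /f_inj /val_inj //|].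
by rewrite !card_sig [X in X <= _](card_imset (vset G) f_inj).
Qed.

End MapGraph.

Lemma isomorphic_sym (T U : finType) (G : graph T) (H : graph U) :
  isomorphic G H -> isomorphic H G.
Proof.
case=> f [g fg gf] h; exists g; first by exists f.
by move=> x y; rewrite -h !gf.
Qed.

Definition map_invariant (Q : graph_family) : Prop :=
  forall (T U : finType) (f : T -> U) (G : graph T),
    injective f -> Q U (map_graph f G) <-> Q T G.

Lemma relabelling_map_invariant Q : relabelling_closed Q -> map_invariant Q.
Proof.
move=> h T U f G fi; have iso := isomorphic_map fi G.
by split; apply: h => //; apply: isomorphic_sym.
Qed.

(** An enumeration of [S] carries the graphs labelled by ordinals injectively onto those with vertex
    set [S]. *)
Lemma card_labelled (Q : graph_family) (U : finType) (S : {set U}) :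
  map_invariant Q ->
  #|[set G : graph U | (vset G == S) && `[< Q U G >]]| = #|labelled Q #|S| |.
Proof.
move=> inv; pose f (i : 'I_#|S|) := enum_val i.
have fi : injective f := @enum_val_inj _ _.
have fS : f @: [set: 'I_#|S|] = S.
  apply/setP => x; apply/imsetP/idP => [[i _ ->]|xS]; first exact: enum_valP.
  by exists (enum_rank_in xS x); rewrite // /f enum_rankK_in.
have surj y : y \in S -> exists x, y = f x.
  by move=> yS; exists (enum_rank_in yS y); rewrite /f enum_rankK_in.
rewrite -(card_imset _ (map_graph_inj fi)).
apply: eq_card => G; rewrite inE; apply/idP/imsetP.
  move=> /andP[/eqP VG /asboolP QG].
  pose G0 := mk_graph [set: 'I_#|S|] [set e : {set 'I_#|S|} | f @: e \in edges G].
  have eG : G = map_graph f G0.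
    apply: graph_ext; first by rewrite VG vset_map -[in LHS]fS.
    apply/setP => e; rewrite edges_map //; apply/idP/imsetP.
      move=> eG; have fe : f @: (f @^-1: e) = e.
        apply/setP => y; apply/imsetP/idP => [[x + ->]|ye]; first by rewrite inE.
        have : y \in S by rewrite -VG (subsetP (edge_sub eG)).
        by case/surj => x yx; exists x; rewrite // inE -yx.
      exists (f @^-1: e) => //.
      rewrite /G0 {1}/edges /= !inE subsetT /= fe eG -(card_imset _ fi) fe.
      by rewrite (edge_card eG).
    by case=> e0; rewrite /G0 {1}/edges /= !inE => /andP[eG _] ->.
  exists G0 => //; rewrite /labelled inE /vset /= eqxx /=.
  by apply/asboolP/(inv _ _ f); rewrite // -eG.
case=> G0; rewrite /labelled inE => /andP[/eqP V0 /asboolP Q0] ->.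
rewrite vset_map V0 fS eqxx /=; apply/asboolP; exact/inv.
Qed.

Lemma sum_subsets (U : finType) (S : {set U}) (F : nat -> nat) :
  \sum_(D : {set U} | D \subset S) F #|D| = \sum_(k < #|S|.+1) 'C(#|S|, k) * F k.
Proof.
rewrite (partition_big (fun D : {set U} => inord #|D| : 'I_#|S|.+1) xpredT) //=.
apply: eq_bigr => k _; rewrite -cards_draws -sum_nat_const.
apply: eq_big => [D|D].
  rewrite inE; apply: andb_id2l => /subset_leq_card le.
  by rewrite -val_eqE /= inordK.
by move=> /andP[/subset_leq_card le /eqP <-]; rewrite inordK.
Qed.

Lemma sum_subsets_add (U : finType) (v : U) (T : {set U}) (F : {set U} -> nat) :
  v \notin T ->
  \sum_(D : {set U} | (v \in D) && (D :\ v \subset T)) F D =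
  \sum_(D : {set U} | D \subset T) F (v |: D).
Proof.
move=> vT; rewrite (reindex_onto (fun D : {set U} => v |: D) (fun D => D :\ v)) /=.
  apply: eq_bigl => D; rewrite setU11 /=; apply/andP/idP => [[DT /eqP e]|DT].
    by rewrite -e.
  by rewrite setU1K // (contra _ vT) // => /(subsetP DT).
by move=> D /andP[vD _]; rewrite setD1K.
Qed.

Section Counting.
Variable A : graph_family.
Hypotheses (A_class : graph_class A) (A_bs : block_stable A).

Definition conn_family : graph_family := fun U G => connected_graph G /\ A G.

Definition num_graphs n := #|labelled A n|.
Definition num_connected n := #|labelled conn_family n|.
Definition num_blocks n := #|labelled (block_family A) n|.

(* Forests on k + m vertices whose components each contain exactly one of k
   prescribed vertices. *)
Fixpoint num_forests k m : nat :=
  if k is k'.+1 then \sum_(j < m.+1) 'C(m, j) * (num_connected j.+1 * num_forests k' (m - j))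
  else (m == 0).

(* Connected graphs with a root and n further vertices from which the root can be
   deleted without disconnecting them. *)
Definition num_attached n := \sum_(k < n.+1) 'C(n, k) * (num_blocks k.+1 * num_forests k (n - k)).

Let A_inv : map_invariant A.
Proof. by apply: relabelling_map_invariant; case: A_class. Qed.

Lemma conn_map_invariant : map_invariant conn_family.
Proof.
move=> T U f G fi; rewrite /conn_family; split=> -[a b]; split.
- exact/(connected_map fi).
- exact/(A_inv _ fi).
- exact/(connected_map fi).
- exact/(A_inv _ fi).
Qed.

Lemma block_map_invariant : map_invariant (block_family A).
Proof.
move=> T U f G fi; rewrite /block_family -!nonseparableP; split=> -[a b]; split.
- exact/(A_inv _ fi).
- exact/(nonseparable_map fi).
- exact/(A_inv _ fi).
- exact/(nonseparable_map fi).
Qed.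

Lemma card_conn_on (U : finType) (S : {set U}) : #|conn_on A S| = num_connected #|S|.
Proof. exact: (card_labelled S conn_map_invariant). Qed.

Lemma card_block_on (U : finType) (S : {set U}) : #|block_on A S| = num_blocks #|S|.
Proof.
rewrite /num_blocks -(card_labelled S block_map_invariant); apply: eq_card => G.
rewrite !inE; congr (_ && _); apply: asbool_equiv_eq.
rewrite /block_family -nonseparableP; tauto.
Qed.

Lemma card_all_on (U : finType) (S : {set U}) :
  #|comp_on A predT S| = num_graphs #|S|.
Proof.
rewrite /num_graphs -(card_labelled S A_inv); apply: eq_card => G.
rewrite !inE; congr (_ && _); rewrite andb_idr // => _.
exact/forall_inP.
Qed.

Lemma num_graphs0 : num_graphs 0 = 1.
Proof.
rewrite /num_graphs; pose G0 : graph 'I_0 := mk_graph set0 set0.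
have all0 (S : {set 'I_0}) : S = set0 by apply/setP => -[].
apply/eqP/cards1P; exists G0; apply/setP => G; rewrite !inE.
have -> : G = G0.
  apply: graph_ext; first by rewrite [LHS]all0 [RHS]all0.
  apply/setP => e; apply/idP/idP => /edge_card; by rewrite (all0 e) cards0.
rewrite eqxx [setT]all0 eqxx /=; apply/asboolP.
by case: A_class => _; apply.
Qed.

Lemma num_connected1 : num_connected 1 = 1.
Proof.
rewrite /num_connected; pose G0 : graph 'I_1 := mk_graph setT set0.
apply/eqP/cards1P; exists G0; apply/setP => G; rewrite !inE.
apply/andP/eqP => [[/eqP VG _]|->].
  apply: graph_ext; first by rewrite VG.
  apply/setP => e; apply/idP/idP => /[dup] /edge_card e2 /edge_sub /subset_leq_card.
    by rewrite e2 VG cardsT card_ord.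
  by rewrite e2 cardsT card_ord.
split=> //; apply/asboolP; split; last by case: A_bs => h _; apply: h; rewrite cardsT card_ord.
apply: (@connected_from _ _ ord0); first by rewrite inE.
by move=> y _; rewrite (ord1 y).
Qed.

Lemma num_blocks_small n : n < 2 -> num_blocks n = 0.
Proof.
move=> n2; apply/eqP; rewrite /num_blocks cards_eq0; apply/eqP/setP => G; rewrite !inE.
apply/negP => /andP[/eqP VG /asboolP [_ /nonseparableP [_ + _]]].
by rewrite VG cardsT card_ord ltnNge -ltnS n2.
Qed.

(** A subset containing [v] is determined by its other elements, hence the shifts by one. *)
Lemma sum_subsets_mem (U : finType) (v : U) (S : {set U}) (F : {set U} -> nat)
    (g : nat -> nat) : v \in S ->
  (forall D : {set U}, v \in D -> D \subset S -> F D = g #|D|.-1) ->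
  \sum_(D : {set U} | (v \in D) && (D \subset S)) F D =
  \sum_(k < #|S|) 'C(#|S|.-1, k) * g k.
Proof.
move=> vS FE; have -> : #|S| = #|S :\ v|.+1 by rewrite (cardsD1 v S) vS.
rewrite -sum_subsets.
transitivity (\sum_(D : {set U} | (v \in D) && (D :\ v \subset S :\ v)) g #|D|.-1).
  apply: eq_big => [D|D /andP[vD DS]]; last exact: FE.
  case: (boolP (v \in D)) => //= vD.
  by rewrite subDset setD1K.
rewrite sum_subsets_add ?setD11 //; apply: eq_bigr => D DS.
by rewrite cardsU1 (contra (subsetP DS v)) // setD11.
Qed.

(** [k] counts the companions of label 0 in its component. *)
Lemma num_graphs_rec n : num_graphs n.+1 = \sum_(k < n.+1) 'C(n, k) * (num_connected k.+1 * num_graphs (n - k)).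
Proof.
have cT : #|[set: 'I_n.+1]| = n.+1 by rewrite cardsT card_ord.
rewrite -[in LHS]cT -card_all_on (comp_on_rec A_bs _ (in_setT ord0)).
rewrite (eq_bigl (fun D : {set 'I_n.+1} => (ord0 \in D) && (D \subset setT))); last first.
  by move=> D; rewrite andbT.
rewrite (@sum_subsets_mem _ _ _ _ (fun k => num_connected k.+1 * num_graphs (n - k))) ?in_setT //.
  by rewrite cT.
move=> D vD _; rewrite card_conn_on card_all_on cardsDS ?subsetT // cT.
have D0 : 0 < #|D| by apply/card_gt0P; exists ord0.
by rewrite prednK //; congr (_ * num_graphs _); case: #|D| D0 => // m _; rewrite subSS.
Qed.

(** Induction on the size of [L]: the component of some [l] in [L] contains no other element of [L],
    so its companions come from outside [L], and the rest is the same problem for [L :\ l]. For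
    empty [L] only the empty graph qualifies. *)
Lemma card_comp_on (U : finType) (L S : {set U}) : L \subset S ->
  #|comp_on A (one_in L) S| = num_forests #|L| #|S :\: L|.
Proof.
move: {2}#|L| (leqnn #|L|) => k; elim: k L S => [|k IH] L S.
  rewrite leqn0 cards_eq0 => /eqP -> _; rewrite cards0 setD0 /=.
  have one0 (C : {set U}) : one_in set0 C = false by rewrite /one_in setI0 cards0.
  have [->|/set0Pn [x xS]] := eqVneq S set0.
    rewrite cards0 eqxx; transitivity (num_graphs 0); last exact: num_graphs0.
    rewrite -(cards0 U) -card_all_on.
    apply: eq_card => G; rewrite !inE; congr [&& _, _ & _].
    by apply/forall_inP/forall_inP => h x; rewrite inE.
  rewrite cards_eq0 (introF eqP _); last by move=> e; rewrite e inE in xS.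
  apply/eqP; rewrite cards_eq0; apply/eqP/setP => G; rewrite !inE.
  by apply/negP => /and3P[_ _ /forall_inP /(_ x xS)]; rewrite one0.
move=> cL LS; have [L0|/set0Pn [l lL]] := eqVneq L set0.
  by apply: IH => //; rewrite L0 cards0.
have cLl : #|L| = #|L :\ l|.+1 by rewrite (cardsD1 l L) lL.
rewrite (comp_on_rec A_bs _ (subsetP LS _ lL)) cLl /=.
have lSL : l \notin S :\: L by rewrite inE lL.
rewrite -(sum_subsets (S :\: L) (fun j => num_connected j.+1 * num_forests #|L :\ l| (#|S :\: L| - j))).
transitivity (\sum_(D : {set U} | (l \in D) && (D :\ l \subset S :\: L))
    #|conn_on A D| * #|comp_on A (one_in L) (S :\: D)|).
  apply: eq_bigl => D; case: (boolP (l \in D)) => //= lD.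
  apply/andP/subsetP => [[DS /cards1P [z e]] x|h].
    have : l \in D :&: L by rewrite inE lD.
    rewrite e inE => /eqP lz; subst z.
    rewrite in_setD1 => /andP[xl xD]; rewrite inE (subsetP DS) // andbT.
    by apply: contra xl => xL; rewrite -in_set1 -e inE xD.
  split.
    apply/subsetP => x xD; have [->|xl] := eqVneq x l; first exact: (subsetP LS).
    by have := h x; rewrite in_setD1 xl xD inE => /(_ isT) /andP[].
  apply/cards1P; exists l; apply/setP => x; rewrite !inE.
  have [->|xl] := eqVneq x l; first by rewrite lD lL.
  apply/negP => /andP[xD xL]; have := h x.
  by rewrite in_setD1 xl xD inE xL => /(_ isT).
rewrite sum_subsets_add //; apply: eq_bigr => D DS.
have lD : l \notin D by apply: contra lSL => /(subsetP DS).
have DL x : x \in D -> x \notin L by move/(subsetP DS); rewrite inE => /andP[].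
rewrite card_conn_on cardsU1 lD; congr (_ * _).
have sub : L :\ l \subset S :\: (l |: D).
  apply/subsetP => x; rewrite !inE => /andP[xl xL]; rewrite (negbTE xl) /=.
  by rewrite (subsetP LS) // andbT; apply: contraL xL => /DL.
have <- : #|(S :\: (l |: D)) :\: (L :\ l)| = #|S :\: L| - #|D|.
  rewrite -cardsDS //; apply: eq_card => x; rewrite !inE.
  have [->|xl] := eqVneq x l; rewrite ?lL /= ?andbF //.
  by case: (x \in L) => //=; case: (x \in D).
rewrite -IH //; last by rewrite -ltnS -cLl.
apply: eq_card => G; rewrite !inE; case: eqP => //= VG; congr (_ && _).
apply: eq_forallb_in => x xS; rewrite /one_in; congr (#|pred_of_set _| == 1).
apply/setP => z; rewrite !in_setI; apply: andb_id2l => zx.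
rewrite in_setD1; have : z \in S :\: (l |: D).
  by rewrite -VG; apply: (subsetP (comp_sub _)) zx; rewrite VG.
by rewrite !inE negb_or => /andP[/andP[-> _] _].
Qed.

Lemma card_att_on (U : finType) (r : U) (D : {set U}) : r \notin D ->
  #|att_on A r D| = num_attached #|D|.
Proof.
move=> rD; rewrite att_on_rec // /num_attached.
rewrite -(sum_subsets D (fun k => num_blocks k.+1 * num_forests k (#|D| - k))).
apply: eq_bigr => L LD; rewrite card_block_on card_comp_on // cardsDS //.
by rewrite cardsU1 (contra (subsetP LD r)).
Qed.

(** Two labels are distinguished, the root and a vertex [v] whose component at the root is split
    off. With E the series of [num_attached], this is C'' = E' C', that is, C' = exp(E). *)
Lemma num_connected_rec n :
  num_connected n.+2 = \sum_(k < n.+1) 'C(n, k) * (num_attached k.+1 * num_connected (n - k).+1).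
Proof.
pose r : 'I_n.+2 := ord0; pose v : 'I_n.+2 := lift ord0 ord0.
have cT : #|[set: 'I_n.+2]| = n.+2 by rewrite cardsT card_ord.
have vr : v != r by [].
rewrite -[in LHS]cT -card_conn_on (conn_on_rec A_bs (in_setT r) (in_setT v) vr).
have cD : #|[set: 'I_n.+2] :\ r| = n.+1.
  move: (cardsD1 r [set: 'I_n.+2]); rewrite cT in_setT => /eqP.
  by rewrite add1n eqSS eq_sym => /eqP.
rewrite (@sum_subsets_mem _ _ _ _ (fun k => num_attached k.+1 * num_connected (n - k).+1)).
- by rewrite cD.
- by rewrite in_setD1 vr in_setT.
move=> D vD DS; have rD : r \notin D by apply/negP => /(subsetP DS); rewrite setD11.
have D0 : 0 < #|D| by apply/card_gt0P; exists v.
have Dn : #|D| <= n.+1 by move: (subset_leq_card DS); rewrite cD.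
rewrite card_att_on // card_conn_on cardsDS ?subsetT // cT prednK //.
by congr (_ * num_connected _); case: #|D| D0 Dn => // m _ mn; rewrite /= subSS subSn.
Qed.

Lemma num_connected_le n : num_connected n <= num_graphs n.
Proof.
apply: subset_leq_card; apply/subsetP => G; rewrite !inE.
by move=> /andP[-> /asboolP [_ AG]]; apply/asboolP.
Qed.

End Counting.

From mathcomp Require Import all_order all_algebra.
Import Order.TTheory GRing.Theory Num.Theory.
Local Open Scope ring_scope.

(** * Truncated power series *)

Section Truncated.
Variable R : numFieldType.
Implicit Types (p q r : {poly R}) (u v : nat -> R).

Definition trunc N u : {poly R} := \poly_(i < N) u i.

Definition eqX N p q := forall i, (i < N)%N -> p`_i = q`_i.

Lemma coef_trunc N u i : (i < N)%N -> (trunc N u)`_i = u i.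
Proof. by move=> h; rewrite coef_poly h. Qed.

Lemma eqX_trans N p q r : eqX N p q -> eqX N q r -> eqX N p r.
Proof. by move=> a b i h; rewrite a ?b. Qed.

Lemma eqX_sym N p q : eqX N p q -> eqX N q p.
Proof. by move=> a i h; rewrite a. Qed.

Lemma eqX_mul N p p' q q' : eqX N p p' -> eqX N q q' -> eqX N (p * q) (p' * q').
Proof.
move=> a b i h; rewrite !coefM; apply: eq_bigr => j _.
by rewrite a ?b // (leq_ltn_trans _ h) // ?leq_subr // -ltnS.
Qed.

Lemma eqX_exp N p q k : eqX N p q -> eqX N (p ^+ k) (q ^+ k).
Proof.
by move=> h; elim: k => [|k IH]; rewrite ?expr0 // !exprS; apply: eqX_mul.
Qed.

Lemma eqX_sum N (I : Type) (s : seq I) (F G : I -> {poly R}) :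
  (forall i, eqX N (F i) (G i)) -> eqX N (\sum_(i <- s) F i) (\sum_(i <- s) G i).
Proof. by move=> h i hi; rewrite !coef_sum; apply: eq_bigr => j _; apply: h. Qed.

Lemma eqX_scale N a p q : eqX N p q -> eqX N (a *: p) (a *: q).
Proof. by move=> h i hi; rewrite !coefZ h. Qed.

Lemma coef_exp_lt p k n : p`_0 = 0 -> (n < k)%N -> (p ^+ k)`_n = 0.
Proof.
move=> p0; elim: k n => [|k IH] n // nk; rewrite exprS coefM big1 // => -[j /= jn] _.
case: j jn => [|j] jn; first by rewrite p0 mul0r.
rewrite IH ?mulr0 // (leq_trans _ (nk : (n <= k)%N)) //.
by rewrite ltn_subrL (leq_trans _ (jn : (j < n)%N)).
Qed.

Lemma coef_exp_ge0 (p : {poly R}) k i : (forall i, 0 <= p`_i) -> 0 <= (p ^+ k)`_i.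
Proof.
move=> p0; elim: k i => [|k IH] i; first by rewrite expr0 coef1 ler0n.
by rewrite exprS coefM; apply: sumr_ge0 => j _; rewrite mulr_ge0.
Qed.

Lemma trunc_coef_ge0 u N i : (forall n, 0 <= u n) -> 0 <= (trunc N u)`_i.
Proof. by move=> u0; rewrite coef_poly; case: ifP. Qed.

Lemma sum_ord_widen (V : nmodType) (F : nat -> V) N M : (N <= M)%N ->
  (forall j, (N <= j)%N -> F j = 0) -> \sum_(j < M) F j = \sum_(j < N) F j.
Proof.
move=> NM F0; rewrite -!(big_mkord xpredT F) (big_cat_nat (leq0n N) NM) //=.
rewrite [X in _ + X]big_nat_cond [X in _ + X]big1 ?addr0 //.
by move=> j /andP[/andP[Nj _] _]; apply: F0.
Qed.

Lemma coef_comp_lt p q n N : q`_0 = 0 -> (n < N)%N ->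
  (p \Po q)`_n = \sum_(j < N) p`_j * (q ^+ j)`_n.
Proof.
move=> q0 nN; rewrite coef_comp_poly.
pose F j := p`_j * (q ^+ j)`_n.
rewrite -(@sum_ord_widen _ F (size p) (maxn N (size p))) ?leq_maxr //; last first.
  by move=> j hj; rewrite /F (leq_sizeP _ _ (leqnn _)) ?mul0r.
apply: sum_ord_widen; first exact: leq_maxl.
by move=> j hj; rewrite /F coef_exp_lt ?mulr0 // (leq_trans nN).
Qed.

Lemma eqX_comp N p p' q q' : q`_0 = 0 -> q'`_0 = 0 ->
  eqX N p p' -> eqX N q q' -> eqX N (p \Po q) (p' \Po q').
Proof.
move=> q0 q0' pp qq i iN; rewrite !(@coef_comp_lt _ _ i N) //.
by apply: eq_bigr => j _; rewrite pp // (eqX_exp j qq).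
Qed.

(** For [p] without constant term, [N] terms give exp(p) modulo X^N. Degrees are not cut off, so the
    rules for derivative and composition are exact identities. *)
Definition exp_trunc N p : {poly R} := \sum_(j < N) (j`!%:R)^-1 *: p ^+ j.

Lemma deriv_exp_trunc N p : (exp_trunc N.+1 p)^`() = p^`() * exp_trunc N p.
Proof.
rewrite /exp_trunc big_ord_recl /= expr0 derivD derivZ derivC scaler0 add0r.
rewrite (raddf_sum (@deriv R)) mulr_sumr; apply: eq_bigr => j _.
rewrite /= derivZ deriv_exp /= /bump /= add1n -scalerAr factS natrM.
by rewrite -scaler_nat scalerA invfM mulrAC mulVf ?mul1r ?pnatr_eq0.
Qed.

Lemma exp_trunc0 N p : p`_0 = 0 -> (exp_trunc N.+1 p)`_0 = 1.
Proof.
move=> p0; rewrite /exp_trunc big_ord_recl coefD coefZ expr0 coef1 invr1 mul1r.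
rewrite coef_sum big1 ?addr0 // => j _.
by rewrite coefZ coef_exp_lt ?mulr0.
Qed.

(* The recursion says that x and exp(y) solve the same equation X' = y' X. *)
Lemma exp_trunc_uniq N p x : p`_0 = 0 -> x 0%N = 1 ->
  (forall n, (n.+1 < N)%N ->
     n.+1%:R * x n.+1 = \sum_(k < n.+1) (k.+1%:R * p`_k.+1) * x (n - k)%N) ->
  forall n, (n < N)%N -> x n = (exp_trunc N p)`_n.
Proof.
move=> p0 x0; case: N => [//|N] rec n.
elim/ltn_ind: n => -[|n] IH nN; first by rewrite exp_trunc0.
apply: (mulfI (x := n.+1%:R)); first by rewrite pnatr_eq0.
rewrite rec // mulr_natl -coef_deriv deriv_exp_trunc coefM.
apply: eq_bigr => k _; rewrite coef_deriv mulr_natl; congr (_ * _).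
have kn : (n - k < n.+1)%N by rewrite ltnS leq_subr.
rewrite IH //; last by rewrite (ltn_trans kn).
(* The power [p ^+ N], lost by differentiation, has no coefficient at this index. *)
rewrite /exp_trunc big_ord_recr coefD /= coefZ (coef_exp_lt (k := N)) ?mulr0 ?addr0 //.
by rewrite (leq_ltn_trans (leq_subr _ _)).
Qed.

Lemma eqX_exp_trunc N p q : eqX N p q -> eqX N (exp_trunc N p) (exp_trunc N q).
Proof.
by move=> h; apply: eqX_sum => j; apply: eqX_scale; apply: eqX_exp.
Qed.

Lemma exp_trunc_comp N p q : exp_trunc N p \Po q = exp_trunc N (p \Po q).
Proof.
rewrite /exp_trunc (raddf_sum (comp_poly q)); apply: eq_bigr => j _.
by rewrite /= comp_polyZ rmorphXn.
Qed.

(* Lagrange inversion, by induction on n through T^k = z^k phi^k(T). *)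
Lemma lagrange_trunc N (T P : {poly R}) : T`_0 = 0 -> eqX N T ('X * (P \Po T)) ->
  forall n k, (0 < n < N)%N -> (k <= n)%N ->
  n%:R * (T ^+ k)`_n = k%:R * (P ^+ n)`_(n - k).
Proof.
move=> T0 TP; elim/ltn_ind => n IH k /andP[n0 nN] kn.
have [->|k0] := posnP k.
  by rewrite expr0 coef1 eqn0Ngt n0 mulr0 mul0r.
have -> : (T ^+ k)`_n = (P ^+ k \Po T)`_(n - k).
  have -> := eqX_exp k TP nN; rewrite exprMn coefXnM ltnNge kn /=.
  by rewrite rmorphXn.
have /orP[/eqP e|lt] : (k == n) || (k < n)%N by rewrite -leq_eqVlt.
  by rewrite e subnn (@coef_comp_lt _ _ 0 1) // big_ord1 expr0 coef1 mulr1.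
set m := (n - k)%N; have m0 : (0 < m)%N by rewrite subn_gt0.
have mn : (m < n)%N by rewrite ltn_subrL k0 n0.
apply: (mulfI (x := m%:R)); first by rewrite pnatr_eq0 -lt0n.
rewrite (@coef_comp_lt _ _ m m.+1) //.
(* The induction hypothesis at [m < n] turns m [z^m] T^j into j [z^(m-j)] P^m, and the numbers j
   [z^j] P^k are the coefficients of X (P^k)'. *)
have e1 : m%:R * \sum_(j < m.+1) (P ^+ k)`_j * (T ^+ j)`_m =
    ('X * (P ^+ k)^`() * P ^+ m)`_m.
  rewrite coefM mulr_sumr; apply: eq_bigr => -[j /= jm] _.
  rewrite mulrCA IH ?m0 ?(ltn_trans mn nN) //.
  rewrite mulrA; congr (_ * _); rewrite coefXM.
  case: j jm => [|j] jm; first by rewrite mulr0.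
  by rewrite coef_deriv mulr_natr.
rewrite mulrCA e1.
(* Both sides are n k X P' P^(n-1), because m + k = n. *)
have e2 : n%:R *: ('X * (P ^+ k)^`() * P ^+ m) = k%:R *: ('X * (P ^+ n)^`()).
  rewrite !deriv_exp -!scaler_nat -!scalerAr -!scalerAl scalerA [RHS]scalerA.
  rewrite [n%:R * _]mulrC; congr (_ *: _); rewrite -!mulrA -exprD; congr (_ * (_ * _)).
  congr (_ ^+ _); rewrite /m; case: (k) k0 kn => // k' _ kn.
  by case: (n) kn => // n' kn'; rewrite subSS /= subnKC.
have := congr1 (fun q : {poly R} => q`_m) e2; rewrite !coefZ => ->.
rewrite coefXM eqn0Ngt m0 /= coef_deriv prednK //.
by rewrite -[X in k%:R * X]mulr_natl mulrCA.
Qed.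

End Truncated.

From mathcomp Require Import reals sequences exp.

Section FpsExp.
Variable R : realType.
Implicit Types (u : nat -> R).

Lemma trunc0 u N : u 0%N = 0 -> (trunc N u)`_0 = 0.
Proof. by move=> u0; rewrite coef_poly u0 if_same. Qed.

Lemma fps_expE u n N : u 0%N = 0 -> (n < N)%N ->
  fps_exp u n = (exp_trunc N (trunc N u))`_n.
Proof.
move=> u0 nN; rewrite /fps_exp /exp_trunc !coef_sum.
rewrite (@sum_ord_widen _ (fun j => ((j`!%:R)^-1 *: (trunc N u) ^+ j)`_n) n.+1 N) //.
  apply: eq_bigr => j _; rewrite !coefZ; congr (_ * _).
  apply: (@eqX_exp _ n.+1) => // i ile; rewrite !coef_trunc //.
  exact: leq_trans ile nN.
by move=> j nj; rewrite coefZ coef_exp_lt ?mulr0 // trunc0.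
Qed.

Variable u : nat -> R.
Hypotheses (u0 : u 0%N = 0) (u_ge0 : forall n, 0 <= u n).

Lemma fps_exp_ge0 n : 0 <= fps_exp u n.
Proof.
rewrite (fps_expE u0 (ltnSn n)) coef_sum; apply: sumr_ge0 => j _.
by rewrite coefZ mulr_ge0 ?invr_ge0 ?ler0n // coef_exp_ge0 // => i; exact: trunc_coef_ge0.
Qed.

Lemma fps_exp0 : fps_exp u 0 = 1.
Proof. by rewrite (fps_expE u0 (ltnSn 0)) exp_trunc0 // trunc0. Qed.

(** Nonnegative terms cannot cancel, so the support of exp(u) is the union of the supports of the
    powers of u. *)
Lemma fps_exp_gt0P n N : (n < N)%N ->
  0 < fps_exp u n <-> exists j, 0 < ((trunc N u) ^+ j)`_n.
Proof.
move=> nN; rewrite (fps_expE u0 nN) coef_sum; split.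
  move=> pos; have [//|no] := pselect (exists j, 0 < ((trunc N u) ^+ j)`_n).
  suff e : \sum_(j < N) ((j`!%:R)^-1 *: trunc N u ^+ j)`_n = 0 by rewrite e ltxx in pos.
  apply: big1 => j _; rewrite coefZ.
  have [->|] := eqVneq ((trunc N u ^+ j)`_n) 0; first by rewrite mulr0.
  move=> ne; case: no; exists (j : nat).
  by rewrite lt_def ne coef_exp_ge0 // => i; exact: trunc_coef_ge0.
case=> j pj; have jN : (j < N)%N.
  rewrite ltnNge; apply/negP => Nj.
  by rewrite coef_exp_lt ?ltxx ?trunc0 // in pj; exact: leq_trans nN Nj.
rewrite (bigD1 (Ordinal jN)) //= ltr_wpDr //.
  apply: sumr_ge0 => i _; rewrite coefZ mulr_ge0 ?invr_ge0 ?ler0n //.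
  by rewrite coef_exp_ge0 // => ?; exact: trunc_coef_ge0.
by rewrite coefZ mulr_gt0 // invr_gt0 ltr0n fact_gt0.
Qed.

(** Positive coefficients of u^i and u^j multiply to one of the nonnegative terms of a coefficient
    of u^(i+j). *)
Lemma fps_exp_suppD k l : 0 < fps_exp u k -> 0 < fps_exp u l -> 0 < fps_exp u (k + l).
Proof.
have kN : (k < (k + l).+1)%N by rewrite ltnS leq_addr.
have lN : (l < (k + l).+1)%N by rewrite ltnS leq_addl.
move=> /(fps_exp_gt0P kN) [i pi] /(fps_exp_gt0P lN) [j pj].
apply/(fps_exp_gt0P (ltnSn _)); exists (i + j)%N; rewrite exprD coefM.
rewrite (bigD1 (Ordinal kN)) //= addKn ltr_wpDr ?mulr_gt0 //.
by apply: sumr_ge0 => m _; rewrite mulr_ge0 // coef_exp_ge0 // => ?; exact: trunc_coef_ge0.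
Qed.

Lemma fps_exp_supp n : 0 < u n -> 0 < fps_exp u n.
Proof.
move=> un; apply/(fps_exp_gt0P (ltnSn n)); exists 1%N.
by rewrite expr1 coef_trunc.
Qed.

End FpsExp.

(** * The functional equation T = z phi(T) *)

Section CountingSeries.
Variables (R : realType) (A : graph_family).
Hypotheses (A_class : graph_class A) (A_bs : block_stable A).

Definition tree_coef (n : nat) : R := (n * num_connected A n)%:R / n`!%:R.

Definition block_diff : nat -> R := pseries_diffs (egf R (block_family A)).

Lemma tree_coefS n : tree_coef n.+1 = (num_connected A n.+1)%:R / n`!%:R.
Proof.
rewrite /tree_coef factS !natrM invfM mulrACA divff ?mul1r //.
by rewrite pnatr_eq0.
Qed.

Lemma binomial_conv (x y : nat -> nat) n :
  (\sum_(k < n.+1) 'C(n, k) * (x k * y (n - k)))%:R / n`!%:R =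
  \sum_(k < n.+1) ((x k)%:R / k`!%:R) * ((y (n - k)%N)%:R / (n - k)`!%:R) :> R.
Proof.
rewrite natr_sum mulr_suml; apply: eq_bigr => -[k /= kn] _.
rewrite -(bin_fact (kn : (k <= n)%N)) !natrM mulf_div.
have c0 : ('C(n, k))%:R != 0 :> R by rewrite pnatr_eq0 -lt0n bin_gt0.
by rewrite [in LHS]invfM mulrACA divff // mul1r.
Qed.

Lemma egf_rec n : n.+1%:R * egf R A n.+1 =
  \sum_(k < n.+1) tree_coef k.+1 * egf R A (n - k)%N.
Proof.
rewrite /egf -/(num_graphs A n.+1) num_graphs_rec // factS natrM invfM mulrCA mulVKf ?pnatr_eq0 //.
rewrite (binomial_conv (fun k => num_connected A k.+1) (num_graphs A)).
by apply: eq_bigr => k _; rewrite tree_coefS.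
Qed.

Lemma tree_coef_rec n : n.+1%:R * tree_coef n.+2 =
  \sum_(k < n.+1) (k.+1%:R * ((num_attached A k.+1)%:R / (k.+1)`!%:R)) * tree_coef (n - k).+1.
Proof.
rewrite tree_coefS num_connected_rec // factS natrM invfM mulrCA mulVKf ?pnatr_eq0 //.
rewrite (binomial_conv (fun k => num_attached A k.+1) (fun k => num_connected A k.+1)).
apply: eq_bigr => k _; rewrite tree_coefS; congr (_ * _).
by rewrite factS natrM invfM mulrCA mulVKf ?pnatr_eq0.
Qed.

Lemma tree_coef0 : tree_coef 0 = 0.
Proof. by rewrite /tree_coef mul0n mul0r. Qed.

Lemma tree_coef1 : tree_coef 1 = 1.
Proof. by rewrite tree_coefS num_connected1 // fact0 divr1. Qed.

Lemma tree_coef_ge0 n : 0 <= tree_coef n.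
Proof. by rewrite mulr_ge0 ?ler0n ?invr_ge0. Qed.

Lemma tree_coef_le n : tree_coef n <= n%:R * egf R A n.
Proof.
rewrite /tree_coef natrM -mulrA ler_wpM2l ?ler0n // ler_wpM2r ?invr_ge0 ?ler0n //.
by rewrite ler_nat num_connected_le.
Qed.

Lemma egf0 : egf R A 0 = 1.
Proof. by rewrite /egf -/(num_graphs A 0) num_graphs0 // fact0 divr1. Qed.

Lemma block_diffE n : block_diff n = (num_blocks A n.+1)%:R / n`!%:R.
Proof.
rewrite /block_diff /pseries_diffs /egf -/(num_blocks A n.+1) factS natrM invfM.
by rewrite mulrCA mulVKf ?pnatr_eq0.
Qed.

Lemma block_diff0 : block_diff 0 = 0.
Proof. by rewrite block_diffE num_blocks_small // mul0r. Qed.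

Lemma block_diff_ge0 n : 0 <= block_diff n.
Proof. by rewrite block_diffE mulr_ge0 ?ler0n ?invr_ge0. Qed.

Let c := fun n => tree_coef n.+1.

(** Each of the [k] components is rooted at a prescribed vertex that is not counted in [m]; hence
    the k-th power of C', whose coefficients are [c]. *)
Lemma num_forestsE k m N : (m < N)%N ->
  (num_forests A k m)%:R / m`!%:R = ((trunc N c) ^+ k)`_m.
Proof.
elim: k m => [|k IH] m mN.
  rewrite expr0 coef1 /=; case: m mN => [|m] _; last by rewrite mul0r.
  by rewrite fact0 divr1.
rewrite exprS coefM /= (binomial_conv (fun k => num_connected A k.+1) (num_forests A k)).
apply: eq_bigr => j _; rewrite IH; last by rewrite (leq_ltn_trans (leq_subr _ _)).
by rewrite coef_trunc /c ?tree_coefS // (leq_trans (ltn_ord j)).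
Qed.

Definition block_exp : nat -> R := fps_exp block_diff.

Lemma tree_coef_fixpoint N :
  eqX N (trunc N tree_coef) ('X * (trunc N block_exp \Po trunc N tree_coef)).
Proof.
set T := trunc N tree_coef.
have T0 : T`_0 = 0 by rewrite trunc0 // tree_coef0.
have TX : eqX N T ('X * trunc N c).
  move=> i iN; rewrite coefXM; case: i iN => [|i] iN /=; first by rewrite T0.
  by rewrite !coef_trunc // ltnW.
pose Ec k : R := (num_attached A k)%:R / k`!%:R.
pose E := trunc N block_diff \Po T.
(* The series of [num_attached] is B'(T): a block with [k] non-root vertices contributes z^k for
   them and C'^k for what hangs there. *)
have EE i : (i < N)%N -> Ec i = E`_i.
  move=> iN; rewrite /E (@coef_comp_lt _ _ _ i i.+1) // /Ec /num_attached.
  have nn : (i - i < N)%N by rewrite subnn (leq_trans _ iN).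
  transitivity (\sum_(k < i.+1) block_diff k * ((num_forests A k (i - k)%N)%:R / (i - k)`!%:R)).
    rewrite natr_sum mulr_suml; apply: eq_bigr => -[k /= kn] _.
    rewrite block_diffE -(bin_fact (kn : (k <= i)%N)) !natrM mulf_div.
    have c0 : ('C(i, k))%:R != 0 :> R by rewrite pnatr_eq0 -lt0n bin_gt0.
    by rewrite [in LHS]invfM mulrACA divff // mul1r.
  apply: eq_bigr => -[k /= kn] _.
  rewrite coef_trunc ?(leq_trans kn) //; congr (_ * _).
  rewrite (eqX_exp k TX iN) exprMn coefXnM ltnNge (kn : (k <= i)%N) /=.
  by apply: num_forestsE; rewrite (leq_ltn_trans (leq_subr _ _)).
have E0 : E`_0 = 0.
  by rewrite /E (@coef_comp_lt _ _ _ 0 1) // big_ord1 trunc0 ?mul0r // block_diff0.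
(* C'' = E' C' together with C'(0) = 1 identifies C' with exp(E). *)
have cE i : (i < N)%N -> c i = (exp_trunc N E)`_i.
  apply: exp_trunc_uniq => //; first by rewrite /c tree_coef1.
  move=> n nN; rewrite /c tree_coef_rec; apply: eq_bigr => k _.
  by have := EE k.+1 (leq_ltn_trans (ltn_ord k) nN); rewrite /Ec => ->.
apply: eqX_trans TX _; apply: eqX_mul => // i iN.
rewrite coef_trunc // cE // /E -exp_trunc_comp.
apply: (@eqX_comp _ N) => // j jN; rewrite coef_trunc // /block_exp.
by rewrite (fps_expE block_diff0 jN).
Qed.

(** A block on k + 1 vertices puts k >= 1 into the support of phi. If it is a single edge this is
    only k = 1; doubling [k] reaches an exponent at least 2. *)
Lemma block_exp_nontrivial : nonempty_family (block_family A) ->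
  exists2 k, (2 <= k)%N & 0 < block_exp k.
Proof.
case=> U [G bG]; have n2 : (2 <= #|vset G|)%N.
  by case: bG => _ /nonseparableP [].
have nb0 : (0 < num_blocks A #|vset G|)%N.
  have e := @card_labelled _ U (vset G) (block_map_invariant A_class).
  rewrite /num_blocks -e; apply/card_gt0P; exists G; rewrite inE eqxx; exact/asboolP.
pose k := #|vset G|.-1.
have kE : k.+1 = #|vset G| by rewrite /k prednK // (leq_trans _ n2).
have k1 : (1 <= k)%N by rewrite -ltnS kE.
have pk : 0 < block_exp k.
  apply: fps_exp_supp; first exact: block_diff0.
    exact: block_diff_ge0.
  by rewrite block_diffE kE divr_gt0 ?ltr0n ?fact_gt0.
exists (k + k)%N; first by rewrite -addn1 leq_add.
apply: fps_exp_suppD => //; [exact: block_diff0|exact: block_diff_ge0].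
Qed.

End CountingSeries.

From mathcomp Require Import all_classical all_reals all_analysis.
From mathcomp Require Import ring lra zify.
Import numFieldNormedType.Exports.
Local Open Scope classical_set_scope.

(** * The dominant singularity *)

Section Critical.
Variable R : realType.

Lemma coef_exp_le (p q : {poly R}) k i : (forall i, 0 <= p`_i <= q`_i) ->
  (p ^+ k)`_i <= (q ^+ k)`_i.
Proof.
move=> pq; elim: k i => [|k IH] i; first by rewrite expr0.
rewrite !exprS !coefM; apply: ler_sum => j _; apply: ler_pM => //.
- by case/andP: (pq j).
- by apply: coef_exp_ge0 => l; case/andP: (pq l).
- by case/andP: (pq j).
Qed.

(** Bounds known only arbitrarily near [x] pass to [x]; this carries estimates from partial sums to
    their suprema. *)
Lemma horner_le_near (p : {poly R}) (x c : R) :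
  (forall e : R, 0 < e -> exists y : R, `|x - y| < e /\ p.[y] <= c) -> p.[x] <= c.
Proof.
move=> h; rewrite leNgt; apply/negP => cp.
have pos : 0 < p.[x] - c by rewrite subr_gt0.
have := @continuous_horner R p x => /cvgrPdist_lt /(_ _ pos).
rewrite near_nbhs => /nbhs_ballP [e /= e0 be].
have [y [xy py]] := h e e0; have := be y xy => /=.
by rewrite distrC ltr_distlC => /andP[_]; rewrite ltNge => /negP; apply; lra.
Qed.

Lemma horner_ge0_coef (p : {poly R}) x n : (forall i, 0 <= p`_i) -> 0 <= x ->
  p`_n * x ^+ n <= p.[x].
Proof.
move=> p0 x0; have [sn|ns] := leqP (size p) n.
  rewrite (leq_sizeP _ _ sn) // mul0r horner_coef.
  by apply: sumr_ge0 => i _; rewrite mulr_ge0 ?exprn_ge0.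
rewrite horner_coef (bigD1 (Ordinal ns)) //= lerDl.
by apply: sumr_ge0 => i _; rewrite mulr_ge0 ?exprn_ge0.
Qed.

Variables (phi t : nat -> R) (K : nat).
Hypotheses (phi_ge0 : forall n, 0 <= phi n) (t_ge0 : forall n, 0 <= t n)
  (t0 : t 0%N = 0) (t1 : t 1%N = 1)
  (t_fix : forall N, eqX N (trunc N t) ('X * (trunc N phi \Po trunc N t)))
  (K2 : (2 <= K)%N) (phiK : 0 < phi K)
  (t_small : exists2 x : R, 0 < x & exists M : R, forall N, (trunc N t).[x] <= M).

Local Notation V x N := (trunc N t).[x].

Lemma trunc_hornerE (u : nat -> R) N x : (trunc N u).[x] = \sum_(i < N) u i * x ^+ i.
Proof. by rewrite horner_poly. Qed.

Lemma trunc_horner_ge0 (u : nat -> R) N x : (forall n, 0 <= u n) -> 0 <= x ->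
  0 <= (trunc N u).[x].
Proof.
move=> u0 x0; rewrite trunc_hornerE; apply: sumr_ge0 => i _.
by rewrite mulr_ge0 ?exprn_ge0.
Qed.

Lemma trunc_horner_mono N x y : 0 <= x -> x <= y -> V x N <= V y N.
Proof.
move=> x0 xy; rewrite !trunc_hornerE; apply: ler_sum => i _.
by rewrite ler_wpM2l // lerXn2r ?nnegrE // (le_trans x0).
Qed.

(* The inequality x phi(T(x)) <= T(x), on partial sums. *)
Lemma fix_ineq J N x : 0 <= x ->
  exists S, x * (trunc J phi).[V x N] <= V x S.
Proof.
move=> x0; set P := trunc J phi; set T := trunc N t.
exists (size (P \Po T)).+1; rewrite -horner_comp horner_coef.
rewrite trunc_hornerE big_ord_recl t0 mul0r add0r mulr_sumr.
apply: ler_sum => -[n /= nS] _; rewrite /bump /= add1n exprS.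
rewrite mulrCA ler_wpM2r ?mulr_ge0 ?exprn_ge0 //.
set M := (maxn N n.+2).
have -> : t n.+1 = (trunc M phi \Po trunc M t)`_n.
  have nM : (n.+1 < M)%N by rewrite leq_max leqnn orbT.
  by have := t_fix nM; rewrite coef_trunc // coefXM.
have T0 L : (trunc L t)`_0 = 0 by rewrite coef_poly t0 if_same.
rewrite (@coef_comp_lt _ P T n n.+1) ?T0 //.
rewrite (@coef_comp_lt _ _ (trunc M t) n n.+1) ?T0 //; apply: ler_sum => -[j /= jn] _.
apply: ler_pM.
- exact: trunc_coef_ge0.
- by apply: coef_exp_ge0 => i; apply: trunc_coef_ge0.
- have jM : (j < M)%N := leq_trans (leqW jn) (leq_maxr _ _).
  by rewrite (coef_trunc phi jM) coef_poly; case: ifP.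
- apply: coef_exp_le => i; rewrite trunc_coef_ge0 //= !coef_poly.
  case: ifP => [iN|_]; last by case: ifP.
  by rewrite leq_max iN.
Qed.

Let X := [set x : R | 0 <= x /\ exists M : R, forall N, V x N <= M].
Let B x : R := 1 + 2 ^+ K / (x * phi K).

(** Let s be the supremum of the partial sums. Some partial sum exceeds s / 2, so x phi_K (s / 2)^K
    <= s, that is, s^(K-1) <= 2^K / (x phi_K). As K >= 2, this bounds s itself once s > 1; the
    summand 1 in [B] covers s <= 1. *)
Lemma value_bound x : 0 < x -> X x -> forall N, V x N <= B x.
Proof.
move=> x0 [_ [M hM]].
pose E := range (fun N => V x N).
have hs : has_sup E.
  by split; [exists (V x 0); exists 0%N | exists M => _ [N _ <-]].
have sub N : V x N <= sup E.
  by apply: ub_le_sup; [case: hs | exists N].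
suff : sup E <= B x by move=> h N; apply: le_trans (sub N) h.
have Bx : 0 < 2 ^+ K / (x * phi K) by rewrite divr_gt0 ?exprn_gt0 ?mulr_gt0.
have [s1|s1] := leP (sup E) 1; first by rewrite /B; lra.
have s0 : 0 < sup E by lra.
have [_ [N _ <-]] := sup_adherent (divr_gt0 s0 (ltr0n R 2)) hs.
set s := sup E in sub s1 s0 * => hN.
have [S hS] := fix_ineq K.+1 N (ltW x0).
have h1 : x * (phi K * (s / 2) ^+ K) <= s.
  apply: le_trans (le_trans hS (sub S)).
  rewrite ler_wpM2l ?(ltW x0) //.
  apply: le_trans (horner_ge0_coef K _ _); first last.
  - exact/trunc_horner_ge0/ltW.
  - by move=> i; apply: trunc_coef_ge0.
  rewrite coef_trunc // ler_wpM2l // lerXn2r ?nnegrE ?divr_ge0 ?(ltW s0) //.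
    exact/trunc_horner_ge0/ltW.
  lra.
have h2 : s ^+ K.-1 <= 2 ^+ K / (x * phi K).
  rewrite ler_pdivlMr ?mulr_gt0 // -(ler_pM2r s0) mulrAC -exprSr prednK ?(ltn_trans _ K2) //.
  move: h1; rewrite expr_div_n mulrA mulrCA mulrA -ler_pdivlMr ?invr_gt0 ?exprn_gt0 //.
  by rewrite invrK mulrC [_ * s]mulrC.
have h3 : s <= s ^+ K.-1.
  by rewrite -{1}[s]expr1 ler_weXn2l ?(ltW s1) // -ltnS prednK // (ltn_trans _ K2).
rewrite /B; lra.
Qed.

Lemma X_ubound : has_ubound X.
Proof.
exists (1 + 1 + 2 ^+ K / phi K) => x Xx.
have pos : 0 < 2 ^+ K / phi K by rewrite divr_gt0 ?exprn_gt0.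
have [x1|x1] := leP x 1; first by lra.
have x0 : 0 < x by lra.
have := value_bound x0 Xx 2; rewrite trunc_hornerE !big_ord_recl big_ord0 /= t0 t1.
rewrite mul0r add0r addr0 mul1r expr1 /B => h.
suff : 2 ^+ K / (x * phi K) <= 2 ^+ K / phi K by lra.
rewrite invfM mulrA ler_pM2r ?invr_gt0 // ler_pdivrMr // ler_peMr ?exprn_ge0 //.
exact: ltW.
Qed.

(** [rho] is the supremum of the points with bounded partial sums, and [tau] the supremum of the
    partial sums at [rho]. *)
Lemma critical_point : exists rho tau : R,
  [/\ 0 < rho, 0 < tau, forall J, rho * (trunc J phi).[tau] <= tau &
      forall x : R, rho < x -> forall M : R, exists N, M < V x N].
Proof.
have [x1 x10 [M1 hM1]] := t_small.
have Xx1 : X x1 by split; [exact: ltW | exists M1].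
have hs : has_sup X by split; [exists x1 | exact: X_ubound].
pose rho := sup X; have x1r : x1 <= rho by apply: ub_le_sup => //; exact: X_ubound.
have r0 : 0 < rho by apply: lt_le_trans x1r.
have below x : 0 <= x -> x < rho -> X x.
  move=> x0 xr; have d0 : 0 < rho - x by rewrite subr_gt0.
  have [y Xy] := sup_adherent d0 hs.
  rewrite -/rho subKr => xy; split=> //; case: Xy => y0 [M hM].
  by exists M => N; apply: le_trans (hM N); apply: trunc_horner_mono => //; exact: ltW.
(* [B] is decreasing, so its value at [rho / 2] bounds T uniformly between [rho / 2] and [rho], and
   by continuity of each partial sum also at [rho]. *)
have bnd N : V rho N <= B (rho / 2).
  apply: horner_le_near => e e0.
  have [y [y0 yr ye]] : exists y, [/\ rho / 2 <= y, y < rho & rho - e / 2 <= y].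
    exists (Num.max (rho / 2) (rho - e / 2)); rewrite !le_max !lexx orbT; split=> //.
    by rewrite gt_max; apply/andP; split; lra.
  exists y; split; first by rewrite ger0_norm; lra.
  have r20 : 0 < rho / 2 by rewrite divr_gt0.
  have yp : 0 < y by exact: lt_le_trans y0.
  apply: le_trans (value_bound yp (below y (ltW yp) yr) N) _.
  rewrite /B lerD2l ler_pM2l ?exprn_gt0 // lef_pV2 ?posrE ?mulr_gt0 //.
  by rewrite ler_pM2r.
pose E := range (fun N => V rho N).
have hE : has_sup E.
  by split; [exists (V rho 0); exists 0%N | exists (B (rho / 2)) => _ [N _ <-]].
pose tau := sup E.
have sub N : V rho N <= tau by apply: ub_le_sup; [case: hE | exists N].
exists rho, tau; split=> //.
- apply: lt_le_trans (sub 2); rewrite trunc_hornerE !big_ord_recl big_ord0 /= t0 t1.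
  by rewrite mul0r add0r addr0 mul1r expr1.
- move=> J; rewrite -hornerZ; apply: horner_le_near => e e0.
  have [_ [N _ <-] hN] := sup_adherent e0 hE.
  exists (V rho N); split; first by rewrite ger0_norm ?subr_ge0 ?sub // ltrBlDl -ltrBlDr.
  rewrite hornerZ; have [S hS] := fix_ineq J N (ltW r0).
  exact: le_trans hS (sub S).
move=> x rx M; have [//|no] := pselect (exists N, M < V x N).
have : x <= rho; last by rewrite leNgt rx.
apply: ub_le_sup; first exact: X_ubound.
split; first by lra.
by exists M => N; rewrite leNgt; apply/negP => h; apply: no; exists N.
Qed.

End Critical.


(** * Random walk weights *)

Section Walk.
Variable R : realType.
Variables (phi : nat -> R) (tau Phi : R).
Hypotheses (phi_ge0 : forall n, 0 <= phi n) (phi0 : phi 0%N = 1)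
  (tau_gt0 : 0 < tau) (Phi_gt0 : 0 < Phi)
  (phi_tau : forall J, (trunc J phi).[tau] <= Phi).

Definition pcoef n s : R := ((trunc s.+1 phi) ^+ n)`_s.

Lemma pcoefE n s N : (s < N)%N -> pcoef n s = ((trunc N phi) ^+ n)`_s.
Proof.
move=> sN; apply: (@eqX_exp _ s.+1) => // i ile.
by rewrite !coef_trunc // (leq_trans ile).
Qed.

(* The probability that n independent steps with law phi_k tau^k / Phi add up to s
   (a subprobability law if phi(tau) < Phi). *)
Definition walk n s : R := pcoef n s * tau ^+ s / Phi ^+ n.

Definition step a : R := phi a * tau ^+ a / Phi.

Lemma pcoef_ge0 n s : 0 <= pcoef n s.
Proof. by apply: coef_exp_ge0 => i; apply: trunc_coef_ge0. Qed.

Lemma walk_ge0 n s : 0 <= walk n s.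
Proof.
by rewrite !mulr_ge0 ?pcoef_ge0 ?invr_ge0 ?exprn_ge0 ?(ltW tau_gt0) ?(ltW Phi_gt0).
Qed.

Lemma walk1 a : walk 1 a = step a.
Proof. by rewrite /walk /pcoef !expr1 coef_trunc. Qed.

Lemma walk_mul n m s r : walk n s * walk m r <= walk (n + m) (s + r).
Proof.
have sN : (s < (s + r).+1)%N by rewrite ltnS leq_addr.
have rN : (r < (s + r).+1)%N by rewrite ltnS leq_addl.
have h : pcoef n s * pcoef m r <= pcoef (n + m) (s + r).
  rewrite (pcoefE n sN) (pcoefE m rN) /pcoef exprD coefM.
  rewrite (bigD1 (Ordinal sN)) //= addKn lerDl; apply: sumr_ge0 => j _.
  by rewrite mulr_ge0 // coef_exp_ge0 // => i; apply: trunc_coef_ge0.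
have -> : walk n s * walk m r =
    pcoef n s * pcoef m r * (tau ^+ (s + r) / Phi ^+ (n + m)).
  by rewrite /walk !exprD invfM; ring.
rewrite /walk -[X in _ <= X]mulrA ler_wpM2r //.
by rewrite mulr_ge0 ?invr_ge0 ?exprn_ge0 ?(ltW tau_gt0) ?(ltW Phi_gt0).
Qed.

Lemma walk_up n s a : walk n s * step a <= walk n.+1 (s + a).
Proof. by have := walk_mul n 1 s a; rewrite addn1 walk1. Qed.

Lemma walk_pow n s k : walk n s ^+ k <= walk (k * n) (k * s).
Proof.
elim: k => [|k IH].
  by rewrite expr0 !mul0n /walk /pcoef !expr0 coef1 !mul1r invr1.
rewrite exprS !mulSn; apply: le_trans (walk_mul _ _ _ _).
by rewrite ler_wpM2l ?walk_ge0.
Qed.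

Lemma step_gt0 a : 0 < phi a -> 0 < step a.
Proof. by move=> h; rewrite divr_gt0 ?mulr_gt0 ?exprn_gt0. Qed.

Section Exchange.
Variables (a n s : nat).
Hypotheses (n_gt0 : (0 < n)%N) (as_ : (a <= s)%N).

Let P := trunc s.+1 phi.
Let B : {poly R} := phi a *: 'X^a.
Let Q := P - B.
(* The contribution to [w^s] phi^n of the products in which phi_a w^a occurs
   exactly k times. *)
Let q k : R := (B ^+ k * Q ^+ (n - k) *+ 'C(n, k))`_s.

Let B_ge0 i : 0 <= B`_i.
Proof. by rewrite coefZ coefXn mulr_ge0 ?ler0n. Qed.

Let Q_ge0 i : 0 <= Q`_i.
Proof.
rewrite coefB coefZ coefXn coef_poly; have [->|ne] := eqVneq i a.
  by rewrite ltnS as_ mulr1 subrr.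
by rewrite mulr0 subr0; case: ifP.
Qed.

Let q_ge0 k : 0 <= q k.
Proof.
rewrite /q coefMn mulrn_wge0 // coefM; apply: sumr_ge0 => j _.
by rewrite mulr_ge0 ?coef_exp_ge0.
Qed.

Let tilted y : ((y *: B + Q) ^+ n)`_s = \sum_(k < n.+1) y ^+ k * q k.
Proof.
rewrite addrC exprDn coef_sum; apply: eq_bigr => k _.
by rewrite /q !coefMn exprZn -scalerAr coefZ mulrnAr [Q ^+ _ * _]mulrC.
Qed.

Let total : pcoef n s = \sum_(k < n.+1) q k.
Proof.
have -> : pcoef n s = ((1 *: B + Q) ^+ n)`_s by rewrite scale1r addrC subrK.
by rewrite tilted; apply: eq_bigr => k _; rewrite expr1n mul1r.
Qed.

Let mean : \sum_(k < n.+1) k%:R * q k = n%:R * (phi a * pcoef n.-1 (s - a)).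
Proof.
have -> : phi a * pcoef n.-1 (s - a) = (B * P ^+ n.-1)`_s.
  rewrite /B -scalerAl coefZ coefXnM ltnNge as_ /=.
  by rewrite (@pcoefE _ _ s.+1) // ltnS leq_subr.
have -> : P = Q + B by rewrite subrK.
rewrite exprDn prednK // mulr_sumr coef_sum mulr_sumr big_ord_recl mul0r add0r.
apply: eq_bigr => -[k /= kn] _; rewrite /bump /= add1n /q.
rewrite coefMn mulr_natl -mulrnA mulnC -mul_bin_diag.
rewrite mulrnAr coefMn mulr_natl -mulrnA mulnC; congr (_`_s *+ _).
rewrite exprS -mulrA [Q ^+ (n.-1 - k) * _]mulrC.
have -> // : (n - k.+1 = n.-1 - k)%N.
by case: (n) n_gt0 => // n' _; rewrite subSS.
Qed.

(** Each step of size [a] is given the weight [y]. One coefficient times tau^s is at most the whole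
    value at [tau], whose n-th root is at most Phi (1 + p (y - 1)) with p = [step a]. *)
Let bound y : 0 < y ->
  ((y *: B + Q) ^+ n)`_s * tau ^+ s / Phi ^+ n <= expR (n%:R * (step a * (y - 1))).
Proof.
move=> y0; have yBQ i : 0 <= (y *: B + Q)`_i.
  by rewrite coefD coefZ addr_ge0 // mulr_ge0 // ltW.
have hor : 0 <= (y *: B + Q).[tau] <= Phi * expR (step a * (y - 1)).
  apply/andP; split.
    by rewrite horner_coef sumr_ge0 // => i _; rewrite mulr_ge0 ?exprn_ge0 ?(ltW tau_gt0).
  have -> : (y *: B + Q).[tau] = P.[tau] + (y - 1) * (phi a * tau ^+ a).
    by rewrite hornerD hornerZ /Q hornerD hornerN /B hornerZ hornerXn; ring.
  apply: le_trans (_ : Phi * (1 + step a * (y - 1)) <= _); last first.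
    by rewrite ler_pM2l // expR_ge1Dx.
  have -> : Phi * (1 + step a * (y - 1)) = Phi + (y - 1) * (phi a * tau ^+ a).
    by rewrite /step; field; rewrite gt_eqF.
  by rewrite lerD2r phi_tau.
rewrite ler_pdivrMr ?exprn_gt0 //.
apply: le_trans (horner_ge0_coef (p := (y *: B + Q) ^+ n) s _ (ltW tau_gt0)) _.
  by move=> i; apply: coef_exp_ge0.
rewrite horner_exp expRM_natl -exprMn mulrC.
case/andP: hor => h1 h2; apply: lerXn2r => //; rewrite nnegrE.
by rewrite mulr_ge0 ?(ltW Phi_gt0) ?expR_ge0.
Qed.

(* Jensen: the number of steps equal to a has conditional mean
   n * step a * walk (n-1) (s-a) / walk n s. *)
Lemma walk_exchange th : 0 < walk n s ->
  walk n s * expR (th * (n%:R * (step a * walk n.-1 (s - a) / walk n s)))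
    <= expR (n%:R * (step a * (expR th - 1))).
Proof.
move=> w0; apply: le_trans (bound (expR_gt0 th)); rewrite tilted.
have pc0 : 0 < pcoef n s.
  rewrite lt_def pcoef_ge0 andbT; apply: contraTneq w0 => e.
  by rewrite /walk e !mul0r ltxx.
have -> : n%:R * (step a * walk n.-1 (s - a) / walk n s) =
    n%:R * (phi a * pcoef n.-1 (s - a)) / pcoef n s.
  have e1 : tau ^+ s = tau ^+ a * tau ^+ (s - a) by rewrite -exprD subnKC.
  have e2 : Phi ^+ n = Phi * Phi ^+ n.-1 by rewrite -exprS prednK.
  rewrite /walk /step e1 e2; field.
  by rewrite !(gt_eqF pc0) !expf_neq0 ?gt_eqF.
rewrite -mean; set m := _ / pcoef n s.
have -> : walk n s * expR (th * m) =
    pcoef n s * expR (th * m) * (tau ^+ s / Phi ^+ n) by rewrite /walk; ring.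
rewrite -[X in _ <= X]mulrA ler_pM2r ?divr_gt0 ?exprn_gt0 //.
(* Jensen in the form of the tangent of k -> exp(th k) at the mean [m]; the linear terms cancel in
   the sum over k. *)
have -> : pcoef n s * expR (th * m) =
    \sum_(k < n.+1) expR (th * m) * (1 + th * (k%:R - m)) * q k.
  transitivity (expR (th * m) * \sum_(k < n.+1) ((1 - th * m) * q k + th * (k%:R * q k))).
    rewrite big_split /= -!mulr_sumr -total mulrC; congr (_ * _).
    by rewrite /m; field; rewrite gt_eqF.
  by rewrite mulr_sumr; apply: eq_bigr => k _; ring.
apply: ler_sum => k _; rewrite ler_wpM2r //.
apply: le_trans (_ : expR (th * m) * expR (th * (k%:R - m)) <= _).
  by rewrite ler_wpM2l ?expR_ge0 ?expR_ge1Dx.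
by rewrite -expRD -mulrDr addrC subrK mulrC expRM_natl.
Qed.

End Exchange.

Lemma expR_quadratic (x : R) : `|x| <= 1 / 2 -> expR x - 1 <= x + 2 * x ^+ 2.
Proof.
rewrite ler_norml => /andP[x1 x2].
have h : 1 - x <= expR (- x) by have := expR_ge1Dx (- x); lra.
have p1 : 0 < 1 - x by lra.
have h2 : expR x <= (1 - x)^-1.
  by rewrite -[expR x]invrK -expRN lef_pV2 ?posrE ?expR_gt0.
suff : (1 - x)^-1 <= 1 + x + 2 * x ^+ 2 by lra.
rewrite -div1r ler_pdivrMr //.
have -> : (1 + x + 2 * x ^+ 2) * (1 - x) = 1 + x ^+ 2 * (1 - 2 * x) by ring.
by rewrite lerDl mulr_ge0 ?sqr_ge0 //; lra.
Qed.

(** In [walk_exchange] a weight of at least exp(- eta n) costs only [eta] per step: th p x <= p (th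
    + 2 th^2) + eta. With eta = 2 p dl^2, th = dl gives x <= 1 + 4 dl and th = - dl gives x >= 1 - 4
    dl, whence dl = e / 4. *)
Lemma walk_ratio a e : 0 < phi a -> 0 < e -> e <= 1 -> exists2 eta, 0 < eta &
  forall n s, (0 < n)%N -> (a <= s)%N -> expR (- (eta * n%:R)) <= walk n s ->
    `|walk n.-1 (s - a) / walk n s - 1| <= e.
Proof.
move=> pa e0 e1; have p0 := step_gt0 pa; set p := step a in p0.
pose dl := e / 4; have dl0 : 0 < dl by rewrite divr_gt0.
exists (2 * p * dl ^+ 2); first by rewrite mulr_gt0 ?exprn_gt0 // mulr_gt0.
move=> n s n0 as_ lo; have w0 : 0 < walk n s by apply: lt_le_trans lo; exact: expR_gt0.
set x := walk n.-1 (s - a) / walk n s.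
have key th : `|th| <= 1 / 2 -> th * (p * x) <= p * (th + 2 * th ^+ 2) + 2 * p * dl ^+ 2.
  move=> hth; have := walk_exchange n0 as_ th w0.
  rewrite -mulrA -/x -/p => h.
  have n1 : 0 < n%:R :> R by rewrite ltr0n.
  have h1 : expR (- (2 * p * dl ^+ 2 * n%:R)) * expR (th * (n%:R * (p * x)))
      <= expR (n%:R * (p * (th + 2 * th ^+ 2))).
    apply: le_trans (_ : expR (n%:R * (p * (expR th - 1))) <= _).
      by apply: le_trans h; rewrite ler_pM2r ?expR_gt0.
    by rewrite ler_expR ler_pM2l // ler_pM2l // expR_quadratic.
  move: h1; rewrite -expRD ler_expR => h1.
  by rewrite -(ler_pM2l n1); lra.
have dl2 : dl <= 1 / 2 by rewrite /dl; lra.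
have k1 := key dl; have k2 := key (- dl).
rewrite normrN gtr0_norm // in k2; rewrite gtr0_norm // in k1.
move: (k1 dl2) (k2 dl2) => {}k1 {}k2.
have pd : 0 < p * dl by rewrite mulr_gt0.
have ee : e = 4 * dl by rewrite /dl; lra.
rewrite ler_norml; apply/andP; split.
  by rewrite -(ler_pM2l pd) ee; nra.
by rewrite -(ler_pM2l pd) ee; nra.
Qed.

End Walk.


Lemma expR_eventually_le (R : realType) (c eta : R) : 0 < c -> 0 < eta ->
  exists N, forall n, (N <= n)%N -> expR (- (eta * n%:R)) <= c.
Proof.
move=> c0 eta0; have x0 : 0 <= (c * eta)^-1 by rewrite invr_ge0 mulr_ge0 ?ltW.
exists (Num.bound (c * eta)^-1) => n nN.
have h : (c * eta)^-1 < n%:R.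
  by apply: lt_le_trans (archi_boundP x0) _; rewrite ler_nat.
rewrite expRN -[c]invrK lef_pV2 ?posrE ?invr_gt0 ?expR_gt0 //.
apply: le_trans (_ : eta * n%:R <= _); last by have := expR_ge1Dx (eta * n%:R); lra.
by rewrite mulrC -ler_pdivrMr // -invfM ltW.
Qed.


Lemma cvg_near_eq (R : realType) (f g : nat -> R) (l : R) :
  (\forall i \near \oo, f i = g i) -> f @ \oo --> l -> g @ \oo --> l.
Proof. by move=> h cf; apply: cvg_trans cf; apply: near_eq_cvg. Qed.

Lemma ler_sum_trunc (R : realType) (f g : nat -> R) n m :
  (forall k, 0 <= g k) ->
  (forall k, (k < n)%N -> f k = 0 \/ (k < m)%N /\ f k <= g k) ->
  \sum_(k < n) f k <= \sum_(k < m) g k.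
Proof.
move=> g0 h; pose F k := if (k < m)%N then g k else 0.
apply: le_trans (_ : \sum_(k < n) F k <= _).
  apply: ler_sum => -[k /= kn] _; rewrite /F.
  by case: (h k kn) => [->|[-> //]]; case: ifP.
have F0 k : 0 <= F k by rewrite /F; case: ifP.
have -> : \sum_(k < m) g k = \sum_(k < m) F k.
  by apply: eq_bigr => k _; rewrite /F ltn_ord.
rewrite -(@sum_ord_widen _ F m (maxn n m)) ?leq_maxr //; last first.
  by move=> j mj; rewrite /F ltnNge mj.
rewrite -!(big_mkord xpredT F) (big_cat_nat (leq0n n) (leq_maxl n m)) /=.
by rewrite lerDl; apply: sumr_ge0.
Qed.

Lemma geometric_bounded (R : realType) (u : nat -> R) (q M : R) N :
  0 <= q < 1 -> 0 <= M -> (forall n, 0 <= u n) ->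
  (forall n, (N <= n)%N -> u n <= M * q ^+ n) ->
  exists B, forall J, \sum_(j < J) u j <= B.
Proof.
move=> /andP[q0 q1] M0 u0 h.
have geo n : \sum_(i < n) M * q ^+ i <= M * (1 - q)^-1.
  rewrite -mulr_sumr ler_wpM2l // -div1r ler_pdivlMr ?subr_gt0 // mulrC.
  have -> : (1 - q) * \sum_(i < n) q ^+ i = 1 - q ^+ n.
    by rewrite -opprB mulNr -subrX1 opprB.
  by rewrite gerBl exprn_ge0.
exists (\sum_(j < N) u j + M * (1 - q)^-1) => J.
have [JN|NJ] := leqP J N.
  apply: le_trans (_ : \sum_(j < N) u j <= _).
    by apply: ler_sum_trunc => // k kJ; right; rewrite (leq_trans kJ).
  by rewrite lerDl mulr_ge0 // invr_ge0 subr_ge0 ltW.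
rewrite (bigID (fun j : 'I_J => (j < N)%N)) /= lerD //.
  by rewrite [X in _ <= X](big_ord_widen J u) // ltnW.
apply: le_trans (geo J); rewrite big_mkcond /=; apply: ler_sum => j _.
case: ifP => [|_]; first by rewrite -leqNgt => /h.
by rewrite mulr_ge0 // exprn_ge0.
Qed.

Lemma linear_ratio (R : realType) (k : nat) : (0 < k)%N ->
  (fun i => (1 + k * i.+1)%:R / (1 + k * i)%:R : R) @ \oo --> (1 : R).
Proof.
move=> k0; apply/cvgrPdist_le => e e0.
have kx : 0 <= k%:R / e by rewrite divr_ge0 ?ler0n ?ltW.
exists (Num.bound (k%:R / e)) => // i /= Ni.
have h : k%:R / e < i%:R by apply: lt_le_trans (archi_boundP kx) _; rewrite ler_nat.
have p1 : 0 < (1 + k * i)%:R :> R by rewrite ltr0n.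
have -> : 1 - (1 + k * i.+1)%:R / (1 + k * i)%:R = - (k%:R / (1 + k * i)%:R) :> R.
  rewrite mulnS addnCA natrD mulrDl divff ?gt_eqF //; ring.
rewrite normrN ger0_norm ?divr_ge0 ?ler0n // ler_pdivrMr //.
move: h; rewrite ltr_pdivrMr // => /ltW /le_trans; apply.
rewrite mulrC ler_pM2l // ler_nat; apply: leq_trans (leq_pmull i k0) _.
exact: leq_addl.
Qed.

Lemma cvg_subseq (R : realType) (f : nat -> R) (g : nat -> nat) (l : R) :
  (forall i, (i <= g i)%N) -> f @ \oo --> l -> (fun i => f (g i)) @ \oo --> l.
Proof.
move=> gi /cvgrPdist_le cf; apply/cvgrPdist_le => e /cf [N _ h].
by exists N => // i /= Ni; apply: h; exact: leq_trans Ni (gi i).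
Qed.

(** * Sequences of walks with subexponentially decaying weight *)

Section GoodWalk.
Variable R : realType.
Variables (phi : nat -> R) (tau Phi : R).
Hypotheses (phi_ge0 : forall n, 0 <= phi n)
  (tau_gt0 : 0 < tau) (Phi_gt0 : 0 < Phi)
  (phi_tau : forall J, (trunc J phi).[tau] <= Phi).

Local Notation w := (walk phi tau Phi).

(** Exactly the sequences to which [walk_ratio] applies eventually for every error; [i <= n i] makes
    the number of steps tend to infinity. *)
Definition subexp (n s : nat -> nat) : Prop :=
  (forall i : nat, (i <= n i)%N) /\
  (forall eta : R, 0 < eta ->
    \forall i \near \oo, expR (- (eta * (n i)%:R)) <= w (n i) (s i)).

Lemma subexp_gt0 n s : subexp n s -> \forall i \near \oo, 0 < w (n i) (s i).
Proof.
case=> _ /(_ 1 ltr01) [N _ h]; exists N => // i Ni; apply: lt_le_trans (h i Ni).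
exact: expR_gt0.
Qed.

(** An added step [a] costs at most the constant factor [step a]. *)
Lemma subexp_up n s a : 0 < phi a -> subexp n s ->
  subexp (fun i => (n i).+1) (fun i => (s i + a)%N).
Proof.
move=> pa [ni h]; split=> [i|eta eta0]; first exact: leqW.
have e0 : 0 < eta / 2 by rewrite divr_gt0.
have pa0 := step_gt0 tau_gt0 Phi_gt0 pa.
have [N1 h1] := expR_eventually_le pa0 e0.
have [N2 _ h2] := h _ e0.
exists (maxn N1 N2) => // i; rewrite /= geq_max => /andP[i1 i2].
apply: le_trans (walk_up phi_ge0 tau_gt0 Phi_gt0 _ _ a).
apply: le_trans (_ : expR (- (eta / 2 * (n i)%:R)) * expR (- (eta / 2 * (n i)%:R)) <= _).
  by rewrite -expRD ler_expR -natr1; lra.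
apply: ler_pM; rewrite ?expR_ge0 ?h2 // h1 //.
exact: leq_trans i1 (ni i).
Qed.

(** By [walk_ratio] the removal of a step [a] changes the weight by a factor tending to 1, in
    particular at least 1 / 2 eventually. *)
Lemma subexp_down n s a : 0 < phi a -> (forall i : nat, (0 < n i)%N) -> (forall i : nat, (a <= s i)%N) ->
  subexp n s -> (forall i : nat, (i <= (n i).-1)%N) ->
  subexp (fun i => (n i).-1) (fun i => (s i - a)%N) /\
  (fun i => w (n i).-1 (s i - a)%N / w (n i) (s i)) @ \oo --> (1 : R).
Proof.
move=> pa n0 as_ gd ni'; have [ni h] := gd.
have lim : (fun i => w (n i).-1 (s i - a)%N / w (n i) (s i)) @ \oo --> (1 : R).
  apply/cvgrPdist_le => e e0.
  have m0 : 0 < Num.min e 1 by rewrite lt_min e0 ltr01.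
  have m1 : Num.min e 1 <= 1 by rewrite ge_min lexx orbT.
  have [eta eta0 hr] := walk_ratio phi_ge0 tau_gt0 Phi_gt0 phi_tau pa m0 m1.
  have [N _ hN] := h _ eta0; exists N => // i Ni /=.
  rewrite distrC; apply: le_trans (hr _ _ (n0 i) (as_ i) (hN i Ni)) _.
  by rewrite ge_min lexx.
split=> //; split=> // eta eta0.
have e0 : 0 < eta / 2 by rewrite divr_gt0.
have c0 : 0 < expR (- eta) / 2 by rewrite divr_gt0 ?expR_gt0.
have [N1 h1] := expR_eventually_le c0 e0.
have [N2 _ h2] := h _ e0.
have half : 0 < 1 / 2 :> R by lra.
have /cvgrPdist_le /(_ _ half) [N3 _ h3] := lim.
exists (maxn N1 (maxn N2 N3)) => // i; rewrite /= !geq_max => /and3P[i1 i2 i3].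
have w0 : 0 < w (n i) (s i) by apply: lt_le_trans (h2 i i2); exact: expR_gt0.
have := h3 i i3; rewrite /= ler_distlC => /andP[r1 _].
have {r1} : 1 / 2 * w (n i) (s i) <= w (n i).-1 (s i - a).
  by rewrite -ler_pdivlMr //; lra.
apply: le_trans.
have := h2 i i2 => /= h2i.
apply: le_trans (_ : 1 / 2 * expR (- (eta / 2 * (n i)%:R)) <= _); last by lra.
have := h1 (n i) (leq_trans i1 (ni i)) => h1i.
have -> : expR (- (eta * (n i).-1%:R)) =
    expR eta * (expR (- (eta / 2 * (n i)%:R)) * expR (- (eta / 2 * (n i)%:R))).
  rewrite -!expRD; congr expR.
  by case: (n i) (n0 i) => // m _; rewrite -natr1 /=; field.
rewrite mulrA ler_pM2r ?expR_gt0 // -ler_pdivlMl ?expR_gt0 // -expRN.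
by apply: le_trans h1i _; rewrite mul1r mulrC.
Qed.

(** The sequence with a step [a] added is again subexponential, so the ratio is that of
    [subexp_down] started from there. *)
Lemma subexp_step n s a : 0 < phi a -> subexp n s ->
  (fun i => w (n i) (s i) / w (n i).+1 (s i + a)%N) @ \oo --> (1 : R).
Proof.
move=> pa gd; have up := subexp_up pa gd.
have a_le i : (a <= s i + a)%N by exact: leq_addl.
have n_gt0 i : (0 < (n i).+1)%N by [].
have n_le i : (i <= ((n i).+1).-1)%N by case: gd => h _; exact: h.
have [_] := subexp_down pa n_gt0 a_le up n_le.
by under eq_fun do rewrite /= addnK.
Qed.

End GoodWalk.


(** * Ratios of the tree coefficients *)

(** The least positive difference e of two elements divides every element, since a nonzero remainder
    would be a smaller difference; so e = d. With x = j d and x + d in S, each N >= j^2 can be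
    written as r (j + 1) + (q - r) j, where q and r are quotient and remainder of N by j. *)
Lemma semigroup_multiples (S : nat -> Prop) d :
  (forall a b, S a -> S b -> S (a + b)%N) -> S 0%N -> (exists k, (0 < k)%N /\ S k) ->
  is_gcd S d -> (0 < d)%N /\ exists n0, forall n, (n0 <= n)%N -> (d %| n)%N -> S n.
Proof.
move=> SD S0 [k [k0 Sk]] [dS dmax].
have SM q a : S a -> S (q * a)%N.
  by move=> Sa; elim: q => [|q IH]; rewrite ?mul0n // mulSn; apply: SD.
have d0 : (0 < d)%N by apply: dvdn_gt0 k0 (dS _ Sk).
split=> //.
pose P e := `[< (0 < e)%N /\ exists x, S x /\ S (x + e)%N >].
have exP : exists e, P e by exists k; apply/asboolP; split=> //; exists 0%N.
have [e /asboolP [e0 [x [Sx Sxe]]] emin] := ex_minnP exP.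
have edS y : S y -> (e %| y)%N.
  move=> Sy; have [//|r0] := posnP (y %% e)%N; first by rewrite /dvdn => ->.
  have : P (y %% e)%N.
    apply/asboolP; split=> //; exists ((y %/ e) * (x + e))%N; split; first exact: SM.
    rewrite mulnDr -addnA -divn_eq; apply: SD => //; exact: SM.
  by move/emin; rewrite leqNgt ltn_pmod.
have de : d = e.
  apply/eqP; rewrite eqn_dvd dmax // andbT.
  by rewrite -(dvdn_addr _ (dS _ Sx)) dS.
subst e; have /dvdnP [j xj] := dS _ Sx.
have [j0|j0] := posnP j.
  exists 0%N => n _ /dvdnP [N ->]; apply: SM.
  by move: Sxe; rewrite xj j0.
exists (d * (j * j))%N => n jn /dvdnP [N nN]; subst n.
have jN : (j * j <= N)%N by rewrite mulnC leq_pmul2r in jn.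
have iq : (N %% j <= N %/ j)%N.
  by apply: leq_trans (ltnW (ltn_pmod N j0)) _; rewrite leq_divRL.
have -> : (N * d = (N %% j) * (x + d) + (N %/ j - N %% j) * x)%N.
  rewrite mulnDr addnAC -mulnDl subnKC // xj mulnA -mulnDl; congr (_ * _)%N.
  exact: divn_eq.
by apply: SD; apply: SM.
Qed.

Lemma finite_pos_lower (R : realType) (f : nat -> R) (P : pred nat) N :
  (forall i, (i < N)%N -> P i -> 0 < f i) ->
  exists2 c, 0 < c & forall i, (i < N)%N -> P i -> c <= f i.
Proof.
elim: N => [|N IH] h; first by exists 1.
have [c c0 hc] := IH (fun i iN => h i (ltnW iN)).
exists (if P N then Num.min c (f N) else c).
  by case: ifP => // PN; rewrite lt_min c0 h.
move=> i; rewrite ltnS leq_eqVlt => /orP[/eqP -> PN|iN Pi].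
  by rewrite PN ge_min lexx orbT.
by case: ifP => _; [rewrite ge_min hc | exact: hc].
Qed.

Section Tree.
Variable R : realType.
Variables (phi t : nat -> R) (rho tau : R) (d : nat).
Hypotheses (phi_ge0 : forall n, 0 <= phi n) (phi0 : phi 0%N = 1)
  (phiD : forall a b, 0 < phi a -> 0 < phi b -> 0 < phi (a + b)%N)
  (phi_pos : exists2 k, (2 <= k)%N & 0 < phi k)
  (phi_gcd : is_gcd (fun k => 0 < phi k) d)
  (t_ge0 : forall n, 0 <= t n)
  (t0 : t 0%N = 0)
  (t_fix : forall N, eqX N (trunc N t) ('X * (trunc N phi \Po trunc N t)))
  (rho0 : 0 < rho) (tau0 : 0 < tau)
  (rho_tau : forall J, rho * (trunc J phi).[tau] <= tau)
  (rho_max : forall x : R, rho < x -> forall M : R, exists N, M < (trunc N t).[x]).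

Definition tn n : R := t n * rho ^+ n.

Let Phi := tau / rho.
Let Phi0 : 0 < Phi. Proof. exact: divr_gt0. Qed.
Let phi_tau J : (trunc J phi).[tau] <= Phi.
Proof. by rewrite /Phi ler_pdivlMr // mulrC. Qed.

Local Notation w := (walk phi tau Phi).
Local Notation p := (step phi tau Phi).

Let w_ge0 n s : 0 <= w n s. Proof. exact: walk_ge0. Qed.

Lemma tn_ge0 n : 0 <= tn n.
Proof. by rewrite mulr_ge0 // exprn_ge0 // ltW. Qed.

Let trunc_t0 N : (trunc N t)`_0 = 0.
Proof. by rewrite coef_poly t0 if_same. Qed.

Lemma tn_walk n : tn n.+1 = tau / n.+1%:R * w n.+1 n.
Proof.
have nN : (0 < n.+1 < n.+2)%N by rewrite ltnSn.
have := lagrange_trunc (trunc_t0 n.+2) (@t_fix n.+2) nN (ltn0Sn n).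
rewrite !expr1 coef_trunc // mul1r subn1 /= -(pcoefE _ _ (leqnSn n.+1)) => h.
rewrite /tn /walk -h /Phi.
have -> : (tau / rho) ^+ n.+1 = tau ^+ n * tau / rho ^+ n.+1.
  by rewrite expr_div_n exprSr.
field.
by rewrite !expf_neq0 ?gt_eqF // addrC natr1 pnatr_eq0.
Qed.

Let phi_semigroup : (0 < d)%N /\
  exists n0, forall n, (n0 <= n)%N -> (d %| n)%N -> 0 < phi n.
Proof.
have p00 : 0 < phi 0%N by rewrite phi0.
have ex : exists k, (0 < k)%N /\ 0 < phi k.
  by have [k k2 pk] := phi_pos; exists k; split=> //; apply: leq_trans k2.
exact: semigroup_multiples phiD p00 ex phi_gcd.
Qed.

Let d0 : (0 < d)%N. Proof. exact: (proj1 phi_semigroup). Qed.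

Lemma pcoef_supp n s : pcoef phi n s != 0 -> (d %| s)%N.
Proof.
rewrite /pcoef; move: (s.+1) => N; elim: n s => [|n IH] s.
  by rewrite expr0 coef1; case: s => [|s] //=; rewrite eqxx.
rewrite exprS coefM => ne; have [//|nd] := boolP (d %| s)%N.
case/eqP: ne; apply: big1 => -[j /= js] _; apply/eqP; rewrite mulf_eq0.
case: eqP => //= /eqP pj; apply/negPn/negP => /IH dsj.
have dj : (d %| j)%N.
  case: phi_gcd => h _; apply: h; rewrite lt_def phi_ge0 andbT.
  by apply: contra pj => /eqP e; rewrite coef_poly e if_same.
by move: nd; rewrite -(subnK (js : (j <= s)%N)) dvdn_add.
Qed.

Lemma tn_supp n : tn n != 0 -> (0 < n)%N /\ (d %| n.-1)%N.
Proof.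
case: n => [|n]; first by rewrite /tn t0 mul0r eqxx.
move=> ne; split=> //=; apply: (@pcoef_supp n.+1); apply: contra ne => /eqP e.
by rewrite tn_walk /walk e !mul0r mulr0.
Qed.

Lemma walk_n0 n : 0 < w n 0.
Proof.
have -> : w n 0 = (Phi ^+ n)^-1.
  rewrite /walk expr0 mulr1 /pcoef; suff -> : (trunc 1 phi ^+ n)`_0 = 1 by rewrite mul1r.
  elim: n => [|n IH]; first by rewrite expr0 coef1.
  by rewrite exprS coefM big_ord1 IH coef_trunc // phi0 mulr1.
by rewrite invr_gt0 exprn_gt0.
Qed.

(** Otherwise T would converge at [rho * expR (eta / 2)] by comparison with a geometric series,
    against the maximality of [rho]. *)
Lemma tn_growth eta N0 : 0 < eta ->
  exists2 m, (N0 <= m)%N & expR (- (eta * m%:R)) <= tn m.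
Proof.
move=> eta0.
have [//|no] := pselect (exists2 m, (N0 <= m)%N & expR (- (eta * m%:R)) <= tn m).
have lt m : (N0 <= m)%N -> tn m <= expR (- (eta * m%:R)).
  by move=> h; rewrite leNgt; apply/negP => h2; apply: no; exists m => //; exact: ltW.
pose x := rho * expR (eta / 2).
pose q := expR (- (eta / 2)).
have q0 : 0 <= q by exact: expR_ge0.
have q1 : q < 1 by rewrite /q -[X in _ < X](@expR0 R) ltr_expR; lra.
have xr : rho < x.
  by rewrite /x ltr_pMr // -[X in X < _](@expR0 R) ltr_expR; lra.
have x0 : 0 <= x by apply: ltW; exact: lt_trans xr.
have tx m : (N0 <= m)%N -> t m * x ^+ m <= q ^+ m.
  move=> h; have -> : t m * x ^+ m = tn m * expR (m%:R * (eta / 2)).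
    by rewrite /tn /x exprMn -expRM_natl; ring.
  apply: le_trans (_ : expR (- (eta * m%:R)) * expR (m%:R * (eta / 2)) <= _).
    by rewrite ler_pM2r ?expR_gt0 ?lt.
  by rewrite -expRD /q -expRM_natl ler_expR; lra.
have [B hB] : exists B, forall J, \sum_(j < J) t j * x ^+ j <= B.
  apply: (@geometric_bounded R (fun j => t j * x ^+ j) q 1 N0) => //.
  - by rewrite q0.
  - by move=> n; rewrite mulr_ge0 // exprn_ge0.
  - by move=> n /tx; rewrite mul1r.
have [N] := rho_max xr B; rewrite trunc_hornerE ltNge => /negP; case; exact: hB.
Qed.

(** A good length from [tn_growth] is completed to a run with as many steps as its sum. Repeating
    that run preserves the excess of one step over the sum, and a short remainder adjusts the
    length. *)
Lemma walk_lower eta : 0 < eta ->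
  \forall i \near \oo, expR (- (eta * (1 + d * i)%:R)) <= w (1 + d * i) (d * i).
Proof.
move=> eta0; have [K K2 pK] := phi_pos; have [n0 hn0] := proj2 phi_semigroup.
(* Two thirds of [eta] pay for the repeated run, one third for the remainder. *)
pose e := eta / 3; have e0 : 0 < e by rewrite divr_gt0.
(* K - 1 steps with sum K, namely one step K and K - 2 steps 0, compensate the sum m - 1 of the m
   steps behind [tn m]. *)
pose c := w K.-1 K / tau.
have c0 : 0 < c.
  rewrite divr_gt0 //; apply: lt_le_trans (_ : w K.-2 0 * p K <= _).
    by rewrite mulr_gt0 ?walk_n0 ?step_gt0.
  have := walk_up phi_ge0 tau0 Phi0 K.-2 0 K; rewrite add0n.
  by case: (K) K2 => [|[|K']].
have [N1 hN1] := expR_eventually_le c0 e0.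
have [m mN hm] := tn_growth (maxn N1 1) e0.
have m1 : (0 < m)%N by apply: leq_trans mN; exact: leq_maxr.
pose M := (d * (m.-1 + K))%N.
have M0 : (0 < M)%N by rewrite muln_gt0 d0 addn_gt0 (ltn_trans _ K2) ?orbT.
have wM : expR (- (2 * e * M%:R)) <= w M M.
  have h1 : expR (- (2 * e * (m.-1 + K)%:R)) <= w (m.-1 + K) (m.-1 + K).
    have -> : (w (m.-1 + K) (m.-1 + K) = w (m + K.-1) (m.-1 + K))%N.
      by congr w; case: (m) m1 => // m' _; case: (K) K2 => // K' _; rewrite /= addnS.
    apply: le_trans (walk_mul phi_ge0 tau0 Phi0 _ _ _ _).
    have -> : w m m.-1 = m%:R / tau * tn m.
      case: (m) m1 => // m' _; rewrite tn_walk /=.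
      have : m'.+1%:R != 0 :> R by rewrite pnatr_eq0.
      by move: m'.+1%:R => x x0; field; rewrite x0 gt_eqF.
    have -> : m%:R / tau * tn m * w K.-1 K = m%:R * (tn m * c) by rewrite /c; ring.
    apply: le_trans (_ : tn m * c <= _); last first.
      apply: ler_peMl; last by rewrite ler1n.
      by apply: mulr_ge0; [exact: tn_ge0 | exact: ltW].
    apply: le_trans (_ : expR (- (e * m%:R)) * expR (- (e * m%:R)) <= _).
      rewrite -expRD ler_expR; have : m%:R <= (m.-1 + K)%:R :> R.
        by rewrite ler_nat; move: m1 K2; clear; lia.
      by move=> h; have := ler_wpM2l (ltW e0) h; lra.
    apply: ler_pM; rewrite ?expR_ge0 //.
    by apply: hN1; apply: leq_trans mN; exact: leq_maxl.
  apply: le_trans (walk_pow phi_ge0 tau0 Phi0 _ _ d).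
  have -> : expR (- (2 * e * M%:R)) = expR (- (2 * e * (m.-1 + K)%:R)) ^+ d.
    by rewrite -expRM_natl /M natrM; congr expR; ring.
  by apply: lerXn2r; rewrite ?nnegrE ?expR_ge0.
(* Lengths 1 + d i are split as j M + r with r in a fixed window. *)
pose f r := w r.+1 r.
have fpos r : (n0 <= r)%N -> (d %| r)%N -> 0 < f r.
  move=> nr dr; apply: lt_le_trans (walk_up phi_ge0 tau0 Phi0 r 0 r).
  by rewrite mulr_gt0 ?walk_n0 ?step_gt0 ?hn0.
have [c' c'0 hc'] := @finite_pos_lower R f
    (fun r => (n0 <= r)%N && (d %| r)%N) (n0 + M)
    (fun r _ h => fpos r (proj1 (andP h)) (proj2 (andP h))).
have [N2 hN2] := expR_eventually_le c'0 e0.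
exists (maxn N2 n0) => // i /=; rewrite geq_max => /andP[iN2 in0].
have id : (i <= d * i)%N by rewrite leq_pmull.
pose r := (n0 + (d * i - n0) %% M)%N; pose j := ((d * i - n0) %/ M)%N.
have dir : (d * i = j * M + r)%N.
  by rewrite /r addnCA /j -divn_eq subnKC // (leq_trans in0).
have dM : (d %| M)%N by rewrite /M dvdn_mulr.
have dr : (d %| r)%N.
  have : (d %| d * i)%N by rewrite dvdn_mulr.
  by rewrite dir dvdn_addr // dvdn_mull.
have hr : c' <= f r.
  by apply: hc'; rewrite /r ?ltn_add2l ?ltn_pmod // leq_addr /= dr.
have -> : (1 + d * i = j * M + r.+1)%N by rewrite dir addnS.
rewrite dir; apply: le_trans (walk_mul phi_ge0 tau0 Phi0 _ _ _ _).
apply: le_trans (_ : expR (- (2 * e * (j * M)%:R)) * expR (- (e * (1 + d * i)%:R)) <= _).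
  rewrite -expRD ler_expR /e.
  have : (j * M)%:R <= (j * M + r.+1)%:R :> R by rewrite ler_nat leq_addr.
  rewrite (_ : (1 + d * i = j * M + r.+1)%N); last by rewrite dir addnS.
  move=> h; have := ler_wpM2l (ltW e0) h; rewrite /e; lra.
apply: ler_pM; rewrite ?expR_ge0 //.
  apply: le_trans (walk_pow phi_ge0 tau0 Phi0 _ _ _).
  have -> : expR (- (2 * e * (j * M)%:R)) = expR (- (2 * e * M%:R)) ^+ j.
    by rewrite -expRM_natl natrM; congr expR; ring.
  by apply: lerXn2r; rewrite ?nnegrE ?expR_ge0.
apply: le_trans hr; apply: hN2; apply: leq_trans iN2 _.
by apply: leq_trans id _; rewrite leq_addl.
Qed.

Let subexp_base : subexp phi tau Phi (fun i => 1 + d * i)%N (fun i => d * i)%N.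
Proof.
split=> [i|]; last exact: walk_lower.
by rewrite (leq_trans (leq_pmull i d0)) // leq_addl.
Qed.

Let phi00 : 0 < phi 0%N. Proof. by rewrite phi0. Qed.

(** A step x + d is added and a step x removed, then d steps 0 are added: number of steps and sum
    both grow by d, and each move has a ratio tending to 1. As large multiples of d, x and x + d are
    both possible steps. *)
Let walk_period :
  (fun i => w (1 + d * i) (d * i) / w (1 + d * i.+1) (d * i.+1)) @ \oo --> (1 : R).
Proof.
have [n0 hn0] := proj2 phi_semigroup.
pose x := (d * n0)%N; have xn : (n0 <= x)%N by rewrite leq_pmull.
have px : 0 < phi x by apply: hn0; rewrite // dvdn_mulr.
have pxd : 0 < phi (x + d)%N.
  by apply: hn0; rewrite ?dvdn_add ?dvdn_mulr // (leq_trans xn) // leq_addr.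
have c1 := subexp_step phi_ge0 tau0 Phi0 phi_tau pxd subexp_base.
have up := subexp_up phi_ge0 tau0 Phi0 pxd subexp_base.
have a_le i : (x <= d * i + (x + d))%N by rewrite addnCA leq_addr.
have n_gt i : (0 < (1 + d * i).+1)%N by [].
have n_le i : (i <= ((1 + d * i).+1).-1)%N by case: subexp_base.
have [gv c2] := subexp_down phi_ge0 tau0 Phi0 phi_tau px n_gt a_le up n_le.
have eS i : (d * i + (x + d) - x = d * i.+1)%N by rewrite addnCA addKn mulnS addnC.
have es : (fun i => d * i + (x + d) - x)%N = (fun i => d * i.+1)%N.
  by apply/funext => i; exact: eS.
rewrite /= es in gv; move: c2; rewrite /=; under eq_fun do rewrite eS; move=> c2.
have chain j : subexp phi tau Phi (fun i => 1 + d * i + j)%N (fun i => d * i.+1)%N /\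
    (fun i => w (1 + d * i) (d * i.+1) / w (1 + d * i + j) (d * i.+1)) @ \oo --> (1 : R).
  elim: j => [|j [gj cj]].
    have e0 : (fun i => 1 + d * i + 0)%N = (fun i => 1 + d * i)%N.
      by apply/funext => i; rewrite addn0.
    rewrite e0; split=> //.
    apply: cvg_near_cst; near=> i; rewrite addn0 divff // gt_eqF //; near: i; exact: subexp_gt0 gv.
  have gj' := subexp_up phi_ge0 tau0 Phi0 phi00 gj.
  have cj' := subexp_step phi_ge0 tau0 Phi0 phi_tau phi00 gj.
  have e1 : (fun i => (1 + d * i + j).+1) = (fun i => 1 + d * i + j.+1)%N.
    by apply/funext => i; rewrite addnS.
  have e2 : (fun i => d * i.+1 + 0)%N = (fun i => d * i.+1)%N.
    by apply/funext => i; rewrite addn0.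
  rewrite e1 e2 in gj'; split=> //.
  have pos := subexp_gt0 gj.
  have /(_ _) lim := cvgM cj cj'; rewrite mulr1 in lim; apply: cvg_near_eq lim.
  near=> i; rewrite /= addn0 addnS.
  have p1 : 0 < w (1 + d * i + j) (d * i.+1) by near: i; exact: pos.
  by rewrite /= mulrA divfK // gt_eqF.
have [_ c3] := chain d.
have pos1 := subexp_gt0 up; have pos2 := subexp_gt0 gv.
have /(_ _) cV := cvgV (oner_neq0 _) c2.
have /(_ _) c12 := cvgM c1 cV.
have /(_ _) lim := cvgM c12 c3.
rewrite invr1 !mulr1 in lim; apply: cvg_near_eq lim; near=> i.
have p1 : 0 < w (1 + d * i).+1 (d * i + (x + d)) by near: i; exact: pos1.
have p2 : 0 < w (1 + d * i) (d * i.+1) by near: i; exact: pos2.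
have e : (1 + d * i + d = 1 + d * i.+1)%N by rewrite mulnS addnA addnAC.
rewrite /= e.
have [->|nz] := eqVneq (w (1 + d * i.+1) (d * i.+1)) 0; first by rewrite invr0 !mulr0.
rewrite /=; field.
by rewrite nz !gt_eqF.
Unshelve. all: by end_near. Qed.

Lemma tn_gt0_near : \forall i \near \oo, 0 < tn (1 + d * i).
Proof.
have pos := subexp_gt0 subexp_base.
near=> i; rewrite add1n tn_walk; apply: mulr_gt0; first by rewrite divr_gt0.
by near: i; exact: pos.
Unshelve. all: by end_near. Qed.

Lemma tn_ratio : (fun i => tn (1 + d * i) / tn (1 + d * i.+1)) @ \oo --> (1 : R).
Proof.
have /(_ _) lim := cvgM (@linear_ratio R _ d0) walk_period; rewrite mulr1 in lim.
apply: cvg_near_eq lim; near=> i.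
rewrite /= !add1n !tn_walk.
have p1 : (d * i).+1%:R != 0 :> R by rewrite pnatr_eq0.
have p2 : (d * i.+1).+1%:R != 0 :> R by rewrite pnatr_eq0.
have [->|nz] := eqVneq (w (d * i.+1).+1 (d * i.+1)) 0; first by rewrite !mulr0 !invr0 !mulr0.
move: p1 p2 nz; move: (d * i).+1%:R (d * i.+1).+1%:R => a b.
move: (w _ _) (w _ _) => u v a0 b0 v0.
by field; rewrite a0 b0 v0 gt_eqF.
Unshelve. all: by end_near. Qed.

(** The sum is rho^(n+2) [z^(n+2)] T^2 with n = d i, which Lagrange inversion expresses by n + 2
    steps with sum n. Dropping a step 0 leads back to [tn (n + 1)]. In 4 tau, one factor 2 is the
    exponent of T^2 and the other bounds the ratio of the two weights. *)
Lemma tn_conv : exists2 C, 0 < C & \forall i \near \oo,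
  \sum_(k < (d * i).+3) tn k * tn ((d * i).+2 - k)%N <= C * tn (1 + d * i).
Proof.
exists (4 * tau); first by rewrite mulr_gt0.
have c := subexp_step phi_ge0 tau0 Phi0 phi_tau phi00 subexp_base.
have half : 0 < 1 / 2 :> R by lra.
have pos := subexp_gt0 (subexp_up phi_ge0 tau0 Phi0 phi00 subexp_base).
move/cvgrPdist_le : c => /(_ _ half) c.
near=> i.
have p1 : 0 < w (1 + d * i).+1 (d * i + 0) by near: i; exact: pos.
have cn : `|1 - w (1 + d * i) (d * i) / w (1 + d * i).+1 (d * i + 0)| <= 1 / 2.
  by near: i; exact: c.
move: p1 cn; rewrite addn0 add1n; set n := (d * i)%N => p1 cn.
have -> : \sum_(k < n.+3) tn k * tn (n.+2 - k)%N =
    rho ^+ n.+2 * ((trunc n.+3 t) ^+ 2)`_n.+2.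
  rewrite expr2 coefM mulr_sumr; apply: eq_bigr => -[k /= kn] _.
  have kn' : (n.+2 - k < n.+3)%N by rewrite ltnS leq_subr.
  rewrite !coef_trunc // /tn mulrACA -exprD subnKC //; ring.
have n23 : (0 < n.+2 < n.+3)%N by rewrite ltnSn.
have lag : n.+2%:R * (trunc n.+3 t ^+ 2)`_n.+2 = 2 * pcoef phi n.+2 n.
  have n3 : (n < n.+3)%N by rewrite ltnS leqW.
  have := lagrange_trunc (trunc_t0 n.+3) (@t_fix n.+3) n23 (isT : (2 <= n.+2)%N).
  by rewrite (pcoefE _ _ n3) => ->; rewrite subSS subSS subn0.
have wup : w n.+2 n <= 2 * w n.+1 n.
  move: cn; rewrite ler_distlC => /andP[h _].
  have : 1 / 2 * w n.+2 n <= w n.+1 n by rewrite -ler_pdivlMr //; lra.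
  by lra.
have eP : (tau / rho) ^+ n.+2 = tau ^+ 2 * tau ^+ n / rho ^+ n.+2.
  by rewrite expr_div_n -exprD.
have ew : w n.+2 n = pcoef phi n.+2 n * rho ^+ n.+2 / tau ^+ 2.
  by rewrite /walk /Phi eP; field; rewrite !expf_neq0 ?gt_eqF.
rewrite ew in wup.
rewrite tn_walk.
have n1 : 0 < n.+1%:R :> R by rewrite ltr0n.
have n2 : 0 < n.+2%:R :> R by rewrite ltr0n.
rewrite -(ler_pM2l n2) mulrCA lag.
have {}wup : pcoef phi n.+2 n * rho ^+ n.+2 <= 2 * tau ^+ 2 * w n.+1 n.
  by move: wup; rewrite ler_pdivrMr ?exprn_gt0 //; lra.
apply: le_trans (_ : 2 * (2 * tau ^+ 2 * w n.+1 n) <= _); first by lra.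
have -> : n.+2%:R * (4 * tau * (tau / n.+1%:R * w n.+1 n)) =
  (n.+2%:R / n.+1%:R) * (2 * (2 * tau ^+ 2 * w n.+1 n)) by field; rewrite gt_eqF.
apply: ler_peMl; last by rewrite ler_pdivlMr // mul1r ler_nat.
apply: mulr_ge0 => //; apply: mulr_ge0 => //; apply: mulr_ge0 => //.
by apply: exprn_ge0; exact: ltW.
Unshelve. all: by end_near. Qed.

End Tree.


(** * Transfer to all graphs *)

Section Transfer.
Variable R : realType.
Variables (tn al : nat -> R) (d : nat).
Hypotheses (d0 : (0 < d)%N) (tn_ge0 : forall n, 0 <= tn n)
  (tn_supp : forall n, tn n != 0 -> (0 < n)%N /\ (d %| n.-1)%N)
  (tn1 : 0 < tn 1)
  (tn_gt0 : \forall i \near \oo, 0 < tn (1 + d * i))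
  (tn_ratio : (fun i => tn (1 + d * i) / tn (1 + d * i.+1)) @ \oo --> (1 : R))
  (tn_conv : exists2 C, 0 < C & \forall i \near \oo,
     \sum_(k < (d * i).+3) tn k * tn ((d * i).+2 - k)%N <= C * tn (1 + d * i))
  (al0 : al 0%N = 1) (al_ge0 : forall n, 0 <= al n)
  (al_rec : forall n, n.+1%:R * al n.+1 = \sum_(k < n.+1) tn k.+1 * al (n - k)%N).

(* tn is periodically zero; h fills the gaps. *)
Definition fill n := tn (1 + d * (n.-1 %/ d)).
Local Notation h := fill.

Lemma fill_ge0 n : 0 <= h n. Proof. exact: tn_ge0. Qed.

Lemma fillE n : (0 < n)%N -> (d %| n.-1)%N -> h n = tn n.
Proof. by move=> n0 dn; rewrite /h mulnC divnK // add1n prednK. Qed.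

Lemma tn_le_fill n : tn n <= h n.
Proof.
have [->|/tn_supp [n0 dn]] := eqVneq (tn n) 0; first exact: fill_ge0.
by rewrite fillE.
Qed.

Lemma fill_gt0 : \forall n \near \oo, 0 < h n.
Proof.
case: tn_gt0 => N _ hN; exists (N * d).+1 => // n /= hn; apply: hN => /=.
by rewrite leq_divRL //; case: n hn.
Qed.

Lemma fill_ratio : (fun n => h n / h n.+1) @ \oo --> (1 : R).
Proof.
apply/cvgrPdist_le => e e0.
move/cvgrPdist_le : tn_ratio => /(_ _ e0) [N1 _ h1].
case: tn_gt0 => N2 _ h2.
exists ((maxn N1 N2) * d).+1 => // -[//|n] /= hn.
have hN : (maxn N1 N2 <= n %/ d)%N by rewrite leq_divRL.
move: (hN); rewrite geq_max => /andP[n1 n2].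
have le1 : (n %/ d <= n.+1 %/ d)%N by apply: leq_div2r.
have le2 : (n.+1 %/ d <= (n %/ d).+1)%N.
  by rewrite -ltnS ltn_divLR // mulSn (leq_trans (n := d + (n %/ d).+1 * d)) //; have := ltn_ceil n d0; lia.
rewrite /h /=; have [e1|e1] : (n.+1 %/ d = n %/ d)%N \/ (n.+1 %/ d = (n %/ d).+1)%N.
    by move: le1 le2; lia.
  rewrite e1 divff ?subrr ?normr0 ?ltW //.
  by rewrite gt_eqF //; apply: h2.
by rewrite e1; apply: h1.
Qed.

Lemma fill_shift j : (fun n => h n / h (n + j)%N) @ \oo --> (1 : R).
Proof.
elim: j => [|j IH].
  apply: cvg_near_cst; case: fill_gt0 => N _ hN; exists N => // n /hN h0.
  by rewrite addn0 divff // gt_eqF.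
have sh : (fun n => h (n + j)%N / h (n + j).+1) @ \oo --> (1 : R).
  have := fill_ratio; rewrite -(cvg_shiftn j); exact.
have /(_ _) lim := cvgM IH sh; rewrite mulr1 in lim; apply: cvg_near_eq lim.
case: fill_gt0 => N _ hN; exists N => // n Nn /=.
have p1 : 0 < h (n + j) by apply: hN => /=; rewrite (leq_trans Nn) ?leq_addr.
by rewrite addnS mulrA divfK // gt_eqF.
Qed.

Lemma fill_shift_near j (e : R) : 0 < e -> \forall n \near \oo,
  `|h (n - j)%N - h n| <= e * h n.
Proof.
move=> e0; move/cvgrPdist_le : (@fill_shift j) => /(_ _ e0) [N1 _ h1].
case: fill_gt0 => N2 _ h2.
exists (maxn N1 N2 + j)%N => // n /= hn.
have jn : (j <= n)%N by apply: leq_trans hn; exact: leq_addl.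
have : (maxn N1 N2 <= n - j)%N by rewrite leq_subRL // addnC.
rewrite geq_max => /andP[n1 n2].
have hp : 0 < h n by apply: h2 => /=; apply: leq_trans n2 (leq_subr _ _).
have := h1 (n - j)%N n1; rewrite /= subnK // distrC.
have -> : h (n - j) / h n - 1 = (h (n - j) - h n) / h n.
  by rewrite mulrBl divff // gt_eqF.
by rewrite normrM normfV (gtr0_norm hp) ler_pdivrMr.
Qed.

(** [tn (n - j)] vanishes unless n - j = 1 mod d, and for those j the value [h j] is [tn] at an
    index rounded down by the same amount for all j. So the sum is part of a convolution square of
    [tn]; the factor 2 pays for shifting [h] by one. *)
Lemma fill_conv : exists2 C, 0 < C & \forall n \near \oo,
  \sum_(j < n | (0 < j)%N) tn (n - j)%N * h j <= C * h n.
Proof.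
case: tn_conv => C C0 [N1 _ h1]; exists (2 * C); first by rewrite mulr_gt0.
have [N2 _ h2] := fill_shift_near 1 (ltr01 : 0 < 1 :> R).
exists ((maxn N1 N2 * d) + N2).+2 => // -[//|[//|n]] /= hn.
pose i := (n %/ d)%N.
have Ni : (N1 <= i)%N.
  apply: leq_trans (leq_maxl N1 N2) _; rewrite leq_divRL //.
  exact: leq_trans (leq_addr N2 _) hn.
have hE : h n.+1 = tn (1 + d * i) by [].
apply: le_trans (_ : C * tn (1 + d * i) <= _); last first.
  rewrite -hE [2 * C]mulrC -mulrA ler_pM2l //.
  have := h2 n.+2; rewrite /= subn1 /= mul1r ler_distl => /(_ _) /andP[|_]; first by lia.
  by lra.
apply: le_trans (h1 i Ni); rewrite big_ord_recl.
pose G k := if (k < n.+1)%N then tn k.+1 * h (n.+1 - k)%N else 0.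
have -> : \sum_(j < n.+2 | (0 < j)%N) tn (n.+2 - j)%N * h j = \sum_(k < n.+2) G k.
  rewrite big_mkcond (reindex_inj rev_ord_inj) /=; apply: eq_bigr => -[k /= kn] _.
  rewrite /G subSS subn_gt0; case: ifP => // kn'.
  by congr (tn _ * _); lia.
apply: le_trans (_ : \sum_(k < (d * i).+2) tn k.+1 * tn ((d * i).+1 - k)%N <= _); last first.
  by rewrite lerDr mulr_ge0.
apply: (@ler_sum_trunc _ G (fun k => tn k.+1 * tn ((d * i).+1 - k)%N)) => [k|k kn].
  by rewrite mulr_ge0.
rewrite /G; case: ifP => [kn'|_]; last by left.
have [->|/tn_supp [_ /= dk]] := eqVneq (tn k.+1) 0; first by left; rewrite mul0r.
right; have [k' ek] := dvdnP dk.
have ki : (k' <= i)%N by rewrite leq_divRL // -ek.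
split; first by rewrite ek mulnC ltnS leqW // leq_mul2l ki orbT.
have -> : h (n.+1 - k) = tn (1 + d * (i - k')).
  rewrite /h; congr (tn (1 + d * _)); rewrite subSn ?[(n.+1 - k)%N]subSn //=.
  have -> : (n - k = (i - k') * d + n %% d)%N.
    by rewrite mulnBl -ek {1}(divn_eq n d) addnBAC // ek leq_mul2r ki orbT.
  by rewrite divnMDl // divn_small ?addn0 // ltn_pmod.
have -> // : (1 + d * (i - k') = (d * i).+1 - k)%N.
by rewrite mulnBr subSn ?add1n ?ek 1?[(k' * d)%N]mulnC // leq_mul2l ki orbT.
Qed.

Lemma al_rev n : n%:R * al n = \sum_(j < n) al j * tn (n - j)%N.
Proof.
case: n => [|n]; first by rewrite mul0r big_ord0.
rewrite al_rec (reindex_inj rev_ord_inj) /=; apply: eq_bigr => -[k /= kn] _.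
by rewrite subSS subKn // mulrC subSn.
Qed.

(* Only boundedly many small indices j contribute to n * al n: the others carry
   a factor 1 / j. *)
Lemma al_tail C M J n : (0 < J)%N -> 0 <= M ->
  \sum_(j < n | (0 < j)%N) tn (n - j)%N * h j <= C * h n ->
  (forall j, (J <= j < n)%N -> j%:R * al j <= M * h j) ->
  \sum_(j < n | (J <= j)%N) al j * tn (n - j)%N <= M * C / J%:R * h n.
Proof.
move=> J0 M0 hC hM; have J1 : 0 < J%:R :> R by rewrite ltr0n.
apply: le_trans (_ : M / J%:R * \sum_(j < n | (0 < j)%N) tn (n - j)%N * h j <= _).
  rewrite mulr_sumr [X in X <= _]big_mkcond [X in _ <= X]big_mkcond /=.
  apply: ler_sum => -[j /= jn] _; case: ifP => [Jj|_]; last first.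
    case: ifP => // _; apply: mulr_ge0; first by rewrite divr_ge0 // ltW.
    by rewrite mulr_ge0 // fill_ge0.
  have j0 : (0 < j)%N by apply: leq_trans Jj.
  rewrite j0 mulrC mulrCA ler_wpM2l // -(ler_pM2l J1).
  apply: le_trans (_ : j%:R * al j <= _); first by rewrite ler_wpM2r // ler_nat.
  apply: le_trans (hM j _) _; first by rewrite Jj.
  by rewrite mulrA [J%:R * _]mulrC divfK // gt_eqF.
have -> : M * C / J%:R * h n = M / J%:R * (C * h n) by ring.
by rewrite ler_wpM2l // divr_ge0 // ltW.
Qed.

(** For finitely many j, [tn (n - j)] is at most [h (n - j)], which is eventually below 2 h_n. *)
Lemma al_head J : exists2 c, 0 <= c & \forall n \near \oo,
  \sum_(j < n | (j < J)%N) al j * tn (n - j)%N <= c * h n.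
Proof.
elim: J => [|J [c c0 [N1 _ h1]]].
  exists 0 => //; exists 0%N => // n _; rewrite mul0r big1 //.
exists (c + 2 * al J); first by rewrite addr_ge0 // mulr_ge0.
have [N2 _ h2] := fill_shift_near J (ltr01 : 0 < 1 :> R).
exists (maxn N1 N2 + J.+1)%N => // n /= hn.
have Jn : (J < n)%N by apply: leq_trans hn; exact: leq_addl.
rewrite (bigD1 (Ordinal Jn)) //= addrC mulrDl lerD //.
  apply: le_trans (h1 n _); last by rewrite /=; lia.
  rewrite le_eqVlt; apply/orP; left; apply/eqP; apply: eq_bigl => j.
  by rewrite -val_eqE /= ltnS; case: ltngtP.
rewrite -mulrA mulrCA ler_wpM2l //.
apply: le_trans (tn_le_fill _) _.
have := h2 n; rewrite /= mul1r ler_distl => /(_ _) /andP[|_]; first by lia.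
by lra.
Qed.

(** Strong induction. Indices below [J] cost c h_n; the others, by the induction hypothesis, cost M
    C / J times h_n, at most half of M h_n since J >= 2 C. So M >= 2 c closes the induction, and the
    summand [S] of [M] covers the finitely many indices before the estimates hold. *)
Lemma al_bound : exists2 M, 0 < M & \forall n \near \oo, n%:R * al n <= M * h n.
Proof.
have [C C0 [N1 _ h1]] := fill_conv; have [N0 _ h0] := fill_gt0.
pose J := (maxn N0 (Num.bound (2 * C))).+1.
have JC : 2 * C <= J%:R.
  apply: ltW; apply: lt_le_trans (archi_boundP _) _; first by rewrite mulr_ge0 ?ltW.
  by rewrite ler_nat /J leqW // leq_maxr.
have [c c0 [N2 _ h2]] := al_head J.
pose N := maxn N1 N2.
pose S := \sum_(n < N) n%:R * al n / h n.
have term0 n : 0 <= n%:R * al n / h n by rewrite divr_ge0 ?fill_ge0 // mulr_ge0.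
have S0 : 0 <= S by apply: sumr_ge0.
pose M := 2 * c + S + 1.
have M0 : 0 < M by rewrite /M; lra.
exists M => //; exists J => // n /= Jn.
elim/ltn_ind: n Jn => n IH Jn.
have hn : 0 < h n by apply: h0 => /=; rewrite (leq_trans _ Jn) // /J leqW // leq_maxl.
have [nN|Nn] := ltnP n N.
  rewrite -ler_pdivrMr //; apply: le_trans (_ : S <= _); last by rewrite /M; lra.
  by rewrite /S (bigD1 (Ordinal nN)) //= lerDl sumr_ge0.
rewrite al_rev (bigID (fun j : 'I_n => (j < J)%N)) /=.
move: Nn; rewrite geq_max => /andP[n1 n2].
have tl := @al_tail C M J n isT (ltW M0) (h1 n n1).
apply: le_trans (_ : c * h n + M * C / J%:R * h n <= _).
  apply: lerD; first exact: h2.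
  under eq_bigl do rewrite -leqNgt.
  by apply: tl => j /andP[Jj jn]; apply: IH.
rewrite -mulrDl ler_pM2r //.
have MC : M * C / J%:R <= M / 2.
  by rewrite ler_pdivrMr ?ltr0n // -mulrA ler_pM2l //; lra.
by apply: le_trans (lerD (lexx c) MC) _; rewrite /M; lra.
Qed.

Definition partial J r := \sum_(j < J | (j == r %[mod d])%N) al j.

(** Indices j >= J cost e / 2 by [al_tail]. For j < J, [tn (n + 1 - j)] is close to [h (n + 1)] if j
    = n mod d and is 0 otherwise. [J] is fixed before [n] grows. *)
Lemma partial_approx (e : R) : 0 < e -> exists J0, forall J, (J0 <= J)%N ->
  \forall n \near \oo, `|n.+1%:R * al n.+1 - partial J n * h n.+1| <= e * h n.+1.
Proof.
move=> e0; have [M M0 [N1 _ hM]] := al_bound; have [C C0 [N2 _ hC]] := fill_conv.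
have [N0 _ h0] := fill_gt0.
have e2 : 0 < e / 2 by rewrite divr_gt0.
have x0 : 0 <= M * C / (e / 2) by rewrite divr_ge0 ?mulr_ge0 ?ltW.
exists (maxn N1 (Num.bound (M * C / (e / 2)))).+1 => J JJ.
have J0 : (0 < J)%N by apply: leq_ltn_trans JJ.
have J1 : 0 < J%:R :> R by rewrite ltr0n.
have MCJ : M * C / J%:R <= e / 2.
  rewrite ler_pdivrMr // -ler_pdivrMl // [X in X <= _]mulrC; apply: ltW.
  apply: lt_le_trans (archi_boundP x0) _; rewrite ler_nat.
  by apply: leq_trans (ltnW JJ); exact: leq_maxr.
pose A := \sum_(j < J) al j.
have A0 : 0 <= A by apply: sumr_ge0.
(* The head errors are weighted by [al j], of total [A]; the added 1 excludes a zero denominator. *)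
have d1 : 0 < (e / 2) / (A + 1) by rewrite divr_gt0 //; lra.
have near_all : \forall n \near \oo, forall j, (j < J)%N ->
    `|h (n - j)%N - h n| <= (e / 2) / (A + 1) * h n.
  elim: (J) => [|K [N3 _ h3]]; first by exists 0%N.
  have [N4 _ h4] := fill_shift_near K d1.
  exists (maxn N3 N4) => // n /=; rewrite geq_max => /andP[n3 n4] j.
  by rewrite ltnS leq_eqVlt => /orP[/eqP ->|jK]; [exact: h4 | exact: h3].
have [N3 _ h3] := near_all.
exists (maxn (maxn N0 N2) (maxn N3 J)) => // n /=.
rewrite !geq_max => /andP[/andP[n0 n2] /andP[n3 nJ]].
have hn : 0 < h n.+1 by apply: h0 => /=; exact: leqW.
have tl : \sum_(j < n.+1 | (J <= j)%N) al j * tn (n.+1 - j)%N <= e / 2 * h n.+1.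
  apply: le_trans (@al_tail C M J n.+1 J0 (ltW M0) (hC _ (leqW n2)) _) _.
    move=> j /andP[Jj _]; apply: hM => /=; apply: leq_trans Jj.
    by apply: leq_trans (ltnW JJ); exact: leq_maxl.
  by rewrite ler_pM2r.
have tl0 : 0 <= \sum_(j < n.+1 | (J <= j)%N) al j * tn (n.+1 - j)%N.
  by apply: sumr_ge0 => j _; rewrite mulr_ge0.
rewrite al_rev (bigID (fun j : 'I_n.+1 => (j < J)%N)) /=.
have -> : \sum_(j < n.+1 | ~~ (j < J)%N) al j * tn (n.+1 - j)%N =
    \sum_(j < n.+1 | (J <= j)%N) al j * tn (n.+1 - j)%N.
  by apply: eq_bigl => j; rewrite -leqNgt.
set T := \sum_(j < n.+1 | (J <= j)%N) _ in tl tl0 *.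
have -> : \sum_(j < n.+1 | (j < J)%N) al j * tn (n.+1 - j)%N =
    \sum_(j < J) al j * tn (n.+1 - j)%N.
  by rewrite (big_ord_widen n.+1 (fun j => al j * tn (n.+1 - j)%N)) // leqW.
set H := \sum_(j < J) _.
suff hH : `|H - partial J n * h n.+1| <= e / 2 * h n.+1.
  have -> : H + T - partial J n * h n.+1 = (H - partial J n * h n.+1) + T by ring.
  apply: le_trans (ler_normD _ _) _; rewrite (ger0_norm tl0); lra.
have -> : H - partial J n * h n.+1 =
    \sum_(j < J) al j * (tn (n.+1 - j)%N - (if (j == n %[mod d])%N then h n.+1 else 0)).
  rewrite /partial big_mkcond mulr_suml -sumrB; apply: eq_bigr => j _.
  by case: ifP => _; ring.
apply: le_trans (ler_norm_sum _ _ _) _.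
apply: le_trans (_ : \sum_(j < J) al j * ((e / 2) / (A + 1) * h n.+1) <= _).
  apply: ler_sum => -[j /= jJ] _; rewrite normrM (ger0_norm (al_ge0 j)) ler_wpM2l //.
  have jn : (j <= n)%N by apply: leq_trans (ltnW jJ) nJ.
  case: ifP => jm.
    rewrite -fillE; last 2 first.
    - by rewrite subn_gt0.
    - by rewrite subSn //= -eqn_mod_dvd // eq_sym.
    by apply: h3 => //=; exact: leqW.
  have -> : tn (n.+1 - j) = 0.
    apply/eqP/negPn/negP => /tn_supp [_].
    by rewrite subSn //= -eqn_mod_dvd // eq_sym jm.
  by rewrite subrr normr0 mulr_ge0 ?fill_ge0 // ltW.
rewrite -mulr_suml -/A; have -> : A * (e / 2 / (A + 1) * h n.+1) =
  (A / (A + 1)) * (e / 2 * h n.+1) by ring.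
apply: ler_piMl; first by apply: mulr_ge0; [exact: ltW | exact: fill_ge0].
have A1 : 0 < A + 1 by lra.
by rewrite ler_pdivrMr // mul1r lerDl.
Qed.

Lemma partial_mono J J' r : (J <= J')%N -> partial J r <= partial J' r.
Proof.
move=> JJ; rewrite /partial (big_ord_widen_cond J' (fun j => (j == r %[mod d])%N) al JJ).
rewrite [X in X <= _]big_mkcond [X in _ <= X]big_mkcond; apply: ler_sum => j _ /=.
by case: (_ == _) => //=; case: ifP.
Qed.

Lemma partial_mod J r r' : (r = r' %[mod d])%N -> partial J r = partial J r'.
Proof. by move=> e; apply: eq_bigl => j; rewrite e. Qed.

(** At one large index congruent to r, the partial sum times [h] is within [h] of a quantity that
    [al_bound] keeps below M h; hence M + 1. *)
Lemma partial_bounded : exists B, forall J r, partial J r <= B.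
Proof.
have [M M0 [N1 _ hM]] := al_bound; have [J0 hJ] := partial_approx ltr01.
have [N0 _ h0] := fill_gt0.
exists (M + 1) => J r.
apply: le_trans (partial_mono r (leq_maxl J J0)) _.
have [N2 _ h2] := hJ (maxn J J0) (leq_maxr _ _).
pose n := (maxn N0 (maxn N1 N2) * d + r)%N.
have Nn : (maxn N0 (maxn N1 N2) <= n)%N.
  by apply: leq_trans (leq_addr _ _); rewrite leq_pmulr.
move: Nn; rewrite !geq_max => /and3P[n0 n1 n2].
rewrite (@partial_mod _ r n); last by rewrite /n modnMDl.
have hn : 0 < h n.+1 by apply: h0; exact: leqW.
rewrite -(ler_pM2r hn).
have := hM n.+1 (leqW n1); have := h2 n n2 => /=.
by rewrite mul1r ler_distl => /andP[a b] c; lra.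
Qed.

Definition plim r := sup (range (fun J => partial J r)).

Let has_sup_partial r : has_sup (range (fun J => partial J r)).
Proof.
split; first by exists (partial 0 r); exists 0%N.
by have [B hB] := partial_bounded; exists B => _ [J _ <-].
Qed.

Lemma partial_le_plim J r : partial J r <= plim r.
Proof. by apply: ub_le_sup; [case: (has_sup_partial r) | exists J]. Qed.

Lemma partial_cvg (e : R) r : 0 < e -> exists J0, forall J, (J0 <= J)%N ->
  `|partial J r - plim r| <= e.
Proof.
move=> e0; have [_ [J0 _ <-] hJ] := sup_adherent e0 (has_sup_partial r).
exists J0 => J JJ; rewrite ler_distl; have := partial_le_plim J r.
have := partial_mono r JJ; rewrite -/(plim r) in hJ => h1 h2.
by apply/andP; split; lra.
Qed.

Lemma plim_mod r r' : (r = r' %[mod d])%N -> plim r = plim r'.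
Proof.
move=> e; have e2 : (fun J => partial J r) = (fun J => partial J r').
  by apply/funext => J; exact: partial_mod.
by rewrite /plim e2.
Qed.

Lemma al_gt0 n : 0 < al n.
Proof.
elim: n => [|n IH]; first by rewrite al0 ltr01.
have n1 : 0 < n.+1%:R :> R by rewrite ltr0n.
rewrite -(pmulr_rgt0 _ n1) al_rec big_ord_recl /= subn0.
apply: ltr_wpDr; last exact: mulr_gt0.
by apply: sumr_ge0 => k _; rewrite mulr_ge0.
Qed.

Lemma plim_gt0 r : 0 < plim r.
Proof.
apply: lt_le_trans (partial_le_plim r.+1 r).
rewrite /partial (bigD1 (Ordinal (ltnSn r))) //= ltr_wpDr ?al_gt0 //.
by apply: sumr_ge0.
Qed.

Lemma al_fill_lim r : (fun i => (d * i + r).+1%:R * al (d * i + r).+1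
   / h (d * i + r).+1) @ \oo --> plim r.
Proof.
apply/cvgrPdist_le => e e0; have e2 : 0 < e / 2 by rewrite divr_gt0.
have [J1 h1] := partial_cvg r e2; have [J2 h2] := partial_approx e2.
have [N1 _ hN] := h2 (maxn J1 J2) (leq_maxr _ _).
have [N0 _ h0] := fill_gt0.
exists (maxn N0 N1) => // i /=; rewrite geq_max => /andP[i0 i1].
pose n := (d * i + r)%N; rewrite -/n.
have ni : (i <= n)%N by apply: leq_trans (leq_addr _ _); rewrite leq_pmull.
have hn : 0 < h n.+1 by apply: h0 => /=; apply: leqW; exact: leq_trans ni.
have := hN n (leq_trans i1 ni) => /=.
rewrite (@partial_mod _ n r); last by rewrite /n mulnC modnMDl.
have := h1 (maxn J1 J2) (leq_maxl _ _).
set p := partial _ r; set y := _ * al n.+1 => a b.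
have {}b : `|y / h n.+1 - p| <= e / 2.
  have -> : y / h n.+1 - p = (y - p * h n.+1) / h n.+1.
    by rewrite mulrBl mulfK // gt_eqF.
  by rewrite normrM normfV (gtr0_norm hn) ler_pdivrMr.
have -> : plim r - y / h n.+1 = - ((p - plim r) + (y / h n.+1 - p)) by ring.
by rewrite normrN; apply: le_trans (ler_normD _ _) _; lra.
Qed.

(** The quotient of two consecutive limits of [al_fill_lim], in which the ratios of the factors n
    and h tend to 1. *)
Lemma al_ratio r : (fun i => al (d * i + r).+1 / al (d * i + r).+2) @ \oo -->
  plim r / plim r.+1.
Proof.
have sub i : (i <= (d * i + r).+1)%N.
  by apply: leqW; apply: leq_trans (leq_addr _ _); rewrite leq_pmull.
have sub' i : (i <= d * i + r)%N.
  by apply: leq_trans (leq_addr _ _); rewrite leq_pmull.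
have c1 := @al_fill_lim r; have c2 := @al_fill_lim r.+1.
have nz : plim r.+1 != 0 by rewrite gt_eqF // plim_gt0.
have /(_ _) c3 := cvgV nz c2.
have /(_ _) c4 := cvgM c1 c3.
have c5 := cvg_subseq sub fill_ratio.
have c6 := cvg_subseq sub' (@linear_ratio R 1 isT).
have /(_ _) c7 := cvgM c4 c5.
have /(_ _) lim := cvgM c7 c6.
rewrite !mulr1 in lim; apply: cvg_near_eq lim.
have [N0 _ h0] := fill_gt0; exists N0 => // i /= i0.
pose n := (d * i + r)%N; rewrite addnS -/n.
have h1 : 0 < h n.+1 by apply: h0; exact: leq_trans i0 (sub i).
have h2 : 0 < h n.+2 by apply: h0; apply: leqW; exact: leq_trans i0 (sub i).
have a2 := al_gt0 n.+2.
rewrite !mul1n !add1n.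
have n1 : n.+1%:R != 0 :> R by rewrite pnatr_eq0.
have n2 : n.+2%:R != 0 :> R by rewrite pnatr_eq0.
move: n1 n2; move: n.+1%:R n.+2%:R => u v u0 v0.
by field; rewrite u0 v0 !gt_eqF.
Qed.

Lemma al_summable : exists B, forall J, \sum_(j < J) al j <= B.
Proof.
have [B hB] := partial_bounded; exists (d%:R * B) => J.
rewrite (partition_big (fun j : 'I_J => Ordinal (ltn_pmod j d0)) xpredT) //=.
apply: le_trans (_ : \sum_(r < d) B <= _); last first.
  by rewrite sumr_const card_ord mulr_natl.
apply: ler_sum => r _; apply: le_trans (hB J r).
rewrite le_eqVlt; apply/orP; left; apply/eqP; apply: eq_bigl => j.
by rewrite [(r %% d)%N]modn_small.
Qed.

End Transfer.


(** * Convolution inverse and residue classes *)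

Lemma exp_truncS (R : realType) N (p : {poly R}) : p`_0 = 0 ->
  eqX N (exp_trunc N.+1 p) (exp_trunc N p).
Proof.
move=> p0 i iN; rewrite /exp_trunc big_ord_recr /= coefD coefZ.
by rewrite coef_exp_lt // mulr0 addr0.
Qed.

(** The product has constant term 1, and its derivative vanishes up to the order lost in
    [deriv_exp_trunc]. *)
Lemma exp_trunc_inv (R : realType) N (p : {poly R}) : p`_0 = 0 ->
  eqX N (exp_trunc N p * exp_trunc N (- p)) 1.
Proof.
move=> p0; have q0 : (- p)`_0 = 0 by rewrite coefN p0 oppr0.
case: N => [|N] // [|n] nN.
  by rewrite coefM big_ord1 !exp_trunc0 // mulr1 coef1.
apply: (mulfI (x := n.+1%:R)); first by rewrite pnatr_eq0.
rewrite mulr_natl -coef_deriv coef1 mulr0 derivM !deriv_exp_trunc derivN mulNr mulrN.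
rewrite coefB; apply/eqP; rewrite subr_eq0; apply/eqP.
have s1 := exp_truncS (N := N) p0; have s2 := exp_truncS (N := N) q0.
have -> : exp_trunc N.+1 p * (p^`() * exp_trunc N (- p)) =
  p^`() * exp_trunc N.+1 p * exp_trunc N (- p) by ring.
have nN' : (n < N)%N by [].
have h1 := eqX_mul (N := N) (fun i _ => erefl (p^`()`_i)) (eqX_sym s1).
by apply: (eqX_mul h1 s2).
Qed.

Section Residues.
Variable R : realType.
Variables (al be : nat -> R) (d : nat).
Hypotheses (d2 : (2 <= d)%N) (al_ge0 : forall n, 0 <= al n)
  (al_sum : exists B, forall J, \sum_(j < J) al j <= B)
  (be_le : forall n, `|be n| <= al n) (ab0 : al 0%N * be 0%N = 1)
  (ab : forall n, \sum_(i < n.+2) al i * be (n.+1 - i)%N = 0).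

Lemma sum_triangle (F : nat -> nat -> R) N :
  \sum_(i < N) \sum_(j < N - i) F i j = \sum_(n < N) \sum_(i < n.+1) F i (n - i)%N.
Proof.
elim: N => [|N IH]; first by rewrite !big_ord0.
rewrite [RHS]big_ord_recr /= -IH big_ord_recr /= subSnn big_ord1.
rewrite [X in _ = _ + X]big_ord_recr /= subnn addrA; congr (_ + _).
rewrite -big_split; apply: eq_bigr => -[i /= iN] _.
by rewrite subSn ?(ltnW iN) // big_ord_recr.
Qed.

(* If the residue classes all carry the same part of the sum of al, the part of
   al * be in the class of 0 equals that in the class of 1; but al * be is the
   identity of the convolution. *)
Lemma residues_distinct (L : R) :
  ~ (forall r (e : R), 0 < e -> exists J0, forall J, (J0 <= J)%N ->
       `|partial al d J r - L| <= e).
Proof.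
move=> hL; have [B0 hB0] := al_sum.
pose B := Num.max B0 1.
have B1 : 1 <= B by rewrite le_max lexx orbT.
have hB J : \sum_(j < J) al j <= B by apply: le_trans (hB0 J) _; rewrite le_max lexx.
have B_gt0 : 0 < B by apply: lt_le_trans B1.
(* With 1 / (8 B), each of the four errors below costs at most 1/8: two classes in the full square,
   two kinds of pairs outside the triangle. Their total 1/2 is less than 1. *)
have [J1 h1] : exists J1, forall J r, (J1 <= J)%N ->
    `|partial al d J r - L| <= 1 / (8 * B).
  have e0 : 0 < 1 / (8 * B) by rewrite divr_gt0 // mulr_gt0.
  have all_r K : exists J1, forall J r, (J1 <= J)%N -> (r < K)%N ->
      `|partial al d J r - L| <= 1 / (8 * B).
    elim: K => [|k [J1 h]]; first by exists 0%N.
    have [J2 h2] := hL k _ e0; exists (maxn J1 J2) => J r.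
    rewrite geq_max => /andP[j1 j2]; rewrite ltnS leq_eqVlt => /orP[/eqP ->|rk].
      exact: h2.
    exact: h.
  have [J1 h] := all_r d; exists J1 => J r j1.
  have -> : partial al d J r = partial al d J (r %% d)%N.
    by apply: partial_mod; rewrite modn_mod.
  by apply: h => //; rewrite ltn_pmod // ltnW.
pose E := range (fun J => \sum_(j < J) al j).
have hE : has_sup E.
  by split; [exists (\sum_(j < 0) al j); exists 0%N | exists B => _ [J _ <-]].
have e0 : 0 < 1 / (8 * B) by rewrite divr_gt0 // mulr_gt0.
have [_ [J2 _ <-] hJ2] := sup_adherent e0 hE.
pose m := (maxn J1 J2).+1; pose N := (m + m)%N.
have N0 : (0 < N)%N by rewrite addn_gt0.
have Jm1 : (J1 <= m)%N by apply: leqW; exact: leq_maxl.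
have Jm2 : (J2 <= m)%N by apply: leqW; exact: leq_maxr.
have tailm : \sum_(j < N | (m <= j)%N) al j <= 1 / (8 * B).
  have sN : \sum_(j < N) al j <= sup E by apply: ub_le_sup; [case: hE | exists N].
  have sm : \sum_(j < J2) al j <= \sum_(j < N | ~~ (m <= j)%N) al j.
    rewrite (big_ord_widen N al); last by rewrite (leq_trans Jm2) // leq_addr.
    rewrite [X in X <= _]big_mkcond [X in _ <= X]big_mkcond; apply: ler_sum => j _ /=.
    rewrite -ltnNge; case: ifP => jJ; last by case: ifP.
    by rewrite (leq_trans jJ).
  move: sN; rewrite (bigID (fun j : 'I_N => (m <= j)%N)) /=; lra.
have JN : (J1 <= N)%N by apply: leq_trans Jm1 (leq_addr _ _).
(* A test function telling class 0 from class 1. As d >= 2 it is 1 at 0, so its sum against the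
   convolution of [al] and [be] is 1. *)
pose chi n : R := (n == 0 %[mod d])%N%:R - (n == 1 %[mod d])%N%:R.
pose F i j := al i * be j * chi (i + j)%N.
have chi0 : chi 0%N = 1.
  by rewrite /chi eqxx eq_sym [(1 %% d)%N]modn_small // mod0n subr0.
have chi_le n : `|chi n| <= 1.
  rewrite /chi; case: eqP => [->|_]; last by rewrite sub0r normrN; case: eqP; rewrite ?normr0 ?normr1.
  by rewrite mod0n modn_small // subr0 normr1.
have F_le i j : `|F i j| <= al i * al j.
  rewrite /F !normrM (ger0_norm (al_ge0 i)) -[X in _ <= X]mulr1.
  by apply: ler_pM => //; rewrite ?mulr_ge0 // ler_wpM2l.
have tri : \sum_(i < N) \sum_(j < N - i) F i j = 1.
  rewrite sum_triangle.
  have -> : \sum_(n < N) \sum_(i < n.+1) F i (n - i)%N =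
      \sum_(n < N) chi n * \sum_(i < n.+1) al i * be (n - i)%N.
    apply: eq_bigr => n _; rewrite mulr_sumr; apply: eq_bigr => -[i /= ile] _.
    by rewrite /F subnKC // mulrC.
  rewrite (bigD1 (Ordinal N0)) //= big_ord1 chi0 mul1r ab0 big1 ?addr0 //.
  by move=> -[[|n] /= nN] // _; rewrite ab mulr0.
set T := \sum_(j < N | _) _ in tailm.
have T0 : 0 <= T by apply: sumr_ge0.
(* Outside the triangle i + j >= 2 m, so one of the two indices is at least m. *)
have rest : `|\sum_(i < N) \sum_(j < N | (N - i <= j)%N) F i j| <= 1 / 4.
  apply: le_trans (ler_norm_sum _ _ _) _.
  apply: le_trans (_ : \sum_(i < N) (al i * T + (if (m <= i)%N then al i else 0) * B) <= _).
    apply: ler_sum => -[i /= iN] _; apply: le_trans (ler_norm_sum _ _ _) _.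
    apply: le_trans (_ : al i * \sum_(j < N | (N - i <= j)%N) al j <= _).
      by rewrite mulr_sumr; apply: ler_sum => j _; exact: F_le.
    case: ifP => mi.
      apply: le_trans (_ : al i * B <= _); last by rewrite lerDr mulr_ge0.
      rewrite ler_wpM2l //; apply: le_trans (hB N).
      by rewrite [X in X <= _]big_mkcond; apply: ler_sum => j _; case: ifP.
    rewrite mul0r addr0 ler_wpM2l // /T.
    rewrite [X in X <= _]big_mkcond [X in _ <= X]big_mkcond; apply: ler_sum => j _ /=.
    case: ifP => [h|_]; last by case: ifP.
    have -> // : (m <= j)%N.
    by apply: leq_trans h; rewrite /N; move: mi; clear; lia.
  rewrite big_split /= -!mulr_suml -big_mkcond /= -/T.
  have hT : B * T <= 1 / 8.
    by apply: le_trans (ler_wpM2l (ltW B_gt0) tailm) _; rewrite le_eqVlt; apply/orP; left;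
      apply/eqP; field; rewrite gt_eqF.
  have := ler_wpM2r T0 (hB N); rewrite [T * B]mulrC; lra.
(* (d - 1) j stands for - j modulo d. *)
pose r0 j := (d.-1 * j)%N; pose r1 j := (d.-1 * j + 1)%N.
have dj j : (d.-1 * j + j = d * j)%N by rewrite -mulSnr prednK // ltnW.
have c0 i j : (i + j == 0 %[mod d])%N = (i == r0 j %[mod d])%N.
  by rewrite /r0 -(eqn_modDr j i) dj modnMr mod0n.
have c1 i j : (i + j == 1 %[mod d])%N = (i == r1 j %[mod d])%N.
  by rewrite /r1 -(eqn_modDr j i) addnAC dj mulnC modnMDl.
have full : \sum_(i < N) \sum_(j < N) F i j =
    \sum_(j < N) be j * (partial al d N (r0 j) - partial al d N (r1 j)).
  rewrite exchange_big; apply: eq_bigr => j _ /=.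
  rewrite /partial [X in _ * (X - _)]big_mkcond [X in _ * (_ - X)]big_mkcond -sumrB mulr_sumr; apply: eq_bigr => i _.
  by rewrite /F /chi c0 c1; do 2 case: (_ == _); rewrite /=; ring.
have Qle : `|\sum_(i < N) \sum_(j < N) F i j| <= 1 / 4.
  rewrite full; apply: le_trans (ler_norm_sum _ _ _) _.
  apply: le_trans (_ : \sum_(j < N) al j * (1 / (4 * B)) <= _).
    apply: ler_sum => j _; rewrite normrM; apply: ler_pM => //.
    have a := h1 N (r0 j) JN; have b := h1 N (r1 j) JN.
    have -> : partial al d N (r0 j) - partial al d N (r1 j) =
      (partial al d N (r0 j) - L) - (partial al d N (r1 j) - L) by ring.
    apply: le_trans (ler_normB _ _) _.
    have -> : 1 / (4 * B) = 1 / (8 * B) + 1 / (8 * B) by field; rewrite gt_eqF.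
    exact: lerD.
  rewrite -mulr_suml; apply: le_trans (ler_wpM2r _ (hB N)) _.
    by rewrite divr_ge0 // mulr_ge0 // ltW.
  by rewrite le_eqVlt; apply/orP; left; apply/eqP; field; rewrite gt_eqF.
have split_sum : \sum_(i < N) \sum_(j < N) F i j =
    1 + \sum_(i < N) \sum_(j < N | (N - i <= j)%N) F i j.
  rewrite -tri -big_split; apply: eq_bigr => i _ /=.
  rewrite (bigID (fun j : 'I_N => (j < N - i)%N)) /=; congr (_ + _).
    by rewrite [RHS](big_ord_widen N (F i)) // leq_subr.
  by apply: eq_bigl => j; rewrite -leqNgt.
move: Qle rest; rewrite split_sum; set X := \sum_(i < N) _.
by rewrite !ler_norml => /andP[_ a] /andP[b _]; lra.
Qed.

End Residues.


(** * Radius of convergence *)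

Lemma pseries_cvg (R : realType) (u : nat -> R) (x : R) :
  (forall n, 0 <= u n) -> 0 <= x ->
  (exists B, forall J, \sum_(j < J) u j * x ^+ j <= B) -> cvgn (pseries u x).
Proof.
move=> u0 x0 [B hB]; apply: nondecreasing_is_cvgn.
  apply/nondecreasing_seqP => n; rewrite /pseries !seriesEord /= big_ord_recr /=.
  by rewrite lerDl mulr_ge0 // exprn_ge0.
exists B => _ [n _ <-]; rewrite /pseries seriesEord /=; exact: hB.
Qed.

(** Beyond [rho] the terms are eventually nondecreasing and do not tend to 0. Below [rho] the terms
    at a point [y] between [x] and [rho] are bounded, so those at [x] decay geometrically. *)
Lemma convergence_radius_ratio (R : realType) (u : nat -> R) (rho : R) :
  (forall n, 0 < u n) -> 0 < rho ->
  (fun n => u n / u n.+1) @ \oo --> rho -> convergence_radius u = rho%:E.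
Proof.
move=> u0 r0 /cvgrPdist_lt lim; rewrite /convergence_radius.
set S := [set _ | _ in _].
have ub x : cvgn (pseries u x) -> `|x| <= rho.
  move=> cx; rewrite leNgt; apply/negP => rx.
  have e0 : 0 < `|x| - rho by rewrite subr_gt0.
  have [N _ hN] := lim _ e0.
  have x0 : 0 < `|x| by exact: lt_trans rx.
  have inc n : (N <= n)%N -> u N * `|x| ^+ N <= u n * `|x| ^+ n.
    elim: n => [|n IH]; first by rewrite leqn0 => /eqP ->.
    rewrite leq_eqVlt => /orP[/eqP -> //|Nn]; apply: le_trans (IH Nn) _.
    rewrite exprS mulrA ler_pM2r ?exprn_gt0 // mulrC -ler_pdivrMr //.
    have := hN n Nn; rewrite /= ltr_distl => /andP[h _]; lra.
  have c0 : 0 < u N * `|x| ^+ N by rewrite mulr_gt0 // exprn_gt0.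
  have /cvgrPdist_lt /(_ _ c0) [N' _ h] := cvg_series_cvg_0 cx.
  have := h (maxn N N') (leq_maxr _ _); rewrite /= sub0r normrN normrM normrX.
  by rewrite (gtr0_norm (u0 _)) ltNge inc // leq_maxl.
have conv x : 0 < x -> x < rho -> cvgn (pseries u x).
  move=> x0 xr; pose y := (x + rho) / 2.
  have xy : x < y by rewrite /y; lra.
  have yr : y < rho by rewrite /y; lra.
  have y0 : 0 < y by exact: lt_trans xy.
  have e0 : 0 < rho - y by rewrite subr_gt0.
  have [N _ hN] := lim _ e0.
  have dec n : (N <= n)%N -> u n * y ^+ n <= u N * y ^+ N.
    elim: n => [|n IH]; first by rewrite leqn0 => /eqP ->.
    rewrite leq_eqVlt => /orP[/eqP -> //|Nn]; apply: le_trans (IH Nn).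
    rewrite exprS mulrA ler_pM2r ?exprn_gt0 // mulrC -ler_pdivlMr //.
    have := hN n Nn; rewrite /= ltr_distl => /andP[_ h]; lra.
  apply: pseries_cvg; [by move=> n; exact: ltW | exact: ltW |].
  apply: (@geometric_bounded R (fun j => u j * x ^+ j) (x / y) (u N * y ^+ N) N).
  - by rewrite divr_ge0 ?(ltW x0) ?(ltW y0) //= ltr_pdivrMr // mul1r.
  - by rewrite mulr_ge0 ?exprn_ge0 // ltW.
  - by move=> n; rewrite mulr_ge0 ?exprn_ge0 // ltW.
  - move=> n Nn; have -> : u n * x ^+ n = u n * y ^+ n * (x / y) ^+ n.
      by rewrite -mulrA -exprMn [y * _]mulrC divfK // gt_eqF.
    by rewrite ler_wpM2r ?dec // exprn_ge0 // divr_ge0 // ltW.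
apply/eqP; rewrite eq_le; apply/andP; split.
  by apply: ge_ereal_sup => _ [x cx <-]; rewrite lee_fin ub.
rewrite leNgt; apply/negP => lt.
have Sle x : 0 < x -> x < rho -> (x%:E <= ereal_sup S)%E.
  move=> x0 xr; apply: ereal_sup_ubound; exists x; first exact: conv.
  by rewrite gtr0_norm.
have r2 : 0 < rho / 2 by rewrite divr_gt0.
have r2r : rho / 2 < rho by lra.
have := Sle _ r2 r2r; case: (ereal_sup S) lt Sle => [s||] lt Sle // h.
move: lt h; rewrite lte_fin lee_fin => sr rs.
have m1 : 0 < (s + rho) / 2 by lra.
have m2 : (s + rho) / 2 < rho by lra.
by have := Sle _ m1 m2; rewrite lee_fin; lra.
Qed.

(** At a quarter of a point of convergence, n (1/4)^n <= (1/2)^n absorbs the factor n. *)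
Lemma small_bounded (R : realType) (a t : nat -> R) :
  (forall n, 0 <= a n) -> (forall n, 0 <= t n) -> (forall n, t n <= n%:R * a n) ->
  (0 < convergence_radius a)%E ->
  exists2 x : R, 0 < x & exists M : R, forall N, (trunc N t).[x] <= M.
Proof.
move=> a0 t0 ta /ereal_sup_gt [_ [x cx <-]]; rewrite lte_fin => x0.
exists (`|x| / 4); first by rewrite divr_gt0.
have /cvgrPdist_lt /(_ _ ltr01) [N _ h] := cvg_series_cvg_0 cx.
have [B hB] : exists B, forall J, \sum_(j < J) t j * (`|x| / 4) ^+ j <= B.
  apply: (@geometric_bounded R (fun j => t j * (`|x| / 4) ^+ j) (1 / 2) 1 N) => //.
  - by apply/andP; split; lra.
  - by move=> n; rewrite mulr_ge0 // exprn_ge0 // divr_ge0.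
  move=> n Nn; rewrite mul1r.
  have := h n Nn; rewrite /= sub0r normrN normrM normrX (ger0_norm (a0 n)) => /ltW hn.
  apply: le_trans (_ : n%:R * a n * (`|x| / 4) ^+ n <= _).
    by rewrite ler_wpM2r // exprn_ge0 // divr_ge0.
  have -> : n%:R * a n * (`|x| / 4) ^+ n = (a n * `|x| ^+ n) * (n%:R * (1 / 4) ^+ n).
    by rewrite [`|x| / 4]mulrC exprMn div1r; ring.
  apply: le_trans (_ : 1 * (n%:R * (1 / 4) ^+ n) <= _).
    by rewrite ler_wpM2r // mulr_ge0 // exprn_ge0 // divr_ge0.
  have -> : 1 / 4 = 1 / 2 * (1 / 2) :> R by field.
  have p2 : 0 <= (1 / 2 : R) ^+ n by rewrite exprn_ge0 // divr_ge0.
  rewrite mul1r exprMn mulrA -[X in _ <= X]mul1r ler_wpM2r //.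
  rewrite expr_div_n expr1n mulrA mulr1 ler_pdivrMr ?exprn_gt0 // mul1r.
  by rewrite -natrX ler_nat ltnW // ltn_expl.
by exists B => J; rewrite trunc_hornerE.
Qed.

Lemma cvg_mull (R : realType) (k l : R) (f : nat -> R) :
  f @ \oo --> l -> (fun n => k * f n) @ \oo --> k * l.
Proof.
move=> cf; have /(_ _) ck := @cvg_cst R k nat \oo.
by have /(_ _) := cvgM ck cf.
Qed.

Unset Implicit Arguments.
Set Strict Implicit.
Set Printing Implicit Defensive.

Theorem theorem4p3 (R : realType) (A : graph_family)
    (A_class : graph_class A)
    (A_small : small_family R A)
    (A_block_stable : block_stable A)
    (B_nonempty : nonempty_family (block_family A))
    (d : nat)
    (d_gcd : is_gcd
       (fun k => 0 < fps_exp (pseries_diffs (egf R (block_family A))) k) d) :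
  smooth_family R A <-> d = 1%N.
Proof.
pose a := egf R A; pose t := tree_coef R A; pose phi := block_exp R A.
have a_ge0 n : 0 <= a n by rewrite mulr_ge0 ?invr_ge0.
have bd0 := @block_diff0 R A.
have bd_ge0 := @block_diff_ge0 R A.
have phi_ge0 n : 0 <= phi n by apply: fps_exp_ge0.
have phi0 : phi 0%N = 1 by apply: fps_exp0.
have phiD k l : 0 < phi k -> 0 < phi l -> 0 < phi (k + l)%N by apply: fps_exp_suppD.
have phi_pos : exists2 k, (2 <= k)%N & 0 < phi k by exact: block_exp_nontrivial.
have t_ge0 := tree_coef_ge0 R A.
have t0 : t 0%N = 0 := tree_coef0 R A.
have t1 : t 1%N = 1 by exact: tree_coef1.
have t_fix N : eqX N (trunc N t) ('X * (trunc N phi \Po trunc N t)).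
  exact: tree_coef_fixpoint.
have t_small := small_bounded a_ge0 t_ge0 (tree_coef_le R A) A_small.
have [K K2 phiK] := phi_pos.
have [rho [tau [rho0 tau0 rho_tau rho_max]]] :=
  critical_point phi_ge0 t_ge0 t0 t1 t_fix K2 phiK t_small.
pose ts := tn t rho.
have ts_ge0 n : 0 <= ts n by exact: tn_ge0.
have ts_supp n : ts n != 0 -> (0 < n)%N /\ (d %| n.-1)%N.
  exact: (tn_supp phi_ge0 d_gcd t0 t_fix rho0 tau0).
have ts1 : 0 < ts 1%N by rewrite /ts /tn t1 mul1r expr1.
have ts_gt0 : \forall i \near \oo, 0 < ts (1 + d * i)%N.
  exact: (tn_gt0_near phi_ge0 phi0 phiD phi_pos d_gcd t_ge0 t0 t_fix rho0 tau0 rho_max).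
have ts_ratio : (fun i => ts (1 + d * i)%N / ts (1 + d * i.+1)%N) @ \oo --> (1 : R).
  exact: (tn_ratio phi_ge0 phi0 phiD phi_pos d_gcd t_ge0 t0 t_fix rho0 tau0 rho_tau rho_max).
have ts_conv := tn_conv phi_ge0 phi0 phiD phi_pos d_gcd t_ge0 t0 t_fix rho0 tau0 rho_tau rho_max.
have d0 : (0 < d)%N by case: d_gcd => h _; apply: dvdn_gt0 (h K phiK); exact: ltnW.
pose al n := a n * rho ^+ n.
have al0 : al 0%N = 1 by rewrite /al expr0 mulr1 /a egf0.
have al_ge0 n : 0 <= al n by rewrite mulr_ge0 ?exprn_ge0 // ltW.
have al_rec n : n.+1%:R * al n.+1 = \sum_(k < n.+1) ts k.+1 * al (n - k)%N.
  rewrite /al mulrA /a egf_rec // mulr_suml; apply: eq_bigr => -[k /= kn] _.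
  have -> : rho ^+ n.+1 = rho ^+ k.+1 * rho ^+ (n - k) by rewrite -exprD addSn subnKC.
  by rewrite /ts /tn /t /a; ring.
have al_pos n : 0 < al n := al_gt0 ts_ge0 ts1 al0 al_ge0 al_rec n.
have a_pos n : 0 < a n by have := al_pos n; rewrite pmulr_lgt0 // exprn_gt0.
have rat n : a n / a n.+1 = rho * (al n / al n.+1).
  by rewrite /al exprS; field; rewrite !gt_eqF ?exprn_gt0.
have lim r := @al_ratio R ts al d d0 ts_ge0 ts_supp ts1 ts_gt0 ts_ratio ts_conv al0 al_ge0 al_rec r.
pose L := plim al d.
have L_gt0 r : 0 < L r :=
  plim_gt0 d0 ts_ge0 ts_supp ts1 ts_gt0 ts_ratio ts_conv al0 al_ge0 al_rec r.
have L_mod r r' : (r = r' %[mod d])%N -> L r = L r' by exact: plim_mod.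
split=> [[rho' [rho'0 _ limA]]|d1]; last first.
  have limA : (fun n => a n / a n.+1) @ \oo --> rho.
    have e : (fun n => rho * (al n.+1 / al n.+2)) = (fun n => a n.+1 / a n.+2).
      by apply/funext => n; rewrite rat.
    have lim0 : (fun n => al n.+1 / al n.+2) @ \oo --> (1 : R).
      (* With d = 1 there is a single residue class, so the limit L 0 / L 1 is 1. *)
      have := lim 0%N; rewrite -/L (L_mod 1%N 0%N) ?d1 ?modn1 // divff ?gt_eqF //.
      by under eq_fun do rewrite mul1n addn0.
    have := @cvg_mull R rho 1 _ lim0; rewrite mulr1 e => h.
    by rewrite -cvg_shiftS.
  by exists rho; split=> //; exact: convergence_radius_ratio.
pose q := rho' / rho; have q0 : 0 < q by rewrite divr_gt0.
have limq : (fun n => al n / al n.+1) @ \oo --> q.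
  rewrite /q mulrC; have e : (fun n => al n / al n.+1) = (fun n => rho^-1 * (a n / a n.+1)).
    by apply/funext => n; rewrite rat mulKf // gt_eqF.
  by rewrite e; apply: cvg_mull.
(* The ratios tend to [q] along all indices, and to [L r / L r.+1] along one residue class. *)
have Lq r : L r = q * L r.+1.
  have sub i : (i <= (d * i + r).+1)%N.
    by apply: leqW; apply: leq_trans (leq_addr _ _); rewrite leq_pmull.
  have e : L r / L r.+1 = q.
    by apply: (cvg_unique _ (lim r) (cvg_subseq sub limq)); exact: norm_hausdorff.
  by have := congr1 (fun x => x * L r.+1) e; rewrite /= divfK ?gt_eqF // => ->.
have Lk k : L 0%N = q ^+ k * L k.
  by elim: k => [|k IH]; rewrite ?expr0 ?mul1r // exprSr -mulrA -Lq.
(* After [d] steps the residue class recurs, so q^d = 1 with q > 0. *)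
have q1 : q = 1.
  apply/eqP; rewrite -(@pexpr_eq1 _ _ d) // ?(ltW q0) //; apply/eqP.
  have := Lk d; rewrite (L_mod d 0%N) ?modnn ?mod0n // => h.
  by apply: (mulIf (lt0r_neq0 (L_gt0 0%N))); rewrite mul1r.
have Lc r : L r = L 0%N by rewrite (Lk r) q1 expr1n mul1r.
case: (ltngtP d 1) => // [|d2]; first by rewrite ltnNge d0.
(* Dividing by n turns z C' back into C: [c] holds the coefficients of C(rho z), and [al] those of
   its exponential. At index 0 the quotient is the wanted 0. *)
exfalso; pose c n := ts n / n%:R.
have c0 : c 0%N = 0 by rewrite /c /ts /tn t0 !mul0r.
have tr0 N : (trunc N c)`_0 = 0 by rewrite coef_poly c0 if_same.
have alE n N : (n < N)%N -> al n = (exp_trunc N (trunc N c))`_n.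
  apply: (@exp_trunc_uniq R N (trunc N c) al) => // m mN.
  rewrite al_rec; apply: eq_bigr => -[k /= km] _; congr (_ * _).
  by rewrite coef_trunc ?(leq_ltn_trans km) // /c mulrCA divff ?mulr1 // pnatr_eq0.
(* The coefficients of exp(- C(rho z)), the convolution inverse of [al]. *)
pose be n := (exp_trunc n.+1 (- trunc n.+1 c))`_n.
have beE n N : (n < N)%N -> be n = (exp_trunc N (- trunc N c))`_n.
  move=> nN; have tN0 : (- trunc N c)`_0 = 0 by rewrite coefN tr0 oppr0.
  transitivity ((exp_trunc n.+1 (- trunc N c))`_n).
    apply: (@eqX_exp_trunc _ n.+1) => // i ile; rewrite !coefN !coef_trunc //.
    exact: leq_trans nN.
  rewrite /exp_trunc !coef_sum.
  symmetry; apply: (@sum_ord_widen _ (fun j => ((j`!%:R)^-1 *: (- trunc N c) ^+ j)`_n)) => //.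
  by move=> j nj; rewrite coefZ coef_exp_lt ?mulr0.
have c_ge0 n : 0 <= c n by rewrite divr_ge0.
(* The expansions of both exponentials agree up to signs (-1)^j, and the terms for [al] are
   nonnegative. *)
have be_le n : `|be n| <= al n.
  rewrite (alE n n.+1) // /be /exp_trunc !coef_sum.
  apply: le_trans (ler_norm_sum _ _ _) _; apply: ler_sum => j _.
  rewrite !coefZ normrM ger0_norm ?invr_ge0 // ler_wpM2l ?invr_ge0 //.
  rewrite exprNn -signr_odd; have tc := @coef_exp_ge0 R (trunc n.+1 c) j n.
  have {}tc : 0 <= ((trunc n.+1 c) ^+ j)`_n by apply: tc => i; apply: trunc_coef_ge0.
  by case: odd; rewrite ?expr0 ?expr1 ?mulN1r ?mul1r ?coefN ?normrN ger0_norm.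
have conv n : \sum_(i < n.+1) al i * be (n - i)%N = (n == 0%N)%:R.
  have := @exp_trunc_inv R n.+1 (trunc n.+1 c) (tr0 _) n (ltnSn n).
  rewrite coef1 => <-; rewrite coefM; apply: eq_bigr => -[i /= ile] _.
  by rewrite (alE i n.+1) // (beE (n - i)%N n.+1) // ltnS leq_subr.
apply: (@residues_distinct R al be d d2 al_ge0 _ be_le _ _ (L 0%N)).
- exact: (al_summable d0 ts_ge0 ts_supp ts1 ts_gt0 ts_ratio ts_conv al_ge0 al_rec).
- by have := conv 0%N; rewrite big_ord1.
- by move=> n; rewrite conv.
move=> r e e0; rewrite -(Lc r).
exact: (partial_cvg d0 ts_ge0 ts_supp ts1 ts_gt0 ts_ratio ts_conv al_ge0 al_rec).
Qed.
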